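(* Let $\mathbb{F}$ be a field with $\operatorname{char}\mathbb{F}\neq 2,3$, and let $A$ and $B$ be unital locally matrix $\mathbb{F}$-algebras. If the groups $[A^{*},A^{*}]$ and $[B^{*},B^{*}]$ are isomorphic, then the rings $A$ and $B$ are isomorphic or anti-isomorphic. Moreover, for an arbitrary group isomorphism $\varphi:[A^{*},A^{*}]\to[B^{*},B^{*}]$, either there exists an isomorphism of rings $\theta_1:A\to B$ such that $\varphi$ is the restriction of $\theta_1$ to $[A^{*},A^{*}]$, or there exists an anti-isomorphism of rings $\theta_2:A\to B$ such that $\varphi(g)=\theta_2(g^{-1})$ for every $g\in[A^{*},A^{*}]$.
   Context: An associative $\mathbb{F}$-algebra $A$ with unit $1$ is a unital locally matrix algebra if for every finite collection $a_1,\ldots,a_t\in A$ there is a subalgebra $A'\subset A$ with $1,a_1,\ldots,a_t\in A'$ and $A'\cong M_n(\mathbb{F})$ for some $n\in\mathbb{N}$ (positive integers). No restriction is placed on the dimension of $A$. $A^{*}$ denotes the group of invertible elements of $A$, and $[A^{*},A^{*}]$ its commutator subgroup. A map $\varphi:R\to S$ of rings is an anti-isomorphism if it is an isomorphism of additive groups and $\varphi(ab)=\varphi(b)\varphi(a)$ for all $a,b\in R$. Ring isomorphisms and anti-isomorphisms are not required to be $\mathbb{F}$-linear. ''Either ... or'' is understood non-exclusively. *)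

(* Defs.v *)
From HB Require Import structures.
From mathcomp Require Import all_boot all_algebra.
From mathcomp Require Import boolp.

Set Implicit Arguments.
Unset Strict Implicit.
Unset Printing Implicit Defensive.

Import GRing.Theory.
Local Open Scope ring_scope.

(* The library's {unit R} only exists for finite rings; this is the same      *)
(* construction for an arbitrary unitRingType.                                *)
Section UnitGroup.
Variable R : unitRingType.

Record unit_group := UnitGroup {
  unit_group_val : R;
  unit_group_valP : unit_group_val \is a GRing.unit }.

HB.instance Definition _ := [isSub for unit_group_val].
HB.instance Definition _ := [Choice of unit_group by <:].

Implicit Types u v w : unit_group.

Definition unit_group1 := UnitGroup (unitr1 R).

Fact unit_groupV_subproof u : (val u)^-1 \is a GRing.unit.
Proof. by rewrite unitrV (valP u). Qed.
Definition unit_groupV u := UnitGroup (unit_groupV_subproof u).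

Fact unit_groupM_subproof u v : val u * val v \is a GRing.unit.
Proof. by rewrite (unitrMr _ (valP u)) (valP v). Qed.
Definition unit_groupM u v := UnitGroup (unit_groupM_subproof u v).

Fact unit_groupMA : associative unit_groupM.
Proof. by move=> u v w; apply/val_inj/mulrA. Qed.
Fact unit_group1M : left_id unit_group1 unit_groupM.
Proof. by move=> u; apply/val_inj/mul1r. Qed.
Fact unit_groupM1 : right_id unit_group1 unit_groupM.
Proof. by move=> u; apply/val_inj/mulr1. Qed.
Fact unit_groupVM : left_inverse unit_group1 unit_groupV unit_groupM.
Proof. by move=> u; apply/val_inj/(mulVr (valP u)). Qed.
Fact unit_groupMV : right_inverse unit_group1 unit_groupV unit_groupM.
Proof. by move=> u; apply/val_inj/(mulrV (valP u)). Qed.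

HB.instance Definition _ := isGroup.Build unit_group
  unit_groupMA unit_group1M unit_groupM1 unit_groupVM unit_groupMV.

End UnitGroup.

(* The commutator subgroup [G, G] of a possibly infinite group, as the        *)
(* smallest subgroup of G containing all commutators.                         *)
Section CommutatorSubgroup.
Variable G : groupType.
Local Open Scope group_scope.

Definition in_commutators : {pred G} := fun x =>
  `[< forall H : {pred G}, group_closed H ->
        (forall y z : G, [~ y, z] \in H) -> x \in H >].

Fact in_commutators_group_closed : group_closed in_commutators.
Proof.
split=> [|x y /asboolP Kx /asboolP Ky]; apply/asboolP => H gH cH.
  by case: gH.
by case: (gH) => _; apply; [apply: Kx | apply: Ky].
Qed.

Record commutator_subgroup := CommutatorSubgroup {
  commutator_subgroup_val : G;
  commutator_subgroup_valP : commutator_subgroup_val \in in_commutators }.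

HB.instance Definition _ := [isSub for commutator_subgroup_val].
HB.instance Definition _ := [Choice of commutator_subgroup by <:].
HB.instance Definition _ := SubChoice_isSubGroup.Build G in_commutators
  commutator_subgroup in_commutators_group_closed.

End CommutatorSubgroup.

Notation units_commutators R := (commutator_subgroup (unit_group R)).

Definition units_commutators_incl (R : unitRingType)
  (g : units_commutators R) : R := val (val g).

(* Subalgebras in the sense of subAlgType contain 1. *)
Definition unital_locally_matrix (F : fieldType) (A : algType F) : Prop :=
  forall s : seq A,
    exists (S : pred A) (A' : subAlgType S),
      {subset s <= S} /\
      exists (n : nat) (f : {lrmorphism A' -> 'M[F]_n.+1}), bijective f.

Definition group_isomorphism (G H : groupType) (phi : G -> H) : Prop :=
  bijective phi /\ {morph phi : x y / (x * y)%g}.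

(* Ring maps are not required to be linear over a base field. *)
Definition ring_isomorphism (R S : nzRingType) (f : R -> S) : Prop :=
  [/\ bijective f, {morph f : x y / x + y}, f 1 = 1
    & {morph f : x y / x * y}].

Definition ring_antiisomorphism (R S : nzRingType) (f : R -> S) : Prop :=
  [/\ bijective f, {morph f : x y / x + y}
    & {morph f : x y / x * y >-> y * x}].

(* Main.v *)
Require Import Defs.
From Stdlib Require Import Ncring Ncring_tac.
From HB Require Import structures.
From mathcomp Require Import all_boot all_algebra.
From mathcomp Require Import boolp.
From mathcomp Require Import ring.

(* An isomorphism [phi] between the commutator groups of the units of A and B
   maps involutions to involutions. For an involution 2e - 1, the subgroup 1 +
   eA(1 - e) is abelian, 2-divisible, inverted by 2e - 1 and normalized by its
   centralizer; in a prime ring these properties force its image into 1 +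
   e'B(1 - e') or 1 + (1 - e')Be', where 2e' - 1 is the image of the
   involution. If A contains a copy of M_n(F) with n >= 3, two commuting
   involutions built from three matrix units cut A into Peirce blocks;
   intersecting the subgroups above shows that [phi] permutes the off-diagonal
   root subgroups 1 + e_i A e_j, either preserving or reversing (i, j). In the
   first case the commutator relation [1 + x, 1 + y] = 1 + xy makes [phi]
   multiplicative on the blocks, hence induced by a ring isomorphism; in the
   second case one composes with inversion and replaces B by its converse
   ring. Finally the root subgroups generate the whole group. The remaining
   algebras are F itself and M_2(F), where the group is SL_2(F): a unipotent
   element is conjugate to its fourth power, so its image has trace 2, and the
   Weyl relations in SL_2(F) show that [phi] is, up to conjugation, induced by
   an automorphism of the field. *)

Set Implicit Arguments.
Unset Strict Implicit.
Unset Printing Implicit Defensive.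

Import GRing.Theory.
Local Open Scope ring_scope.

(** [A] may be infinite-dimensional and [phi] is not linear, so the argument uses idempotents,
    together with finitely many elements at a time inside a matrix subalgebra. For each involution
    the image radical may sit at [e'] or at [1 - e'], and these choices are a priori unrelated. For
    two commuting involutions and their product, the parity of the number of complements decides
    whether the three choices come from one Peirce decomposition or their complements do, hence
    between isomorphism and anti-isomorphism. Size three enters twice: it makes [e] or [1 - e] a sum
    of two nonzero idempotents, which gives primeness something to act on, and the commutator
    relation needs three distinct indices. Dividing by 2 turns involutions into idempotents and
    makes [1 + x] a square; the hypothesis on characteristic 3 serves only for 2 by 2 matrices,
    where it keeps a unipotent from having order three. Algebras of different types are told apart
    by involutions: a noncentral one in the group when there are three indices, only central ones
    for [M_2(F)], and a trivial group for [F]. *)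

Section NonCommutativeRing.
Variable R : pzRingType.

(** These instances enable [non_commutative_ring]. The tactic cannot use relations such as
    [e * e = e], so proofs below first expand a product into monomials and then rewrite with the
    relations. *)
#[global] Instance ncring_ops :
  @Ring_ops R 0 1 +%R *%R (fun x y => x - y) -%R eq := {}.

#[global] Instance ncring :
  @Ring R 0 1 +%R *%R (fun x y => x - y) -%R eq ncring_ops.
Proof.
constructor; try exact _.
- exact: add0r.
- exact: addrC.
- exact: addrA.
- exact: mul1r.
- exact: mulr1.
- exact: mulrA.
- exact: mulrDl.
- by move=> x y z; exact: mulrDr.
- by [].
- exact: subrr.
Qed.

End NonCommutativeRing.

(** * The commutator subgroup of the units, seen inside the ring *)

Section CommutatorsOfUnits.
Variable R : unitRingType.
Implicit Types x y z : R.

(** A predicate on [R] in place of a subtype of a subtype lets group elements be added and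
    multiplied as ring elements. *)
Definition comm_units x : Prop :=
  exists g : units_commutators R, units_commutators_incl g = x.

Lemma comm_units1 : comm_units 1.
Proof. by exists 1%g. Qed.

Lemma comm_unitsM x y : comm_units x -> comm_units y -> comm_units (x * y).
Proof. by move=> [g <-] [h <-]; exists (g * h)%g. Qed.

Lemma comm_unitsV x : comm_units x -> comm_units x^-1.
Proof. by move=> [g <-]; exists (g^-1)%g. Qed.

Lemma comm_units_unit x : comm_units x -> x \is a GRing.unit.
Proof. by move=> [g <-]; apply: (valP (val g)). Qed.

Lemma comm_units_comm y z : y \is a GRing.unit -> z \is a GRing.unit ->
  comm_units (y * z * y^-1 * z^-1).
Proof.
move=> yU zU.
have yVU : y^-1 \is a GRing.unit by rewrite unitrV.
have zVU : z^-1 \is a GRing.unit by rewrite unitrV.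
(* The library commutator of [a] and [b] begins with [a^-1 * b^-1], hence the inverses. *)
pose c := [~ UnitGroup yVU, UnitGroup zVU]%g.
have cK : c \in in_commutators (G := _).
  by apply/asboolP=> H _; apply.
exists (CommutatorSubgroup cK); rewrite /units_commutators_incl /=.
by rewrite !invrK !mulrA.
Qed.

(** Minimality of the commutator subgroup is applied to the subgroup of units satisfying [P]. *)
Lemma comm_units_ind (P : R -> Prop) :
    P 1 -> (forall x y, P x -> P y -> P (x * y)) ->
    (forall x, x \is a GRing.unit -> P x -> P x^-1) ->
    (forall y z, y \is a GRing.unit -> z \is a GRing.unit ->
       P (y * z * y^-1 * z^-1)) ->
  forall x, comm_units x -> P x.
Proof.
move=> P1 PM PV PC _ [g <-].
pose H := [pred u : unit_group R | `[< P (val u) >]].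
have gH : group_closed H.
  split=> [|u v /asboolP Pu /asboolP Pv]; apply/asboolP=> //=.
  by apply: PM => //; apply: PV => //; apply: (valP v).
move/asboolP: (valP g) => /(_ H gH) Hg;
  suff /Hg/asboolP : forall y z : unit_group R,
  [~ y, z]%g \in H by [].
move=> y z; apply/asboolP=> /=; have := PC _ _ (valP (y^-1)%g) (valP (z^-1)%g).
by rewrite /= !invrK !mulrA.
Qed.

End CommutatorsOfUnits.

Lemma comm_units_morph (R S : unitRingType) (f : {rmorphism R -> S}) x :
  comm_units x -> comm_units (f x).
Proof.
move: x; apply: comm_units_ind => [|x y fx fy|x xU fx|y z yU zU].
- by rewrite rmorph1; apply: comm_units1.
- by rewrite rmorphM; apply: comm_unitsM.
- by rewrite rmorphV //; apply: comm_unitsV.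
- by rewrite !rmorphM !rmorphV //; apply: comm_units_comm; rewrite rmorph_unit.
Qed.

Lemma mulr_invE (R : unitRingType) (x y : R) :
  x * y = 1 -> y * x = 1 -> x \is a GRing.unit /\ x^-1 = y.
Proof.
move=> xy yx; have xU : x \is a GRing.unit by apply/unitrP; exists y.
by split=> //; rewrite -[LHS]mulr1 -xy mulKr.
Qed.

(** Conjugation by [1 + e], invertible because 2 is, sends [1 + x] to [1 + 2x]; hence the commutator
    of [1 + e] and [1 + x] is [(1 + 2x)(1 - x) = 1 + x]. *)
Lemma comm_units_elementary (R : unitRingType) (e x : R) :
    2%:R \is a @GRing.unit R -> e * e = e -> e * x = x -> x * e = 0 ->
  comm_units (1 + x).
Proof.
move=> U2 ee ex xe; have xx : x * x = 0 by rewrite -{2}ex mulrA xe mul0r.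
have E1 : (1 + x) * (1 - x) = 1 - x * x by non_commutative_ring.
have E2 : (1 - x) * (1 + x) = 1 - x * x by non_commutative_ring.
rewrite xx subr0 in E1 E2; have [xU _] := mulr_invE E1 E2.
pose t : R := 2%:R^-1; have tt : t + t = 1.
  by rewrite -[t + t](mulr_natl t 2) divrr.
have et : e * t = t * e by apply: commrV; apply: commr_nat.
have E3 : (1 + e) * (1 - t * e) = 1.
  have -> : (1 + e) * (1 - t * e) = 1 + e - t * e - e * t * e.
    by non_commutative_ring.
  by rewrite et -mulrA ee -addrA -opprD -mulrDl tt mul1r addrK.
have E4 : (1 - t * e) * (1 + e) = 1.
  have -> : (1 - t * e) * (1 + e) = 1 + e - t * e - t * (e * e).
    by non_commutative_ring.
  by rewrite ee -addrA -opprD -mulrDl tt mul1r addrK.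
have [eU _] := mulr_invE E3 E4.
suff -> : 1 + x = (1 + e) * (1 + x) * (1 + e)^-1 * (1 + x)^-1.
  exact: comm_units_comm.
apply: (can_inj (mulrK xU)); apply: (can_inj (mulrK eU)).
rewrite !mulrVK //.
have -> : (1 + x) * (1 + x) * (1 + e) =
   1 + e + x + x + x * e + x * e + x * x + x * (x * e).
  by non_commutative_ring.
have -> : (1 + e) * (1 + x) = 1 + e + x + e * x by non_commutative_ring.
by rewrite ex xe xx mulr0 !addr0.
Qed.

Lemma elementary_commutatorE (R : pzRingType) (x y : R) :
    x * x = 0 -> y * y = 0 -> y * x = 0 ->
  1 + x * y = (1 + x) * (1 + y) * (1 - x) * (1 - y).
Proof.
move=> xx yy yx.
have -> : (1 + x) * (1 + y) * (1 - x) * (1 - y) = 1 + x * y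
    - y * y - x * (y * y) - x * x + x * x * y - y * x - x * (y * x)
    + y * x * y + x * (y * x) * y.
  by non_commutative_ring.
by rewrite xx yy yx !(mulr0, mul0r, subr0, addr0).
Qed.

(** Here [u], [v] play the matrix units [E12], [E21], and the element is [diag(t, t^-1)], extended
    by the identity: the commutator of [diag(t, 1)] with a swap. The value [t = -1] later provides
    involutions. *)
Lemma comm_units_torus (F : fieldType) (A : unitAlgType F) (t : F) (u v : A) :
    t != 0 -> u * u = 0 -> v * v = 0 -> u * v * u = u -> v * u * v = v ->
  comm_units (1 + (t - 1) *: (u * v) + (t^-1 - 1) *: (v * u)).
Proof.
move=> t0 uu vv uvu vuv.
have dilE (a : F) : a != 0 ->
    (1 + (a - 1) *: (u * v)) * (1 + (a^-1 - 1) *: (u * v)) = 1.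
  move=> a0; rewrite mulrDl mul1r mulrDr mulr1 -scalerAl -scalerAr scalerA.
  rewrite [u * v * (u * v)]mulrA uvu -addrA -!scalerDl.
  suff -> : a^-1 - 1 + (a - 1 + (a - 1) * (a^-1 - 1)) = 0.
    by rewrite scale0r addr0.
  by field.
have tV0 : t^-1 != 0 by rewrite invr_eq0.
have dV := dilE _ tV0; rewrite invrK in dV.
have [dU dVE] := mulr_invE (dilE _ t0) dV.
(* The permutation matrix exchanging the two indices. *)
pose w := 1 - u * v - v * u + u + v.
have ww : w * w = 1.
  have -> : w * w = 1 + u * u + v * v - u * v * u - u * v * u + u + u
     - v * u * v - v * u * v + v + v - u * v - v * u
     + u * v * u * v + v * u * v * u + u * (v * v) * u + v * (u * u) * v
     - u * u * v - v * (u * u) - v * v * u - u * (v * v).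
    by rewrite /w; non_commutative_ring.
  rewrite uu vv uvu vuv !mulr0 !mul0r !subr0 !addr0.
  non_commutative_ring.
have wu : w * u = v * u.
  have -> : w * u = u - u * v * u - v * (u * u) + u * u + v * u.
    by rewrite /w; non_commutative_ring.
  by rewrite uvu uu mulr0 subr0 addr0 subrr add0r.
have vw : v * w = v * u.
  have -> : v * w = v - v * u * v - v * v * u + v * u + v * v.
    by rewrite /w; non_commutative_ring.
  by rewrite vuv vv mul0r subr0 addr0 subrr add0r.
clearbody w; have [wU wV] := mulr_invE ww ww.
have -> : 1 + (t - 1) *: (u * v) + (t^-1 - 1) *: (v * u) =
  (1 + (t - 1) *: (u * v)) * w * (1 + (t - 1) *: (u * v))^-1 * w^-1; last first.
  exact: comm_units_comm.
rewrite dVE wV -!mulrA.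
have -> : w * ((1 + (t^-1 - 1) *: (u * v)) * w) = 1 + (t^-1 - 1) *: (v * u).
  rewrite mulrDl mul1r mulrDr ww -scalerAl -scalerAr; congr (_ + _ *: _).
  by rewrite !mulrA wu vuv vw.
rewrite mulrDl mul1r mulrDr mulr1 -scalerAl -scalerAr.
have -> : u * v * (v * u) = 0 by rewrite mulrA -(mulrA u) vv mulr0 mul0r.
rewrite !scaler0 addr0.
by rewrite addrAC.
Qed.

(** * Prime rings and vanishing of off-diagonal corners *)

Definition prime_ring (R : pzRingType) :=
  forall x y : R, (forall r, x * r * y = 0) -> x = 0 \/ y = 0.

(** The two-sided ideal of [x] contains 1. Explicit witnesses can be carried along ring morphisms
    and substituted for 1 in computations. *)
Definition simple_ring (R : pzRingType) :=
  forall x : R, x != 0 -> exists s : seq (R * R),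
    \sum_(w <- s) w.1 * x * w.2 = 1.

Lemma simple_prime_ring (R : pzRingType) : simple_ring R -> prime_ring R.
Proof.
move=> sR x y xy; have [->|/sR[s s1]] := eqVneq y 0; [by right|left].
rewrite -[x]mulr1 -s1 big_distrr big1_seq //= => w _.
by rewrite !mulrA xy mul0r.
Qed.

(** Says that the corner of [f] is larger than rank one, so that it contains a nontrivial pair of
    orthogonal idempotents to test against. *)
Definition splits (R : pzRingType) (f : R) :=
  exists p q : R, [/\ p + q = f, p != 0 & q != 0] /\
    [/\ p * p = p, q * q = q, p * q = 0 & q * p = 0].

Section OffDiagonal.
Variable R : pzRingType.
Hypothesis primeR : prime_ring R.
Hypothesis R2 : forall x : R, x + x = 0 -> x = 0.
Variables e f x : R.
Hypotheses (ee : e * e = e) (ef : e + f = 1).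
Hypothesis commx : forall p n : R,
  p * p = p -> p * n = n -> n * p = 0 -> f * n = n -> n * f = n ->
  x * ((1 + n) * x * (1 - n)) = (1 + n) * x * (1 - n) * x.

Let fE : f = 1 - e. Proof. by rewrite -ef addrC addKr. Qed.
Let ef0 : e * f = 0. Proof. by rewrite fE mulrBr mulr1 ee subrr. Qed.
Let fe0 : f * e = 0. Proof. by rewrite fE mulrBl mul1r ee subrr. Qed.

(* As [x] commutes with its conjugate by [1 + n], where [n] lives in the
   [f]-corner, the [(e, e)]-corners of the two products differ by [2 e x n x
   e]. *)
Let nilpotent_kill p q r : p + q = f ->
    p * p = p -> q * q = q -> p * q = 0 -> q * p = 0 ->
  e * x * (p * r * q) * x * e = 0.
Proof.
move=> pqf pp qq pq qp; pose n := p * r * q.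
have fp : f * p = p by rewrite -pqf mulrDl pp qp addr0.
have qf : q * f = q by rewrite -pqf mulrDr qq qp add0r.
have fn : f * n = n by rewrite /n !mulrA fp.
have nf : n * f = n by rewrite /n -!mulrA qf.
have en : e * n = 0 by rewrite -fn mulrA ef0 mul0r.
have ne : n * e = 0 by rewrite -nf -mulrA fe0 mulr0.
have pn : p * n = n by rewrite /n !mulrA pp.
have np : n * p = 0 by rewrite /n -!mulrA qp !mulr0.
rewrite -/n; clearbody n; apply: R2.
have /(congr1 (fun z => e * z * e)) := commx pp pn np fn nf.
have -> : e * (x * ((1 + n) * x * (1 - n))) * e =
   e * x * x * e + e * x * n * x * e - e * x * x * (n * e)
   - e * x * n * x * (n * e).
  by non_commutative_ring.
have -> : e * ((1 + n) * x * (1 - n) * x) * e =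
   e * x * x * e + (e * n) * x * x * e - e * x * n * x * e
     - (e * n) * x * n * x * e.
  by non_commutative_ring.
rewrite en ne !mulr0 !mul0r !subr0 !addr0 => E.
by apply: (addrI (e * x * x * e)); rewrite addrA E subrK addr0.
Qed.

Let kill p q : p + q = f ->
    p * p = p -> q * q = q -> p * q = 0 -> q * p = 0 ->
  e * x * p = 0 \/ q * x * e = 0.
Proof.
move=> pqf pp qq pq qp; apply: primeR => r; rewrite !mulrA.
by have := nilpotent_kill r pqf pp qq pq qp; rewrite !mulrA.
Qed.

Let half_kill p q : p + q = f -> p != 0 ->
    p * p = p -> q * q = q -> p * q = 0 -> q * p = 0 ->
    e * x * p = 0 -> p * x * e = 0 ->
  e * x * f = 0 \/ f * x * e = 0.
Proof.
move=> pqf p0 pp qq pq qp xp px.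
have [xq|xq] := eqVneq (e * x * q) 0.
  by left; rewrite -pqf mulrDr xp xq addr0.
right; rewrite -pqf !mulrDl px add0r.
have [r|/eqP|//] := @primeR p (q * x * e); last by rewrite (negPf p0).
pose n := p * r * q.
have pn : p * n = n by rewrite /n !mulrA pp.
have qn : q * n = 0 by rewrite /n !mulrA qp !mul0r.
have nq : n * q = n by rewrite /n -!mulrA qq.
have np : n * p = 0 by rewrite /n -!mulrA qp !mulr0.
have nn : n * n = 0 by rewrite -{2}pn mulrA np mul0r.
(* These are the conjugates of [q] and [p] by [1 - n]. One outcome of [kill] would give
   [e * x * q = 0], which is excluded; the other says [p * r * (q * x * e) = 0] for every [r], as
   primeness requires. *)
have [] := @kill (q - n) (p + n).
- by rewrite -pqf; non_commutative_ring.
- have -> : (q - n) * (q - n) = q * q - q * n - n * q + n * n.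
    by non_commutative_ring.
  by rewrite qq qn nq nn subr0 addr0.
- have -> : (p + n) * (p + n) = p * p + p * n + n * p + n * n.
    by non_commutative_ring.
  by rewrite pp pn np nn !addr0.
- have -> : (q - n) * (p + n) = q * p + q * n - n * p - n * n.
    by non_commutative_ring.
  by rewrite qp qn np nn !subr0 addr0.
- have -> : (p + n) * (q - n) = p * q - p * n + n * q - n * n.
    by non_commutative_ring.
  by rewrite pq pn nq nn sub0r addNr subr0.
- rewrite mulrBr /n !mulrA xp !mul0r subr0 => /eqP.
  by rewrite (negPf xq).
- by rewrite !mulrDl px add0r /n !mulrA.
Qed.

(** Thus [x] is block triangular. Using [kill] for [(p, q)] and [(q, p)] leaves four cases: two are
    immediate, and in the other two only one half of [f] is controlled, which is what [half_kill]
    handles. *)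
Lemma corner_eq0_or : splits f -> e * x * f = 0 \/ f * x * e = 0.
Proof.
move=> [p] [q] [[pqf p0 q0] [pp qq pq qp]].
have qpf : q + p = f by rewrite addrC.
have [xp|qx] := kill pqf pp qq pq qp;
  have [xq|px] := kill qpf qq pp qp pq.
- by left; rewrite -pqf mulrDr xp xq addr0.
- exact: (half_kill pqf).
- exact: (half_kill qpf).
- by right; rewrite -pqf !mulrDl px qx addr0.
Qed.

End OffDiagonal.

(** For triangular [x] the relation says that both diagonal blocks of [x] square to 1. They need not
    be 1 themselves, which is why [x * x], and not [x], is unipotent. *)
Lemma triangular_sqr (R : pzRingType) (e f x : R) :
    e * e = e -> e + f = 1 -> (e - f) * x * (e - f) * x = 1 -> f * x * e = 0 ->
  x * x * e = e /\ f * (x * x) = f.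
Proof.
move=> ee ef gx fxe.
have fE : f = 1 - e by rewrite -ef addrC addKr.
have ff : f * f = f by rewrite fE mulrBl !mulrBr !mul1r mulr1 ee subrr subr0.
have fe : f * e = 0 by rewrite fE mulrBl mul1r ee subrr.
have xe : x * e = e * x * e.
  by rewrite -[LHS]mul1r -ef mulrDl !mulrA fxe addr0.
have fx : f * x = f * x * f.
  by rewrite -[LHS]mulr1 -ef mulrDr fxe add0r.
have fxxe : f * (x * x * e) = 0.
  by rewrite !mulrA fx -!mulrA [f * (x * e)]mulrA fxe !mulr0.
split.
  rewrite -[RHS]mul1r -gx -[in RHS]mulrA xe.
  have -> : (e - f) * x * (e - f) * (e * x * e) =
     (e + f - f - f) * x * (e * e * x * e) - (e - f) * x * (f * e) * x * e.
    by non_commutative_ring.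
  rewrite fe !mulr0 !mul0r subr0 ee -xe ef !mulrBl mul1r.
  by rewrite -!mulrA [x * (x * e)]mulrA fxxe !subr0.
rewrite -[RHS]mulr1 -gx !mulrA.
have -> : f * (e - f) * x * (e - f) * x =
    f * e * x * (e - f) * x - f * f * x * e * x + f * f * x * f * x.
  by non_commutative_ring.
by rewrite fe ff !mul0r sub0r fxe mul0r oppr0 add0r -fx.
Qed.

(** * Group homomorphisms and the radicals attached to idempotents *)

Definition comm_units_hom (R S : unitRingType) (phi : R -> S) : Prop :=
  (forall x, comm_units x -> comm_units (phi x)) /\
  (forall x y, comm_units x -> comm_units y -> phi (x * y) = phi x * phi y).

(** Both maps are total, with arbitrary values off the commutator subgroups; the explicit inverse
    keeps the notion symmetric. *)
Definition comm_units_iso (R S : unitRingType) (phi : R -> S) (psi : S -> R) :=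
  [/\ comm_units_hom phi, comm_units_hom psi,
      forall x, comm_units x -> psi (phi x) = x
    & forall y, comm_units y -> phi (psi y) = y].

Lemma comm_units_iso_sym (R S : unitRingType) (phi : R -> S) (psi : S -> R) :
  comm_units_iso phi psi -> comm_units_iso psi phi.
Proof. by case. Qed.

Lemma comm_units_hom1 (R S : unitRingType) (phi : R -> S) :
  comm_units_hom phi -> phi 1 = 1.
Proof.
move=> [phiK phiM]; have K1 := comm_units1 R.
have U := comm_units_unit (phiK _ K1).
by apply: (mulrI U); rewrite mulr1 -phiM // mulr1.
Qed.

Lemma comm_units_homV (R S : unitRingType) (phi : R -> S) x :
  comm_units_hom phi -> comm_units x -> phi x^-1 = (phi x)^-1.
Proof.
move=> hphi Kx; have [phiK phiM] := hphi.
have U := comm_units_unit (phiK _ Kx); have xU := comm_units_unit Kx.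
apply: (mulrI U); rewrite mulrV // -phiM //; last exact: comm_unitsV.
by rewrite mulrV // comm_units_hom1.
Qed.

(* [nilrad e x] says that [x] belongs to [e * R * (1 - e)]: the elements [1 +
   x] form the unipotent radical of the parabolic subgroup attached to [e]. *)
Definition nilrad (R : pzRingType) (e x : R) := e * x = x /\ x * e = 0.

Lemma nilrad_compl (R : pzRingType) (e x : R) :
  nilrad (1 - e) x <-> e * x = 0 /\ x * e = x.
Proof.
rewrite /nilrad mulrBl mulrBr mul1r mulr1; split=> -[H1 H2]; split.
- by apply/eqP; rewrite -oppr_eq0 -(inj_eq (addrI x)) addr0 H1.
- by apply/eqP; rewrite eq_sym -subr_eq0 H2.
- by rewrite H1 subr0.
- by rewrite H2 subrr.
Qed.

Lemma nilrad_mul0 (R : pzRingType) (e x y : R) : nilrad e x -> nilrad e y ->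
  x * y = 0.
Proof. by move=> [_ xe] [ey _]; rewrite -ey mulrA xe mul0r. Qed.

Lemma nilradD (R : pzRingType) (e x y : R) : nilrad e x -> nilrad e y ->
  nilrad e (x + y).
Proof.
by move=> [ex xe] [ey ye]; split; rewrite ?mulrDr ?mulrDl ?ex ?ey ?xe ?ye ?addr0.
Qed.

Lemma nilrad0 (R : pzRingType) (e : R) : nilrad e 0.
Proof. by split; rewrite ?mulr0 ?mul0r. Qed.

Lemma idem_compl (R : pzRingType) (e : R) : e * e = e -> (1 - e) * (1 - e) = 1 - e.
Proof. by move=> ee; rewrite mulrBl !mulrBr !mul1r mulr1 ee subrr subr0. Qed.

Definition reflection (R : pzRingType) (e g : R) := g = e + e - 1 \/ g = 1 - e - e.

Lemma reflection_compl (R : pzRingType) (e g : R) :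
  reflection e g -> reflection (1 - e) g.
Proof. by move=> [->|->]; [right|left]; non_commutative_ring. Qed.

Section NilradTransfer.
Variables (R S : unitRingType) (phi : R -> S) (psi : S -> R).
Hypotheses (R2 : 2%:R \is a @GRing.unit R) (S2 : 2%:R \is a @GRing.unit S).
Hypothesis primeS : prime_ring S.
Hypothesis splitS : forall e : S, e * e = e -> e != 0 -> e != 1 ->
  splits e \/ splits (1 - e).
Hypothesis phipsi : comm_units_iso phi psi.
Variables (e g : R) (e' g' : S).
Hypotheses (ee : e * e = e) (ee' : e' * e' = e').
Hypotheses (Kg : comm_units g) (phig : phi g = g').
Hypotheses (gE : reflection e g) (gE' : reflection e' g').
Hypotheses (e'0 : e' != 0) (e'1 : e' != 1).

Lemma two_torsion_free (T : unitRingType) (x : T) :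
  2%:R \is a @GRing.unit T -> x + x = 0 -> x = 0.
Proof.
move=> U2 xx; apply: (mulrI U2); rewrite mulr0.
by rewrite mulr_natl mulr2n.
Qed.

Lemma comm_units_nilrad (T : unitRingType) (f x : T) :
  2%:R \is a @GRing.unit T -> f * f = f -> nilrad f x -> comm_units (1 + x).
Proof. by move=> T2 ff [fx xf]; apply: (comm_units_elementary T2 ff fx xf). Qed.

(* [phi (1 + x)] is the square of [w := phi (1 + x / 2)], and [w] is inverted
   by the image of the reflection and commutes with its conjugates by the
   centralizer of that image; a square of such a [w] is unipotent on one side
   or on the other. *)
Lemma nilrad_image x : nilrad e x ->
  nilrad e' (phi (1 + x) - 1) \/ nilrad (1 - e') (phi (1 + x) - 1).
Proof.
move=> hx; have [[phiK phiM] [psiK psiM] phiK' psiK'] := phipsi.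
pose t : R := 2%:R^-1; have tt : t + t = 1.
  by rewrite -[t + t](mulr_natl t 2) divrr.
have tC (y : R) : y * t = t * y by apply: commrV; apply: commr_nat.
pose y := t * x; have hy : nilrad e y.
  case: hx => ex xe; split; rewrite /y; last by rewrite -mulrA xe mulr0.
  by rewrite mulrA tC -mulrA ex.
have xE : 1 + x = (1 + y) * (1 + y).
  have -> : (1 + y) * (1 + y) = 1 + (y + y) + y * y by non_commutative_ring.
  by rewrite (nilrad_mul0 hy hy) addr0 /y -mulrDl tt mul1r.
clearbody y; have Ky := comm_units_nilrad R2 ee hy.
pose w := phi (1 + y).
(* The involution [g] inverts [1 + y], that is, [g * (1 + y)] squares to 1; this passes through
   [phi]. *)
have gw : (e' - (1 - e')) * w * (e' - (1 - e')) * w = 1.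
  have -> : (e' - (1 - e')) * w * (e' - (1 - e')) * w = g' * w * g' * w.
    by case: gE' => ->; non_commutative_ring.
  rewrite -phig -!phiM //; do ?apply: comm_unitsM => //.
  have -> : g * (1 + y) * g * (1 + y) =
      (e + e - 1) * (1 + y) * (e + e - 1) * (1 + y).
    by case: gE => ->; non_commutative_ring.
  have [ey ye] := hy.
  have -> : (e + e - 1) * (1 + y) = e + e - 1 + y.
    by rewrite mulrDr mulr1 mulrBl mul1r mulrDl ey addrK.
  have -> : (e + e - 1 + y) * (e + e - 1) = 1 - y.
    have -> : (e + e - 1 + y) * (e + e - 1) =
        e * e + e * e + e * e + e * e - e - e - e - e + 1 + y * e + y * e - y.
      by non_commutative_ring.
    by rewrite ee ye; non_commutative_ring.
  have -> : (1 - y) * (1 + y) = 1 - y * y by non_commutative_ring.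
  rewrite (nilrad_mul0 hy hy) subr0.
  exact: comm_units_hom1.
have wcomm (p n : S) : p * p = p -> p * n = n -> n * p = 0 ->
    e' * n = n * e' ->
  w * ((1 + n) * w * (1 - n)) = (1 + n) * w * (1 - n) * w.
  move=> pp pn np e'n.
  have nn : n * n = 0 by rewrite -{2}pn mulrA np mul0r.
  have Kn := comm_units_elementary S2 pp pn np.
  have [_ nV] : 1 + n \is a GRing.unit /\ (1 + n)^-1 = 1 - n.
    apply: mulr_invE.
      have -> : (1 + n) * (1 - n) = 1 - n * n by non_commutative_ring.
      by rewrite nn subr0.
    have -> : (1 - n) * (1 + n) = 1 - n * n by non_commutative_ring.
    by rewrite nn subr0.
  (* As [1 + n] commutes with [g'], its preimage [h] commutes with [g], hence with [e]. Conjugation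
     by [h] therefore preserves the abelian group of the [1 + y], and [phi] carries this commutation
     to [w]. *)
  pose h := psi (1 + n); have Kh : comm_units h by apply: psiK.
  have hE : phi h = 1 + n by apply: psiK'.
  clearbody h;   have hVE : phi h^-1 = 1 - n by rewrite comm_units_homV // hE.
  have hU := comm_units_unit Kh.
  have hg : h * g = g * h.
    rewrite -(phiK' _ (comm_unitsM Kh Kg)) -(phiK' _ (comm_unitsM Kg Kh)).
    rewrite !phiM // hE phig; congr psi; rewrite mulrDl mulrDr mul1r mulr1.
    congr (_ + _).
    by case: gE' => ->; rewrite !mulrBr !mulrBl ?mulrDr ?mulrDl e'n mulr1 mul1r.
  have he : h * e = e * h.
    apply: (mulrI R2); rewrite !mulr_natl !mulr2n.
    have : h * (e + e) = (e + e) * h; last by rewrite mulrDr mulrDl.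
    case: gE hg => ->.
      by rewrite mulrBr mulrBl mulr1 mul1r => /addIr.
    by rewrite -addrA -opprD mulrBr mulrBl mulr1 mul1r => /addrI/oppr_inj.
  have hVe : h^-1 * e = e * h^-1.
    by apply: (mulrI hU); rewrite mulVKr // mulrA he mulrK.
  pose z := h * y * h^-1.
  have hz : nilrad e z.
    have [ey ye] := hy; split; rewrite /z.
      by rewrite !mulrA -he -(mulrA h e y) ey.
    by rewrite -(mulrA (h * y)) hVe !mulrA -(mulrA h y e) ye mulr0 mul0r.
  have zE : 1 + z = h * (1 + y) * h^-1 by rewrite mulrDr mulr1 mulrDl mulrV.
  have Kz := comm_units_nilrad R2 ee hz.
  have <- : phi (1 + z) = (1 + n) * w * (1 - n).
    rewrite zE !phiM ?hE ?hVE //; first exact: comm_unitsM.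
    exact: comm_unitsV.
  rewrite /w -!phiM //; congr phi.
  have -> : (1 + y) * (1 + z) = 1 + y + z + y * z by non_commutative_ring.
  have -> : (1 + z) * (1 + y) = 1 + y + z + z * y by non_commutative_ring.
  by rewrite (nilrad_mul0 hy hz) (nilrad_mul0 hz hy).
have S2' (u : S) : u + u = 0 -> u = 0 by apply: two_torsion_free.
have ef : e' + (1 - e') = 1 by rewrite addrC subrK.
have fe : (1 - e') + e' = 1 by rewrite subrK.
have ff' := idem_compl ee'.
have phixE : phi (1 + x) = w * w by rewrite xE phiM.
have lower : (1 - e') * w * e' = 0 -> nilrad e' (phi (1 + x) - 1).
  move=> /(triangular_sqr ee' ef gw) [H1 H2]; rewrite phixE; split.
    apply/eqP; rewrite eq_sym -subr_eq0 -[X in X - _]mul1r -mulrBl mulrBr.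
    by rewrite H2 mulr1 subrr.
  by rewrite mulrBl mul1r H1 subrr.
have upper : e' * w * (1 - e') = 0 -> nilrad (1 - e') (phi (1 + x) - 1).
  have gw' : ((1 - e') - e') * w * ((1 - e') - e') * w = 1.
    by rewrite -[RHS]gw; non_commutative_ring.
  move=> /(triangular_sqr ff' fe gw') [H1 H2]; rewrite phixE nilrad_compl.
  split; first by rewrite mulrBr H2 mulr1 subrr.
  apply/eqP; rewrite eq_sym -subr_eq0 -[X in X - _]mulr1 -mulrBr mulrBl.
  by rewrite H1 mul1r subrr.
case: (splitS ee' e'0 e'1) => spl.
  have [/lower|/upper] : (1 - e') * w * e' = 0 \/ e' * w * (1 - e') = 0; auto.
  apply: corner_eq0_or spl => // p n pp pn np en ne.
  by apply: wcomm pp pn np _; rewrite en ne.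
have [/upper|/lower] : e' * w * (1 - e') = 0 \/ (1 - e') * w * e' = 0; auto.
apply: corner_eq0_or spl => // p n pp pn np fn nf; apply: wcomm pp pn np _.
have -> : e' * n = 0 by rewrite -fn mulrA mulrBr mulr1 ee' subrr mul0r.
by rewrite -nf -mulrA mulrBl mul1r ee' subrr mulr0.
Qed.

(** A group is not the union of two proper subgroups: if [x] and [y] were sent to different sides,
    their sum could be sent to neither. *)
Lemma nilrad_image_side :
  (forall x, nilrad e x -> nilrad e' (phi (1 + x) - 1)) \/
  (forall x, nilrad e x -> nilrad (1 - e') (phi (1 + x) - 1)).
Proof.
have [|/existsNP[x /not_implyP[hx nx]]] :=
  pselect (forall x, nilrad e x -> nilrad e' (phi (1 + x) - 1)); first by left.
right=> y hy; have [|//] := nilrad_image hy.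
have [//|] := nilrad_image hx; have := nilrad_image (nilradD hx hy).
have [[phiK phiM] _ _ _] := phipsi.
have -> : phi (1 + (x + y)) = phi (1 + x) * phi (1 + y).
  rewrite -phiM; try exact: (comm_units_nilrad R2 ee).
  have -> : (1 + x) * (1 + y) = 1 + (x + y) + x * y by non_commutative_ring.
  by rewrite (nilrad_mul0 hx hy) addr0.
move: nx; set a := phi (1 + x); set b := phi (1 + y) => nx hab ha hb.
have abE : a * b - 1 = (a - 1) + (b - 1) + (a - 1) * (b - 1).
  by non_commutative_ring.
have [e'a ae'] := (nilrad_compl _ _).1 ha; have [e'b be'] := hb.
move: hab nx abE e'a ae' e'b be'.
move: (a * b - 1) (a - 1) (b - 1) => c u v hab nx cE e'a ae' e'b be'.
case: hab => [[_]|/nilrad_compl[+ _]].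
  rewrite cE !mulrDl -mulrA be' mulr0 !addr0 ae' => a1.
  by case: nx; rewrite a1; apply: nilrad0.
rewrite cE !mulrDr mulrA e'a mul0r add0r addr0 e'b => ->.
by apply/nilrad_compl; rewrite mulr0 mul0r.
Qed.

End NilradTransfer.

Definition split_simple (R : unitRingType) :=
  [/\ 2%:R \is a @GRing.unit R, simple_ring R
    & forall e : R, e * e = e -> e != 0 -> e != 1 -> splits e \/ splits (1 - e)].

Lemma nilrad_exists (R : pzRingType) (e : R) : simple_ring R ->
  e * e = e -> e != 0 -> e != 1 -> exists2 x, nilrad e x & x != 0.
Proof.
move=> /simple_prime_ring pR ee e0 e1.
have [//|H] := pselect (exists2 x, nilrad e x & x != 0).
have [r|/eqP|/eqP] := pR e (1 - e).
- apply: contra_notP H => /eqP H; exists (e * r * (1 - e)) => //; split.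
    by rewrite !mulrA ee.
  by rewrite -mulrA mulrBl mul1r ee subrr mulr0.
- by rewrite (negPf e0).
- by rewrite subr_eq0 eq_sym (negPf e1).
Qed.

Lemma nilrad_disjoint (R : pzRingType) (e x : R) :
  nilrad e x -> nilrad (1 - e) x -> x = 0.
Proof. by move=> [ex _] /nilrad_compl[]; rewrite ex. Qed.

Definition nilrad_iso (R S : unitRingType) (phi : R -> S) (psi : S -> R) e e' :=
  (forall x, nilrad e x -> nilrad e' (phi (1 + x) - 1)) /\
  (forall y, nilrad e' y -> nilrad e (psi (1 + y) - 1)).

Section NilradIso.
Variables (R S : unitRingType) (phi : R -> S) (psi : S -> R).
Hypotheses (goodR : split_simple R) (goodS : split_simple S).
Hypothesis phipsi : comm_units_iso phi psi.

(** The side of [e] fixes the other three sides. A wrong choice would place a nonzero element,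
    supplied by [nilrad_exists], in both the radical of [e] and that of [1 - e]. *)
Let nilrad_isoW (e g : R) (e' g' : S) :
    e * e = e -> e' * e' = e' -> comm_units g -> phi g = g' ->
    reflection e g -> reflection e' g' ->
    e != 0 -> e != 1 -> e' != 0 -> e' != 1 ->
    (forall x, nilrad e x -> nilrad e' (phi (1 + x) - 1)) ->
  nilrad_iso phi psi e e' /\ nilrad_iso phi psi (1 - e) (1 - e').
Proof.
move=> ee ee' Kg phig gE gE' e0 e1 e'0 e'1 He.
have [R2 sR spR] := goodR; have [S2 sS spS] := goodS.
have pR := simple_prime_ring sR; have pS := simple_prime_ring sS.
have psiphi := comm_units_iso_sym phipsi.
have [[phiK phiM] [psiK psiM] phiK' psiK'] := phipsi.
have ff := idem_compl ee; have ff' := idem_compl ee'.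
have compl1 (T : pzRingType) (u : T) : u != 0 -> 1 - u != 1.
  by apply: contra_neq => /(canRL (subrK _))/(canLR (addKr _)) <-; rewrite addNr.
have compl0 (T : pzRingType) (u : T) : u != 1 -> 1 - u != 0.
  by rewrite subr_eq0 eq_sym.
have Kg' : comm_units g' by rewrite -phig; apply: phiK.
have psig : psi g' = g by rewrite -phig phiK'.
have [x0 hx0 x0_neq0] := nilrad_exists sR ee e0 e1.
have [x1 hx1 x1_neq0] := nilrad_exists sR ff (compl0 _ _ e1) (compl1 _ _ e0).
have back f x : f * f = f -> nilrad f x -> psi (1 + (phi (1 + x) - 1)) - 1 = x.
  move=> fidem hx; have -> : 1 + (phi (1 + x) - 1) = phi (1 + x).
    by rewrite addrC subrK.
  by rewrite (phiK' _ (comm_units_nilrad R2 fidem hx)) addrC addKr.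
have rc := reflection_compl gE; have rc' := reflection_compl gE'.
have Hpsi : forall y, nilrad e' y -> nilrad e (psi (1 + y) - 1).
  have [//|H] := nilrad_image_side S2 R2 pR spR psiphi ee' ee Kg' psig gE' gE e0 e1.
  case/eqP: x0_neq0; apply: (nilrad_disjoint hx0).
  by rewrite -(back e x0 ee hx0); apply/H/He.
have Hc : forall x, nilrad (1 - e) x -> nilrad (1 - e') (phi (1 + x) - 1).
  have [//|H] := nilrad_image_side R2 S2 pS spS phipsi ff ff' Kg phig rc rc'
    (compl0 _ _ e'1) (compl1 _ _ e'0).
  case/eqP: x1_neq0; apply: (nilrad_disjoint _ hx1).
  rewrite -(back _ _ ff hx1); apply: Hpsi.
  by have := H _ hx1; rewrite subKr.
split=> //; split=> //.
have [//|H] := nilrad_image_side S2 R2 pR spR psiphi ff' ff Kg' psig rc' rc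
    (compl0 _ _ e1) (compl1 _ _ e0).
case/eqP: x1_neq0; apply: (nilrad_disjoint _ hx1).
by rewrite -(back _ _ ff hx1); have := H _ (Hc _ hx1); rewrite subKr.
Qed.

Lemma nilrad_isoP (e g : R) (e' g' : S) :
    e * e = e -> e' * e' = e' -> comm_units g -> phi g = g' ->
    reflection e g -> reflection e' g' ->
    e != 0 -> e != 1 -> e' != 0 -> e' != 1 ->
  exists2 q, q = e' \/ q = 1 - e' &
    nilrad_iso phi psi e q /\ nilrad_iso phi psi (1 - e) (1 - q).
Proof.
move=> ee ee' Kg phig gE gE' e0 e1 e'0 e'1.
have [R2 sR spR] := goodR; have [S2 sS spS] := goodS.
have [H|H] := nilrad_image_side R2 S2 (simple_prime_ring sS) spS phipsi ee ee'
  Kg phig gE gE' e'0 e'1.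
  by exists e'; [left | apply: (nilrad_isoW ee ee' Kg phig gE gE')].
exists (1 - e'); [by right|apply: (nilrad_isoW ee _ Kg phig gE) => //].
- exact: idem_compl.
- exact: reflection_compl.
- by rewrite subr_eq0 eq_sym.
- by rewrite -subr_eq0 addrAC subrr add0r oppr_eq0.
Qed.

End NilradIso.

(** * Peirce decompositions and extension of maps from off-diagonal blocks *)

Definition orthogonal_idempotents (R : pzRingType) (I : finType) (e : I -> R) :=
  (forall i j, e i * e j = if i == j then e i else 0) /\ \sum_i e i = 1.

Definition peirce (R : pzRingType) (I : finType) (e : I -> R) i j x :=
  e i * x = x /\ x * e j = x.

Section Peirce.
Variables (R : pzRingType) (I : finType) (e : I -> R).
Hypothesis orthe : orthogonal_idempotents e.

Lemma idem_orth i : e i * e i = e i.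
Proof. by rewrite orthe.1 eqxx. Qed.

Lemma mul_orth i j : i != j -> e i * e j = 0.
Proof. by rewrite orthe.1 => /negPf->. Qed.

Lemma peirce_sandwich i j x : peirce e i j (e i * x * e j).
Proof. by split; rewrite ?mulrA ?idem_orth // -mulrA idem_orth. Qed.

Lemma peirce_mul i j k x y :
  peirce e i j x -> peirce e j k y -> peirce e i k (x * y).
Proof. by move=> [ix xj] [jy yk]; rewrite /peirce mulrA ix -mulrA yk. Qed.

Lemma peirce_mul0 i j k l x y :
  peirce e i j x -> peirce e k l y -> j != k -> x * y = 0.
Proof.
by move=> [_ xj] [ky _] jk;
  rewrite -xj -ky mulrA -(mulrA x) mul_orth // mulr0 mul0r.
Qed.

Lemma peirce0 i j : peirce e i j 0.
Proof. by split; rewrite ?mulr0 ?mul0r. Qed.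

Lemma peirce_el i j k x : peirce e i j x -> e k * x = if k == i then x else 0.
Proof.
move=> [ix _]; case: eqVneq => [->//|ki].
by rewrite -ix mulrA mul_orth // mul0r.
Qed.

(** By simplicity 1 is a sum of terms [a * e k * b], so a diagonal block is spanned by products
    through another index [k] with [e k] nonzero. *)
Lemma peirce_generate (P : R -> Prop) : simple_ring R ->
    (forall i, exists2 j, i != j & e j != 0) ->
    P 0 -> (forall x y, P x -> P y -> P (x + y)) ->
    (forall x y, P x -> P y -> P (x * y)) ->
    (forall i j x, i != j -> peirce e i j x -> P x) ->
  forall x, P x.
Proof.
move=> simpleR other P0 PD PM Poff x.
rewrite -[x]mul1r -[_ * x]mulr1 -orthe.2 big_distrl big_distrl /=.
apply: (big_ind P) => // i _; rewrite big_distrr /=; apply: (big_ind P) => // j _.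
have [<-|ij] := eqVneq i j; last exact: Poff ij (peirce_sandwich _ _ _).
have [k ik /simpleR[s s1]] := other i.
rewrite -[e i * x]mulr1 -s1 big_distrr big_distrl /=.
apply: (big_ind P) => // w _.
have -> : e i * x * (w.1 * e k * w.2) * e i =
    (e i * (x * w.1) * e k) * (e k * w.2 * e i).
  by rewrite !mulrA -(mulrA _ (e k) (e k)) idem_orth.
apply: PM; first exact: Poff ik (peirce_sandwich _ _ _).
by apply: Poff (peirce_sandwich _ _ _); rewrite eq_sym.
Qed.

End Peirce.

Section Extension.
Variables (R S : nzRingType) (I : finType) (e : I -> R) (e' : I -> S).
Hypotheses (orthe : orthogonal_idempotents e) (orthe' : orthogonal_idempotents e').
Hypotheses (simpleR : simple_ring R) (simpleS : simple_ring S).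
Variables (psi : R -> S) (psi' : S -> R).
Hypothesis psi_off : forall i j x, i != j -> peirce e i j x ->
  peirce e' i j (psi x).
Hypothesis psi'_off : forall i j y, i != j -> peirce e' i j y ->
  peirce e i j (psi' y).
Hypothesis psiK : forall i j x, i != j -> peirce e i j x -> psi' (psi x) = x.
Hypothesis psi'K : forall i j y, i != j -> peirce e' i j y -> psi (psi' y) = y.
Hypothesis psiD : forall i j x y, i != j -> peirce e i j x -> peirce e i j y ->
  psi (x + y) = psi x + psi y.
Hypothesis psiM : forall i j k x y, i != j -> j != k -> i != k ->
  peirce e i j x -> peirce e j k y -> psi (x * y) = psi x * psi y.
Variables (a b c : I) (u : I -> I -> R).
Hypotheses (ab : a != b) (bc : b != c) (ca : c != a).
Hypothesis u_off : forall i j, i \in [:: a; b; c] -> j \in [:: a; b;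
  c] -> peirce e i j (u i j).
Hypothesis uM : forall i j k, i \in [:: a; b; c] -> j \in [:: a; b; c] ->
  k \in [:: a; b; c] -> u i j * u j k = u i k.
Hypothesis u_diag : forall i, i \in [:: a; b; c] -> u i i = e i.
Hypothesis ec0 : e c != 0.

Let aP : a \in [:: a; b; c]. Proof. by rewrite !inE eqxx. Qed.
Let bP : b \in [:: a; b; c]. Proof. by rewrite !inE eqxx orbT. Qed.
Let cP : c \in [:: a; b; c]. Proof. by rewrite !inE eqxx !orbT. Qed.

Let psi0 : psi 0 = 0.
Proof.
have := psiD ab (peirce0 e a b) (peirce0 e a b).
by rewrite addr0 => /eqP; rewrite -subr_eq0 opprD addrA subrr sub0r oppr_eq0 =>
  /eqP.
Qed.

(* [col] extends [psi] to the whole column [R * e c], the missing corner being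
   reached through the matrix units; the ring morphism extending [psi] sends
   [x] to the unique [y] with [col (x * z) = y * col z]. *)
Let corner z := psi (e c * z * u c a) * psi (u a c).
Let col z := \sum_(i | i != c) psi (e i * z) + corner z.

Let ucd_off d z : d \in [:: a; b; c] -> peirce e c d (e c * z * u c d).
Proof.
move=> dP; have [ec ed] := u_off cP dP; split; first by rewrite !mulrA idem_orth.
by rewrite -(mulrA _ (u c d)) ed.
Qed.

(** The corner does not depend on the auxiliary index, so one may route through whichever of [a],
    [b] differs from a given index. *)
Let corner_b z : corner z = psi (e c * z * u c b) * psi (u b c).
Proof.
have uE : e c * z * u c a = (e c * z * u c b) * u b a by rewrite -[RHS]mulrA uM.
have ba : b != a by rewrite eq_sym.
have cb : c != b by rewrite eq_sym.
have ac : a != c by rewrite eq_sym.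
rewrite /corner uE (psiM cb ba ca (ucd_off z bP) (u_off bP aP)).
by rewrite -mulrA -(psiM ba ac bc (u_off bP aP) (u_off aP cP)) uM.
Qed.

Let corner_d d z : d \in [:: a;
  b] -> corner z = psi (e c * z * u c d) * psi (u d c).
Proof. by rewrite !inE => /orP[]/eqP-> //; apply: corner_b. Qed.

Let pick_d i : i != c -> exists d, [/\ d \in [:: a; b], d != c & d != i].
Proof.
move=> ic; have [<-|ai] := eqVneq a i.
  by exists b; split; rewrite ?inE ?eqxx ?orbT // eq_sym.
by exists a; split; rewrite ?inE ?eqxx // eq_sym.
Qed.

Let col0 : col 0 = 0.
Proof.
rewrite /col /corner !(mulr0, mul0r) psi0 mul0r addr0 big1 // => i _.
by rewrite mulr0.
Qed.

Let colD z t : z * e c = z -> t * e c = t -> col (z + t) = col z + col t.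
Proof.
move=> zc tc; rewrite /col addrACA; congr (_ + _).
  rewrite -big_split; apply: eq_bigr => i ic /=.
  rewrite mulrDr (psiD ic) //; split;
    by rewrite ?mulrA ?(idem_orth orthe) // -mulrA ?zc ?tc.
rewrite /corner mulrDr mulrDl (psiD ca) ?mulrDl //; exact: ucd_off.
Qed.

Let colE i z : peirce e i c z -> i != c -> col z = psi z.
Proof.
move=> hz ic; rewrite /col (bigD1 i) //= big1 ?addr0 => [|j /andP[_ ji]].
  rewrite /corner (peirce_el orthe c hz) (peirce_el orthe i hz) eqxx eq_sym
    (negPf ic).
  by rewrite mul0r psi0 mul0r addr0.
by rewrite (peirce_el orthe j hz) (negPf ji).
Qed.

Let colE_c z : peirce e c c z -> col z = corner z.
Proof.
move=> hz; rewrite /col big1 ?add0r // => j jc.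
by rewrite (peirce_el orthe j hz) (negPf jc).
Qed.

(** [psiM] covers three distinct indices only. When [j] or [i] equals [c], the product is factored
    through a matrix unit at an index [d] different from all indices in play. *)
Let col_mul i j x z : i != j -> peirce e i j x -> z * e c = z ->
  col (x * z) = psi x * col z.
Proof.
move=> ij hx zc.
have hz k : peirce e k c (e k * z) by split; rewrite ?mulrA ?idem_orth // -mulrA zc.
have xz : x * z = x * (e j * z) by case: hx => _ xj; rewrite mulrA xj.
have -> : psi x * col z = psi x * (if j == c then corner z else psi (e j * z)).
  have [ix' xj'] := psi_off ij hx.
  rewrite -xj' -2!mulrA; congr (_ * _); rewrite /col mulrDr big_distrr /=.
  have hcorner : e' c * corner z = corner z.
    have [cz _] := psi_off ca (ucd_off z aP).
    by rewrite /corner mulrA cz.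
  have [->|jc] := eqVneq j c.
    rewrite big1 ?add0r // => k kc.
    have hkz := psi_off kc (hz k).
    by rewrite (peirce_el orthe' c hkz) eq_sym (negPf kc).
  rewrite (bigD1 j) //= big1 ?addr0 => [|k /andP[kc kj]]; last first.
    have hkz := psi_off kc (hz k).
    by rewrite (peirce_el orthe' j hkz) eq_sym (negPf kj).
  by rewrite -hcorner mulrA (mul_orth orthe') // mul0r addr0.
have [jc|jc] := eqVneq j c.
  move: xz hx ij hz; rewrite jc => xz hx ic hz.
  have [d [dab dc di]] := pick_d ic.
  have dP : d \in [:: a; b; c].
    by move: dab; rewrite !inE => /orP[]->; rewrite ?orbT.
  have [id cd] : i != d /\ c != d by split; rewrite eq_sym.
  rewrite xz (colE (peirce_mul hx (hz c))) // (corner_d z dab).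
  rewrite mulrA -(psiM ic cd id hx (ucd_off z dP)).
  rewrite -(psiM id dc ic (peirce_mul hx (ucd_off z dP)) (u_off dP cP)).
  by rewrite -!mulrA uM // u_diag // zc.
have [ic|ic] := eqVneq i c; last first.
  by rewrite xz (colE (peirce_mul hx (hz j))) // (psiM ij jc ic hx (hz j)).
move: hx ij; rewrite ic => hx cj.
have [d [dab dc dj]] := pick_d jc.
have dP : d \in [:: a; b; c].
  by move: dab; rewrite !inE => /orP[]->; rewrite ?orbT.
have [jd cd] : j != d /\ c != d by split; rewrite eq_sym.
have hzd : peirce e j d (e j * z * u c d) by apply: peirce_mul (hz j) (u_off cP dP).
rewrite xz (colE_c (peirce_mul hx (hz j))) (corner_d _ dab).
have -> : e c * (x * (e j * z)) * u c d = x * (e j * z * u c d).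
  by case: hx => cx xj; rewrite !mulrA cx.
rewrite (psiM cj jd cd hx hzd) -(mulrA (psi _)) -(psiM jd dc jc hzd (u_off dP cP)).
by rewrite -(mulrA _ (u c d)) uM // u_diag // -mulrA zc.
Qed.

Let compat x y := forall z, z * e c = z -> col (x * z) = y * col z.

Let compat0 : compat 0 0.
Proof. by move=> z _; rewrite !mul0r col0. Qed.

Let compatD x y x' y' : compat x y -> compat x' y' -> compat (x + x') (y + y').
Proof.
move=> xy xy' z zc; rewrite !mulrDl colD ?xy ?xy' // -mulrA zc //.
Qed.

Let compatM x y x' y' : compat x y -> compat x' y' -> compat (x * x') (y * y').
Proof.
move=> xy xy' z zc; rewrite -!mulrA xy ?xy' // -mulrA zc //.
Qed.

Let compat_psi i j x : i != j -> peirce e i j x -> compat x (psi x).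
Proof. by move=> ij hx z zc; apply: col_mul ij hx zc. Qed.

Let psi_neq0 i j x : i != j -> peirce e i j x -> x != 0 -> psi x != 0.
Proof.
move=> ij hx; apply: contra_neq => x0; rewrite -(psiK ij hx) x0.
have hij := peirce0 e i j.
by rewrite -[in LHS]psi0 (psiK ij hij).
Qed.

Let u_neq0 i : i \in [:: a; b; c] -> u i c != 0.
Proof.
move=> iP; apply: contra_neq ec0 => uic.
by rewrite -(u_diag cP) -(uM cP iP cP) uic mulr0.
Qed.

(** For [i != c] the elements [e' i * r * e' c] are values of [col], and for [i = c] so are
    [e' c * r * psi (u a c)]. Since [y] kills them all, primeness gives [y * e' i = 0]. *)
Let compat_uniq y : compat 0 y -> y = 0.
Proof.
have prS := simple_prime_ring simpleS.
move=> y0; have ac : a != c by rewrite eq_sym.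
have uac := psi_neq0 ac (u_off aP cP) (u_neq0 aP).
have hac := psi_off ac (u_off aP cP).
suff yi i : y * e' i = 0.
  by rewrite -[y]mulr1 -orthe'.2 big_distrr big1 //= => i _; apply: yi.
have [->|ic] := eqVneq i c.
  have [r||/eqP] := prS (y * e' c) (psi (u a c)) => //; last by rewrite (negPf uac).
  have hr := peirce_sandwich orthe' c a r.
  have hr' := psi'_off ca hr.
  pose z := psi' (e' c * r * e' a) * u a c.
  have hz : peirce e c c z by apply: peirce_mul hr' (u_off aP cP).
  have := y0 z hz.2; rewrite mul0r col0 (colE_c hz) /corner hz.1 /z.
  rewrite -mulrA uM // u_diag // hr'.2 (psi'K ca hr) => H.
  by rewrite [RHS]H -!mulrA hac.1.
have [r||e'c] := prS (y * e' i) (e' c) => //; last first.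
  by case/eqP: uac; rewrite -hac.2 e'c mulr0.
have hr := peirce_sandwich orthe' i c r.
have hr' := psi'_off ic hr.
have := y0 _ hr'.2; rewrite mul0r col0 (colE hr' ic) (psi'K ic hr) => H.
by rewrite [RHS]H !mulrA.
Qed.

(** The [x] having a compatible [y] are closed under sums and products and include the off-diagonal
    blocks, hence are everything; uniqueness of [y] makes [theta] a morphism. Simplicity of [R]
    gives injectivity, generation of [S] by its blocks surjectivity. *)
Lemma peirce_extension : exists2 theta : R -> S, ring_isomorphism theta &
  forall i j x, i != j -> peirce e i j x -> theta x = psi x.
Proof.
have ac : a != c by rewrite eq_sym.
have e0 i : i \in [:: a; b; c] -> e i != 0.
  move=> iP; apply: contra_neq (u_neq0 iP) => ei.
  by rewrite -(u_off iP cP).1 ei mul0r.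
have e'0 i : i \in [:: a; b] -> e' i != 0.
  move=> iP; have [iP' ic] : i \in [:: a; b; c] /\ i != c.
    by move: iP; rewrite !inE => /orP[]/eqP->; rewrite eqxx ?orbT.
  have [h _] := psi_off ic (u_off iP' cP).
  apply: contra_neq (psi_neq0 ic (u_off iP' cP) (u_neq0 iP')) => ei.
  by rewrite -h ei mul0r.
have pick_ab i : exists2 j, i != j & j \in [:: a; b].
  have [->|ia] := eqVneq i a; first by exists b; rewrite ?inE ?eqxx ?orbT.
  by exists a; rewrite ?inE ?eqxx.
have ex x : exists y, compat x y.
  apply: (peirce_generate orthe (P := fun x => exists y, compat x y)) => //.
  - move=> i; have [j ij jP] := pick_ab i; exists j => //; apply: e0.
    by move: jP; rewrite !inE => /orP[]->; rewrite ?orbT.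
  - by exists 0; apply: compat0.
  - by move=> ? ? [y xy] [y' xy']; exists (y + y'); apply: compatD.
  - by move=> ? ? [y xy] [y' xy']; exists (y * y'); apply: compatM.
  - by move=> i j z ij hz; exists (psi z); apply: compat_psi ij hz.
have uniq x y y' : compat x y -> compat x y' -> y = y'.
  move=> xy xy'; apply/eqP; rewrite -subr_eq0; apply/eqP/compat_uniq => z zc.
  by rewrite mulrBl -xy // -xy' // mul0r col0 subrr.
have [theta thetaP] := choice ex.
have thetaD : {morph theta : x y / x + y}.
  by move=> x y; apply: uniq (thetaP _) _; apply: compatD.
have thetaM : {morph theta : x y / x * y}.
  by move=> x y; apply: uniq (thetaP _) _; apply: compatM.
have theta_psi i j x : i != j -> peirce e i j x -> theta x = psi x.
  by move=> ij hx; apply: uniq (thetaP _) _; apply: compat_psi ij hx.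
have theta1 : theta 1 = 1.
  by apply: uniq (thetaP _) _ => z _; rewrite !mul1r.
have theta0 : theta 0 = 0 by apply: uniq (thetaP _) compat0.
exists theta => //; split=> //.
have theta_inj : injective theta.
  have thetaB x y : theta (x - y) = theta x - theta y.
    by apply: (addIr (theta y)); rewrite -thetaD !subrK.
  move=> x y xy; apply/eqP; rewrite -subr_eq0; apply/negPn/negP => /simpleR[s s1].
  suff: theta 1 = 0 by rewrite theta1 => /eqP; rewrite oner_eq0.
  rewrite -s1 (big_morph theta thetaD theta0) big1 // => w _.
  by rewrite !thetaM thetaB xy subrr mulr0 mul0r.
have theta_surj y : exists x, theta x = y.
  apply: (peirce_generate orthe' (P := fun y => exists x, theta x = y)) => //.
  - by move=> i; have [j ij jP] := pick_ab i; exists j => //; apply: e'0.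
  - by exists 0.
  - by move=> ? ? [x <-] [x' <-]; exists (x + x').
  - by move=> ? ? [x <-] [x' <-]; exists (x * x').
  - move=> i j t ij ht; exists (psi' t).
    by rewrite (theta_psi i j) ?(psi'K ij ht) //; apply: psi'_off.
have [inv invP] := choice theta_surj.
by exists inv => // x; apply: theta_inj; rewrite invP.
Qed.

End Extension.

(* Two commuting involutions split a ring into four Peirce blocks, indexed by
   signs; [bit] lists the signs of the two involutions and of their product.
   *)
Definition I4 : finType := (bool * bool)%type.

Definition bit (k : option bool) (i : I4) :=
  match k with Some true => i.1 | Some false => i.2 | None => i.1 == i.2 end.

(** This is what the product involution is for: to separate [(true, true)] from both [(true, false)]
    and [(false, true)], neither of the first two signs suffices. *)
Lemma bit_separates (i j l : I4) : i != j -> l != i ->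
  exists k, bit k i != bit k j /\ bit k l != bit k i.
Proof.
by case: i j l => [[] []] [[] []] [[] []] // _ _;
  solve [by exists (Some true) | by exists (Some false) | by exists None].
Qed.

Lemma bit_neq (i j : I4) : i != j -> exists k, bit k i != bit k j.
Proof.
by case: i j => [[] []] [[] []] // _;
  solve [by exists (Some true) | by exists (Some false) | by exists None].
Qed.

Definition bit_idem (R : pzRingType) (e : I4 ->
  R) k b := \sum_(i | bit k i == b) e i.

Section BitIdem.
Variables (R : pzRingType) (e : I4 -> R).
Hypothesis orthe : orthogonal_idempotents e.

Lemma bit_idem_mul k b i : bit_idem e k b * e i = if bit k i == b then e i else 0.
Proof.
rewrite /bit_idem big_distrl /=; case: ifP => ki.
  rewrite (bigD1 i) //= idem_orth // big1 ?addr0 // => j /andP[_ ji].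
  exact: mul_orth.
by rewrite big1 // => j kj; apply: mul_orth => //; apply: contraFneq ki => <-.
Qed.

Lemma mul_bit_idem k b i : e i * bit_idem e k b = if bit k i == b then e i else 0.
Proof.
rewrite /bit_idem big_distrr /=; case: ifP => ki.
  rewrite (bigD1 i) //= idem_orth // big1 ?addr0 // => j /andP[_ ji].
  by apply: mul_orth => //; rewrite eq_sym.
rewrite big1 // => j kj; apply: mul_orth => //.
by apply: contraFneq ki => ->.
Qed.

Lemma bit_idem_idem k b : bit_idem e k b * bit_idem e k b = bit_idem e k b.
Proof.
rewrite {2}/bit_idem big_distrr; apply: eq_bigr => i ki /=.
by rewrite bit_idem_mul ki.
Qed.

Lemma bit_idem_compl k b : bit_idem e k (~~ b) = 1 - bit_idem e k b.
Proof.
rewrite -orthe.2 (bigID (fun i => bit k i == b)) /= addrC addrK.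
by apply: eq_bigl => i; case: (bit k i); case: b.
Qed.

Lemma peirce_nilrad i j k x : bit k i != bit k j -> peirce e i j x ->
  nilrad (bit_idem e k (bit k i)) x.
Proof.
move=> kij [ix xj]; split; first by rewrite -ix mulrA bit_idem_mul eqxx.
by rewrite -xj -mulrA mul_bit_idem eq_sym (negPf kij) mulr0.
Qed.

(** An index [l] other than [i] is separated from [i] by a sign that also separates [i] from [j],
    which kills [e l * x]; symmetrically on the right. So the block is an intersection of
    radicals. *)
Lemma nilrad_peirce i j x : i != j ->
    (forall k, bit k i != bit k j -> nilrad (bit_idem e k (bit k i)) x) ->
  peirce e i j x.
Proof.
move=> ij H.
have left0 l : l != i -> e l * x = 0.
  move=> li; have [k [kij kl]] := bit_separates ij li; have [<- _] := H k kij.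
  by rewrite mulrA mul_bit_idem (negPf kl) mul0r.
have right0 l : l != j -> x * e l = 0.
  move=> lj; have ji : j != i by rewrite eq_sym.
  have [k [kij kl]] := bit_separates ji lj; rewrite eq_sym in kij.
  have [_ xk] := H k kij; have kli : bit k l == bit k i.
    by case: (bit k l) (bit k i) (bit k j) kij kl => [] [] [].
  have := bit_idem_mul k (bit k i) l; rewrite kli => <-.
  by rewrite mulrA xk mul0r.
split.
  by rewrite -[RHS]mul1r -orthe.2 big_distrl (bigD1 i) //= big1 ?addr0.
by rewrite -[RHS]mulr1 -orthe.2 big_distrr (bigD1 j) //= big1 ?addr0.
Qed.

End BitIdem.

(** * Frames of idempotents and transfer of the ring structure *)

Section Framed.
Variables (R : unitRingType) (e : I4 -> R) (u : I4 -> I4 -> R).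

Definition frame_idx : seq I4 := [:: (true, false); (false, true); (false, false)].

(* Only three indices carry matrix units; the idempotent at [(true, true)] is
   the remainder and may vanish. *)
Definition framed :=
  [/\ orthogonal_idempotents e,
      {in frame_idx &, forall i j, peirce e i j (u i j)},
      {in frame_idx & &, forall i j k, u i j * u j k = u i k},
      {in frame_idx, forall i, u i i = e i} & e (false, false) != 0].

End Framed.

Section FrameTransfer.
Variables (R : unitRingType) (S : nzRingType).
Variables (e : I4 -> R) (u : I4 -> I4 -> R) (e' : I4 -> S).
Hypotheses (R2 : 2%:R \is a @GRing.unit R) (framedR : framed e u).
Hypotheses (simpleR : simple_ring R) (simpleS : simple_ring S).
Hypothesis orthe' : orthogonal_idempotents e'.
Variables (phi : R -> S) (psi' : S -> R).
Hypotheses (phi1 : phi 1 = 1).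
Hypothesis phiM : forall x y, comm_units x -> comm_units y ->
  phi (x * y) = phi x * phi y.
Hypothesis phi_nilrad : forall k b x, nilrad (bit_idem e k b) x ->
  nilrad (bit_idem e' k b) (phi (1 + x) - 1) /\ psi' (phi (1 + x) - 1) = x.
Hypothesis psi'_nilrad : forall k b y, nilrad (bit_idem e' k b) y ->
  nilrad (bit_idem e k b) (psi' y) /\ phi (1 + psi' y) - 1 = y.

Let psi x := phi (1 + x) - 1.

Lemma comm_units_peirce i j x : i != j -> peirce e i j x -> comm_units (1 + x).
Proof.
move=> ij [ix xj]; have [orthe _ _ _ _] := framedR.
apply: (comm_units_elementary R2 (idem_orth orthe i) ix).
by rewrite -xj -mulrA mul_orth ?mulr0 // eq_sym.
Qed.

(** On a block products vanish, so [1 + x] multiplies as [x] adds. Since [phi] is only assumed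
    multiplicative, the lemma also applies to [x] mapped to [(phi x)^-1] with values in the converse
    ring. *)
Lemma frame_transfer : exists2 theta : R -> S, ring_isomorphism theta &
  forall i j x, i != j -> peirce e i j x -> theta x = phi (1 + x) - 1.
Proof.
have [orthe u_off uM u_diag ec0] := framedR.
have psi_off i j x : i != j -> peirce e i j x -> peirce e' i j (psi x).
  move=> ij hx; apply: nilrad_peirce => // k kij.
  by apply: (phi_nilrad _).1; apply: peirce_nilrad hx.
have psiD i j x y : i != j -> peirce e i j x -> peirce e i j y ->
    psi (x + y) = psi x + psi y.
  move=> ij hx hy; have ji : j != i by rewrite eq_sym.
  have [X Y] := (psi_off _ _ _ ij hx, psi_off _ _ _ ij hy).
  have XY := peirce_mul0 orthe' X Y ji; have xy := peirce_mul0 orthe hx hy ji.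
  rewrite /psi in X Y XY *.
  have -> : 1 + (x + y) = (1 + x) * (1 + y).
    have -> : (1 + x) * (1 + y) = 1 + (x + y) + x * y by non_commutative_ring.
    by rewrite xy addr0.
  rewrite phiM; try exact: comm_units_peirce ij _.
  move: (phi (1 + x)) (phi (1 + y)) XY => a b XY.
  have -> : a * b - 1 = (a - 1) + (b - 1) + (a - 1) * (b - 1).
    by non_commutative_ring.
  by rewrite XY addr0.
have psiN i j x : i != j -> peirce e i j x -> psi (- x) = - psi x.
  move=> ij hx; have hNx : peirce e i j (- x).
    by case: hx => ix xj; split; rewrite ?mulrN ?mulNr ?ix ?xj.
  apply/eqP; rewrite -addr_eq0 -(psiD i j) // addNr.
  by rewrite /psi addr0 phi1 subrr.
have psiM i j k x y : i != j -> j != k -> i != k ->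
    peirce e i j x -> peirce e j k y -> psi (x * y) = psi x * psi y.
  have comm4 (T : pzRingType) (f : I4 -> T) a b : orthogonal_idempotents f ->
      i != j -> j != k -> i != k -> peirce f i j a -> peirce f j k b ->
    1 + a * b = (1 + a) * (1 + b) * (1 + - a) * (1 + - b).
    move=> orthf ij jk ik ha hb.
    have [ji [kj ki]] : j != i /\ k != j /\
      k != i by rewrite !(eq_sym k) (eq_sym j).
    have aa := peirce_mul0 orthf ha ha ji; have bb := peirce_mul0 orthf hb hb kj.
    have ba := peirce_mul0 orthf hb ha ki.
    exact: elementary_commutatorE.
  move=> ij jk ik hx hy.
  have hNx : peirce e i j (- x).
    by case: hx => ix xj; split; rewrite ?mulrN ?mulNr ?ix ?xj.
  have hNy : peirce e j k (- y).
    by case: hy => iy yj; split; rewrite ?mulrN ?mulNr ?iy ?yj.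
  have phiE z : phi (1 + z) = 1 + psi z by rewrite /psi [RHS]addrC subrK.
  rewrite {1}/psi (comm4 _ e) // !phiM; try by do ?apply: comm_unitsM;
    solve [apply: comm_units_peirce ij _ => // | apply: comm_units_peirce jk _ =>
      //].
  rewrite !phiE (psiN i j) // (psiN j k) // -(comm4 _ e') //; try exact: psi_off.
  by rewrite addrC addKr.
apply: (@peirce_extension R S _ e e' orthe orthe' simpleR simpleS psi psi' psi_off
  _ _ _ psiD psiM (true, false) (false, true) (false, false) u).
- move=> i j y ij hy; apply: nilrad_peirce => // k kij.
  by apply: (psi'_nilrad _).1; apply: peirce_nilrad hy.
- move=> i j x ij hx; have [k kij] := bit_neq ij.
  exact: (phi_nilrad (peirce_nilrad orthe kij hx)).2.
- move=> i j y ij hy; have [k kij] := bit_neq ij.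
  exact: (psi'_nilrad (peirce_nilrad orthe' kij hy)).2.
all: by [].
Qed.

End FrameTransfer.

(** * The image of a frame under a group isomorphism *)

(** If [r] denotes this element, then [2r - 1 = (2p - 1)(2q - 1)]: it belongs to the product of the
    two involutions. *)
Definition xnor_idem (R : pzRingType) (p q : R) := p * q + (1 - p) * (1 - q).

Lemma sum_I4 (V : zmodType) (f : I4 -> V) (P : pred I4) :
  \sum_(i | P i) f i =
    (if P (true, true) then f (true, true) else 0) +
    (if P (true, false) then f (true, false) else 0) +
    (if P (false, true) then f (false, true) else 0) +
    (if P (false, false) then f (false, false) else 0).
Proof.
rewrite big_mkcond; pose h i := if P i then f i else 0.
transitivity (\sum_a \sum_b h (a, b)); last by rewrite !big_bool /= addrA.
by rewrite pair_bigA; apply: eq_bigr => -[].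
Qed.

Lemma frame_of_commuting (R : pzRingType) (q : option bool -> R) :
    (forall k, q k * q k = q k) ->
      q (Some true) * q (Some false) = q (Some false) * q (Some true) ->
    q None = xnor_idem (q (Some true)) (q (Some false)) ->
  exists2 e : I4 -> R, orthogonal_idempotents e & forall k, bit_idem e k true = q k.
Proof.
move=> qq; have := qq (Some true); have := qq (Some false).
set q1 := q (Some true); set q2 := q (Some false) => q2q2 q1q1 q12 q3.
pose sel (p : R) b := if b then p else 1 - p.
pose e (i : I4) := sel q1 i.1 * sel q2 i.2.
have selM (p : R) b b' : p * p = p ->
  sel p b * sel p b' = if b == b' then sel p b else 0.
  move=> pp; case: b b' => [] [] //=; first by rewrite mulrBr mulr1 pp subrr.
    by rewrite mulrBl mul1r pp subrr.
  exact: idem_compl.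
have selC b b' : sel q1 b * sel q2 b' = sel q2 b' * sel q1 b.
  have half_comm (p : R) : GRing.comm p q2 -> GRing.comm p (sel q2 b').
    by case: b' => //= pq; apply: commrB => //; apply: commr1.
  apply: half_comm; case: b => //=; apply: commr_sym.
  by apply: commrB; [apply: commr1 | apply: commr_sym].
exists e; last first.
  move=> k; rewrite /bit_idem sum_I4 /e /sel.
  case: k => [[]|] /=; rewrite ?addr0 ?add0r.
  - by rewrite -mulrDr addrC subrK mulr1.
  - by rewrite -mulrDl addrC subrK mul1r.
  - by rewrite q3.
split=> [[a b] [c d]|]; last first.
  by rewrite sum_I4 /e /sel /=; non_commutative_ring.
rewrite /e /= mulrA -(mulrA (sel q1 a)) -selC mulrA selM //.
rewrite -mulrA selM // xpair_eqE; case: (a == c); last by rewrite mul0r.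
by case: (b == d); rewrite ?mulr0.
Qed.

Section Framed.
Variables (F : fieldType) (R : unitAlgType F) (S : unitRingType).
Variables (e : I4 -> R) (u : I4 -> I4 -> R).
Hypotheses (goodR : split_simple R) (goodS : split_simple S) (framedR : framed e u).
Variables (phi : R -> S) (psi : S -> R).
Hypothesis phipsi : comm_units_iso phi psi.

Let orthe : orthogonal_idempotents e. Proof. by case: framedR. Qed.
Let P k := bit_idem e k true.
Let g k := P k + P k - 1.

Lemma frame_idem_neq0 i : i \in frame_idx -> e i != 0.
Proof.
have [_ u_off uM u_diag ec0] := framedR;
  have cI : (false, false) \in frame_idx by [].
move=> iI; apply: contra_neq ec0 => ei; rewrite -u_diag // -(uM _ i) //.
by have [_ <-] := u_off _ _ cI iI; rewrite ei mulr0 mul0r.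
Qed.

(** The index without matrix units is [(true, true)], where all three signs are true. Hence each
    [g k] is -1 on exactly two indices that carry matrix units and is a torus element of parameter
    -1. *)
Let bit_false k : exists i j, [/\ i \in frame_idx, j \in frame_idx, i != j
   & bit_idem e k false = e i + e j].
Proof.
case: k => [[]|]; rewrite /bit_idem sum_I4 /= ?addr0 ?add0r.
- by exists (false, true), (false, false).
- by exists (true, false), (false, false).
- by exists (true, false), (false, true).
Qed.

Let Kg k : comm_units (g k).
Proof.
have [_ u_off uM u_diag _] := framedR.
have [i [j [iI jI ij bE]]] := bit_false k.
have ji : j != i by rewrite eq_sym.
have -> : g k = 1 + (-1 - 1) *: (u i j * u j i) + ((-1)^-1 - 1) *: (u j i * u i j).
  rewrite !uM // !u_diag // invrN1 -addrA -scalerDr -bE.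
  rewrite (bit_idem_compl orthe k true) -/(P k).
  rewrite /g scalerBl scaleN1r scale1r; non_commutative_ring.
apply: comm_units_torus; rewrite ?oppr_eq0 ?oner_eq0 //.
- exact: (peirce_mul0 orthe (u_off _ _ iI jI) (u_off _ _ iI jI) ji).
- exact: (peirce_mul0 orthe (u_off _ _ jI iI) (u_off _ _ jI iI) ij).
- by rewrite !uM.
- by rewrite !uM.
Qed.

Let PP k : P k * P k = P k. Proof. exact: bit_idem_idem. Qed.

Let P_eq1 k : P k != 1.
Proof.
have [i [j [iI jI ij bE]]] := bit_false k.
apply: contraNneq (frame_idem_neq0 iI) => P1.
have := bit_idem_compl orthe k true; rewrite bE -/(P k) P1 subrr => eij.
by have := congr1 ( *%R (e i)) eij;
  rewrite mulrDr idem_orth // mul_orth // addr0 mulr0 => ->.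
Qed.

Let P_eq0 k : P k != 0.
Proof.
have [i iI ki] : exists2 i, i \in frame_idx & bit k i.
  case: k => [[]|].
  - by exists (true, false).
  - by exists (false, true).
  - by exists (false, false).
apply: contraNneq (frame_idem_neq0 iI) => P0.
by have := bit_idem_mul orthe k true i; rewrite ki -/(P k) P0 mul0r => ->.
Qed.

Let g_mul k i : g k * e i = if bit k i then e i else - e i.
Proof.
rewrite /g mulrBl mul1r mulrDl /P bit_idem_mul //.
by case: (bit k i) => /=; rewrite ?addrK // addr0 sub0r.
Qed.

Let g_eq x y : (forall i, x * e i = y * e i) -> x = y.
Proof.
move=> xy; rewrite -[x]mulr1 -[y]mulr1 -orthe.2 !big_distrr.
by apply: eq_bigr => i _; apply: xy.
Qed.

Let g3E : g None = g (Some true) * g (Some false).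
Proof.
apply: g_eq => i; rewrite -mulrA !g_mul.
by case: i => [[] []] /=; rewrite ?mulrN ?g_mul //= opprK.
Qed.

Let g12 : g (Some true) * g (Some false) = g (Some false) * g (Some true).
Proof.
apply: g_eq => i; rewrite -!mulrA !g_mul.
by case: i => [[] []] /=; rewrite ?mulrN ?g_mul.
Qed.

(** The idempotent is [(1 + phi (g k)) / 2]. It is nontrivial because [g k] fails to commute with
    some [1 + x], whereas the images of 0 and 1 would make [phi (g k)] central. *)
Let image_idem k : exists p, [/\ p * p = p, phi (g k) = p + p - 1, p != 0 & p != 1].
Proof.
have [[phiK phiM] [psiK psiM] phiK' psiK'] := phipsi.
have [S2 simpleS _] := goodS; have [R2 simpleR _] := goodR.
pose t : S := 2%:R^-1; have tt : t + t = 1.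
  by rewrite -[t + t](mulr_natl t 2) divrr.
have tC (y : S) : y * t = t * y by apply: commrV; apply: commr_nat.
have gg : g k * g k = 1.
  rewrite /g; have -> : (P k + P k - 1) * (P k + P k - 1) =
    P k * P k + P k * P k + P k * P k + P k * P k - P k - P k - P k - P k + 1.
    by non_commutative_ring.
  by rewrite PP; non_commutative_ring.
have g'g' : phi (g k) * phi (g k) = 1.
  by rewrite -phiM // gg; apply: comm_units_hom1; split.
have gE (x : R) : nilrad (P k) x -> g k * x = x /\ x * g k = - x.
  move=> [Px xP]; have -> : g k * x = P k * x + P k * x - x.
    by rewrite /g; non_commutative_ring.
  have -> : x * g k = x * P k + x * P k - x by rewrite /g; non_commutative_ring.
  by rewrite Px xP addrK addr0 sub0r.
have [x hx x0] := nilrad_exists simpleR (PP k) (P_eq0 k) (P_eq1 k).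
have [gx xg] := gE _ hx.
have Kx := comm_units_nilrad R2 (PP k) hx.
have noncentral : phi (g k) * phi (1 + x) != phi (1 + x) * phi (g k).
  apply: contraNneq x0; rewrite -!phiM // => /(congr1 psi).
  rewrite !phiK'; try exact: comm_unitsM.
  rewrite [g k * _]mulrDr mulr1 gx [_ * g k]mulrDl mul1r xg => /addrI/eqP.
  rewrite -addr_eq0 => /eqP xx.
  by apply/eqP; apply: two_torsion_free R2 xx.
pose p := t * (1 + phi (g k)).
have pE : p + p = 1 + phi (g k) by rewrite /p -mulrDl tt mul1r.
exists p; split.
- move: (phi (g k)) g'g' @p {pE} => h hh p.
  have hh2 : (1 + h) * (1 + h) = (1 + h) + (1 + h).
    have -> : (1 + h) * (1 + h) = 1 + h + h + h * h by non_commutative_ring.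
    by rewrite hh; non_commutative_ring.
  rewrite {1}/p {1}/p -mulrA (mulrA (1 + h)) tC -mulrA hh2 mulrDr -mulrDl tt.
  by rewrite mul1r.
- by rewrite pE addrC addKr.
- apply: contra_neq noncentral => p0; move: pE; rewrite p0 addr0 => /esym/eqP.
  by rewrite addrC addr_eq0 => /eqP->; rewrite mulN1r mulrN1.
- apply: contra_neq noncentral => p1; move: pE; rewrite p1 => /addrI <-.
  by rewrite mul1r mulr1.
Qed.

Let transfers q := forall k, nilrad_iso phi psi (P k) (q k) /\
  nilrad_iso phi psi (1 - P k) (1 - q k).

(** Each [q k] is [p k] or its complement, and the [p k] satisfy the [xnor_idem] relation because
    [g None] is a product. Every complement negates one side of that relation, so only the parity of
    their number matters. *)
Let image_frame : exists2 q : option bool -> S, transfers q &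
  [/\ forall k, q k * q k = q k,
     q (Some true) * q (Some false) = q (Some false) * q (Some true)
   & q None = xnor_idem (q (Some true)) (q (Some false)) \/
     q None = 1 - xnor_idem (q (Some true)) (q (Some false))].
Proof.
have [[phiK phiM] [psiK psiM] phiK' psiK'] := phipsi.
have [S2 simpleS _] := goodS; have [R2 simpleR _] := goodR.
have [p pP] := choice image_idem.
have pp k : p k * p k = p k by case: (pP k).
have pg k : phi (g k) = p k + p k - 1 by case: (pP k).
have ex k : exists qk, (qk = p k \/ qk = 1 - p k) /\
    (nilrad_iso phi psi (P k) qk /\ nilrad_iso phi psi (1 - P k) (1 - qk)).
  have [_ _ p0 p1] := pP k.
  have [||qk qkE hq] := nilrad_isoP goodR goodS phipsi (PP k) (pp k) (Kg k) erefl
    _ _ (P_eq0 k) (P_eq1 k) p0 p1; [by left | by left | by exists qk].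
have [q qP] := choice ex.
have S2' (x y : S) : x + x = y + y -> x = y.
  move=> xy; apply/eqP; rewrite -subr_eq0; apply/eqP/(two_torsion_free S2).
  by rewrite addrACA -opprD xy subrr.
have p12 : GRing.comm (p (Some true)) (p (Some false)).
  have : phi (g (Some true)) * phi (g (Some false)) =
      phi (g (Some false)) * phi (g (Some true)).
    by rewrite -!phiM // g12.
  rewrite !pg; move: (p (Some true)) (p (Some false)) => a b ab.
  (* Expresses [4xy] by the involutions [2x - 1] and [2y - 1]; as 2 is invertible, commuting
     involutions yield commuting idempotents. *)
  have four (x y : S) : x * y + x * y + (x * y + x * y) =
      (x + x - 1) * (y + y - 1) + x + x + y + y - 1 by non_commutative_ring.
  by apply/S2'/S2'; rewrite four ab; non_commutative_ring.
have p3 : p None = xnor_idem (p (Some true)) (p (Some false)).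
  have := phiM _ _ (Kg (Some true)) (Kg (Some false)); rewrite -g3E !pg.
  move: (p None) (p (Some true)) (p (Some false)) => a b c aE.
  apply: S2'; apply: (addIr (-1)); rewrite aE /xnor_idem.
  by non_commutative_ring.
exists q => [k|]; first by case: (qP k).
split=> [k||].
- by have [[->|->] _] := qP k => //; apply: idem_compl.
- have comm1 (a b : S) : GRing.comm a b -> GRing.comm a (1 - b).
    by move=> ab; apply: commrB => //; apply: commr1.
  have [[->|->] _] := qP (Some true); have [[->|->] _] := qP (Some false) => //.
  - exact: comm1.
  - exact/commr_sym/comm1/commr_sym.
  - exact/comm1/commr_sym/comm1/commr_sym.
have xnorN1 (a b : S) : xnor_idem (1 - a) b = 1 - xnor_idem a b.
  by rewrite /xnor_idem; non_commutative_ring.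
have xnorN2 (a b : S) : xnor_idem a (1 - b) = 1 - xnor_idem a b.
  by rewrite /xnor_idem; non_commutative_ring.
have [[->|->] _] := qP None; have [[->|->] _] := qP (Some true);
  have [[->|->] _] := qP (Some false); rewrite p3 ?xnorN1 ?xnorN2 ?subKr; auto.
Qed.

Let nilrad_unit (T : unitRingType) (f x : T) : f * f = f -> nilrad f x ->
  (1 + x)^-1 = 1 - x.
Proof.
move=> ff hx; have xx := nilrad_mul0 hx hx.
have E1 : (1 + x) * (1 - x) = 1 - x * x by non_commutative_ring.
have E2 : (1 - x) * (1 + x) = 1 - x * x by non_commutative_ring.
rewrite xx subr0 in E1 E2; exact: (mulr_invE E1 E2).2.
Qed.

Let psi1K (f : R) x : f * f = f -> nilrad f x ->
  psi (1 + (phi (1 + x) - 1)) - 1 = x.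
Proof.
move=> ff hx; have [_ _ phiK' _] := phipsi; have [R2 _ _] := goodR.
have -> : 1 + (phi (1 + x) - 1) = phi (1 + x) by rewrite addrC subrK.
by rewrite phiK' ?[1 + x]addrC ?addrK // addrC; apply: comm_units_nilrad hx.
Qed.

Let phi1K (f : S) y : f * f = f -> nilrad f y ->
  phi (1 + (psi (1 + y) - 1)) - 1 = y.
Proof.
move=> ff hy; have [_ _ _ psiK'] := phipsi; have [S2 _ _] := goodS.
have -> : 1 + (psi (1 + y) - 1) = psi (1 + y) by rewrite addrC subrK.
by rewrite psiK' ?[1 + y]addrC ?addrK // addrC; apply: comm_units_nilrad hy.
Qed.

Lemma simple_converse (T : nzRingType) : simple_ring T -> simple_ring (T^c).
Proof.
move=> sT x x0; have [s s1] := sT x x0.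
exists [seq (w.2, w.1) | w <- s]; rewrite big_map; apply: etrans s1.
by apply: eq_bigr => w _; exact: mulrA.
Qed.

(** For even parity the [q k] are the sign idempotents of a frame in [S]. For odd parity their
    complements are, so every block [(i, j)] lands in [(j, i)], which inversion and the converse
    ring straighten out. *)
Theorem framed_comm_units_iso :
  (exists2 theta : R -> S, ring_isomorphism theta &
     forall i j x, i != j -> peirce e i j x -> theta x = phi (1 + x) - 1) \/
  (exists2 theta : R -> S^c, ring_isomorphism theta &
     forall i j x, i != j -> peirce e i j x -> theta x = (phi (1 + x))^-1 - 1).
Proof.
have [hphi hpsi phiK' psiK'] := phipsi; have [phiK phiM] := hphi.
have [S2 simpleS _] := goodS; have [R2 simpleR _] := goodR.
have phi1 := comm_units_hom1 hphi.
have [q qT [qq q12 [q3|q3]]] := image_frame; [left|right].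
  have [e' orthe' e'q] := frame_of_commuting qq q12 q3.
  have sides k b : nilrad_iso phi psi (bit_idem e k b) (bit_idem e' k b).
    have [Ht Hf] := qT k; case: b; first by rewrite e'q.
    by rewrite (bit_idem_compl orthe k true) (bit_idem_compl orthe' k true) e'q.
  apply: (frame_transfer R2 framedR simpleR simpleS orthe' phi1 phiM
            (psi' := fun y => psi (1 + y) - 1)) => k b z hz.
    split; first by apply: (sides k b).1.
    by apply: psi1K hz; apply: bit_idem_idem.
  split; first by apply: (sides k b).2.
  by apply: phi1K hz; apply: bit_idem_idem.
pose r k := 1 - q k.
have rr k : r k * r k = r k by apply: idem_compl.
have r12 : r (Some true) * r (Some false) = r (Some false) * r (Some true).
  have comm1 (a b : S) : GRing.comm a b -> GRing.comm a (1 - b).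
    by move=> ab; apply: commrB => //; apply: commr1.
  exact/comm1/commr_sym/comm1/commr_sym.
have r3 : r None = xnor_idem (r (Some true)) (r (Some false)).
  by rewrite /r q3 /xnor_idem; non_commutative_ring.
have [e' orthe' e'r] := frame_of_commuting rr r12 r3.
have orthe'c : orthogonal_idempotents (e' : I4 -> S^c).
  case: orthe' => orth sum; split=> // i j.
  by rewrite [LHS](orth j i) eq_sym; case: eqVneq => // ->.
have sides k b : nilrad_iso phi psi (bit_idem e k b) (1 - bit_idem e' k b).
  have [Ht Hf] := qT k; case: b; first by rewrite e'r /r subKr.
  by rewrite (bit_idem_compl orthe k true) (bit_idem_compl orthe' k true) e'r /r
    !subKr.
have nilradN (T : pzRingType) (f y : T) : nilrad f y -> nilrad f (- y).
  by move=> [fy yf]; split; rewrite ?mulrN ?mulNr ?fy ?yf ?oppr0.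
(* Reversing products exchanges the left and right conditions, that is, an idempotent with its
   complement. *)
have nilradc k b (y : S) : nilrad (bit_idem (e' : I4 -> S^c) k b) (y : S^c) <->
    nilrad (1 - bit_idem e' k b) y.
  by rewrite nilrad_compl; split=> -[].
have ff' k b : (1 - bit_idem e' k b) * (1 - bit_idem e' k b) = 1 - bit_idem e' k b.
  by apply: idem_compl; apply: bit_idem_idem.
have ff k b := bit_idem_idem orthe k b.
have phiVE k b z : nilrad (bit_idem e k b) z ->
    (phi (1 + z))^-1 - 1 = - (phi (1 + z) - 1).
  move=> hz; have hw := (sides k b).1 z hz.
  have -> : phi (1 + z) = 1 + (phi (1 + z) - 1) by rewrite [RHS]addrC subrK.
  move: (phi (1 + z) - 1) hw => w hw; rewrite (nilrad_unit (ff' k b) hw).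
  by rewrite -[1 + w]addrC addrK addrC addKr.
apply: (frame_transfer (S := S^c) (phi := fun x => (phi x)^-1) R2 framedR simpleR
  (simple_converse simpleS) orthe'c _ _ (psi' := fun y => psi (1 - y) - 1)).
- by rewrite phi1 invr1.
- move=> x y Kx Ky; rewrite phiM // invrM //; apply: comm_units_unit; exact: phiK.
- move=> k b z hz; have hw := (sides k b).1 z hz.
  rewrite (phiVE k b) //; split; first by apply/nilradc/nilradN.
  by rewrite opprK; apply: psi1K hz.
- move=> k b y /nilradc/nilradN hy; have hz := (sides k b).2 _ hy.
  split=> //; rewrite (phiVE k b) //.
  by rewrite (phi1K _ hy) // opprK.
Qed.

End Framed.

(** * Matrix algebras embedded in a locally matrix algebra *)

Lemma lrmorphism_build (F : fieldType) (A B : algType F) (h : A -> B) :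
    {morph h : x y / x + y} -> h 1 = 1 -> {morph h : x y / x * y} ->
    (forall a, {morph h : x / a *: x}) ->
  exists H : {lrmorphism A -> B}, H =1 h.
Proof.
move=> hD h1 hM hZ.
have hB : zmod_morphism h.
  move=> x y; apply: (addIr (h y)); rewrite -hD !subrK //.
pose H : {lrmorphism A -> B} := HB.pack h
  (GRing.isZmodMorphism.Build _ _ h hB)
  (GRing.isMonoidMorphism.Build _ _ h (conj h1 hM))
  (GRing.isScalable.Build _ _ _ _ h hZ).
by exists H.
Qed.

Lemma mx_linear_injection (F : fieldType) m n (L : {linear 'M[F]_m -> 'M[F]_n}) :
  injective L -> (m <= n)%N /\ (m = n -> forall y, exists x, L x = y).
Proof.
move=> L_inj; have free : row_free (lin_mx L).
  rewrite -kermx_eq0; apply/rowV0P => v /sub_kermxP.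
  rewrite -[v]vec_mxK mul_vec_lin -(linear0 mxvec) => /(can_inj mxvecK).
  by rewrite -(linear0 L) => /L_inj->; rewrite linear0.
split.
  have := rank_leq_col (lin_mx L); by rewrite (eqP free) !mulnn leq_sqr.
move=> mn; subst n => y; exists (vec_mx (mxvec y *m invmx (lin_mx L))).
have Lu : lin_mx L \in unitmx by rewrite -row_free_unit.
by apply: (can_inj mxvecK); rewrite -mul_vec_lin vec_mxK mulmxKV.
Qed.

(** An idempotent is annihilated by [X(X - 1)], which has distinct roots in [F], and commuting
    diagonalizable matrices are simultaneously diagonalizable. *)
Lemma idempotents_codiagonalizable (F : fieldType) n (es : seq 'M[F]_n.+1) :
    {in es, forall e, e * e = e} -> {in es &, forall e f, e * f = f * e} ->
  exists2 P, P \in unitmx & {in es, forall e, exists d,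
    P *m e *m invmx P = diag_mx d}.
Proof.
move=> idem comm; have [|P Pu /allP diagP] := (codiagonalizableP es).1.
  split=> // e /idem ee; apply/diagonalizableP; exists [:: 0; 1].
    by rewrite /= inE eq_sym oner_eq0.
  apply/mxminpoly_minP; rewrite !big_cons big_nil mulr1 subr0.
  by rewrite rmorphM rmorphB /= horner_mx_X horner_mx_C mulrBr ee mulr1 subrr.
exists P => // e /diagP /= eD.
by rewrite -conjumx //; apply/diag_mxP.
Qed.

Lemma delta_mx_sandwich (R : comPzRingType) m n p q (M : 'M[R]_(n, p))
    (k : 'I_m) i j (l : 'I_q) :
  delta_mx k i *m M *m delta_mx j l = M i j *: delta_mx k l.
Proof.
rewrite -(mul_delta_mx (0 : 'I_1) k i) -(mul_delta_mx (0 : 'I_1) j l).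
rewrite mulmxA -(mulmxA _ _ M) -rowE -(mulmxA _ (row i M)) -colE.
rewrite [col _ _]mx11_scalar !mxE mul_mx_scalar -scalemxAl mul_delta_mx //.
Qed.

Lemma matrix_simple (F : fieldType) n : simple_ring 'M[F]_n.+1.
Proof.
move=> m m0; have [i [j mij]] : exists i j, m i j != 0.
  have [/existsP[i /existsP[j mij]]|] := boolP [exists i, [exists j, m i j != 0]].
    by exists i, j.
  move=> /existsPn H; case/eqP: m0; apply/matrixP => i j; rewrite mxE.
  by have := H i => /existsPn/(_ j); rewrite negbK => /eqP.
(* [E_ki * m * E_jk] equals [m i j] times [E_kk], and the [E_kk] sum to 1. *)
exists [seq ((m i j)^-1 *: delta_mx k i, delta_mx j k) | k <- enum 'I_n.+1].
rewrite big_map big_enum /= -[RHS]/(1%:M) mx1_sum_delta.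
apply: eq_bigr => k _; rewrite -!scalerAl [X in _ *: X]delta_mx_sandwich.
by rewrite scalerA mulVf // scale1r.
Qed.

Lemma simple_morph_inj (R : pzRingType) (S : nzRingType) (f : {rmorphism R -> S}) :
  simple_ring R -> injective f.
Proof.
move=> simpleR x y xy; apply/eqP; rewrite -subr_eq0; apply/negPn/negP.
move=> /simpleR[s s1]; suff: f 1 = 0 by rewrite rmorph1 => /eqP; rewrite oner_eq0.
rewrite -s1 rmorph_sum big1 // => w _.
by rewrite !rmorphM rmorphB xy subrr mulr0 mul0r.
Qed.

Section Embeddings.
Variables (F : fieldType) (A : unitAlgType F).
Hypothesis locmxA : unital_locally_matrix A.

Lemma locmx_embed (s : seq A) : exists n (h : {lrmorphism 'M[F]_n.+1 -> A}),
  injective h /\ forall x, x \in s -> exists m, x = h m.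
Proof.
have [S [A' [sS [n [f [g fK gK]]]]]] := locmxA s.
have f_inj := can_inj fK.
have gD : {morph g : x y / x + y} by move=> x y; apply: f_inj;
  rewrite [LHS]gK rmorphD /= !gK.
have gM : {morph g : x y / x * y} by move=> x y; apply: f_inj;
  rewrite [LHS]gK rmorphM /= !gK.
have g1 : g 1 = 1 by apply: f_inj; rewrite [LHS]gK rmorph1.
have gZ a : {morph g : x / a *: x} by move=> x; apply: f_inj;
  rewrite [LHS]gK linearZ /= gK.
have [||||h hE] := @lrmorphism_build F _ A (fun m => val (g m)).
- by move=> x y /=; rewrite gD raddfD.
- by rewrite g1 rmorph1.
- by move=> x y /=; rewrite gM rmorphM.
- by move=> a x /=; rewrite gZ linearZ.
exists n, h; split=> [x y|x /sS xS].
  by rewrite !hE => /val_inj/(can_inj gK).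
by exists (f (Sub x xS)); rewrite hE fK SubK.
Qed.

(** Conjugating the source of the embedding diagonalizes the idempotents without moving any element
    of [A] or losing any element of the image. *)
Lemma embed_diag n (h : {lrmorphism 'M[F]_n.+1 -> A}) (es : seq A) :
    injective h -> {in es, forall e, exists m, e = h m} ->
    {in es, forall e, e * e = e} -> {in es &, forall e f, e * f = f * e} ->
  exists h' : {lrmorphism 'M[F]_n.+1 -> A}, [/\ injective h',
    forall x, (exists m, x = h m) -> exists m, x = h' m
    & {in es, forall e, exists d, e = h' (diag_mx d)}].
Proof.
move=> h_inj esh idem comm; have [g gP] : exists g : A -> 'M[F]_n.+1,
    {in es, forall e, e = h (g e)}.
  have /choice[g gP] : forall e, exists m, e \in es -> e = h m.
    by move=> e; have [/esh[m ->]|_] := boolP (e \in es); [exists m | exists 0].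
  by exists g.
have [|e f|P Pu diagP] := @idempotents_codiagonalizable F n (map g es).
- move=> _ /mapP[e ees ->]; apply: h_inj.
  by rewrite rmorphM /= -(gP e ees); apply: idem.
- move=> /mapP[e1 e1es ->] /mapP[f1 f1es ->]; apply: h_inj.
  by rewrite !rmorphM /= -(gP e1 e1es) -(gP f1 f1es); apply: comm.
have PV : P *m invmx P = 1 by rewrite mulmxV.
have VP : invmx P *m P = 1 by rewrite mulVmx.
have [||||h' h'E] := @lrmorphism_build F _ A (fun m : 'M[F]_n.+1 => h (invmx P *m
  m *m P)).
- by move=> x y /=; rewrite mulmxDr mulmxDl rmorphD.
- by rewrite mulmx1 VP rmorph1.
- move=> x y /=; rewrite -rmorphM; congr (h _).
  by rewrite -[RHS]/(_ *m _) -!mulmxA (mulmxA P) PV mul1mx.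
- by move=> a x /=; rewrite -scalemxAr -scalemxAl linearZ.
exists h'; split=> [x y|x [m ->]|e ees].
- rewrite !h'E => /h_inj /(congr1 (fun m => P *m m *m invmx P)).
  by rewrite !mulmxA PV !mul1mx -!mulmxA PV !mulmx1.
- exists (P *m m *m invmx P).
  by rewrite h'E !mulmxA VP mul1mx -mulmxA VP mulmx1.
have [d dE] := diagP _ (map_f g ees); exists d.
by rewrite h'E -dE !mulmxA VP mul1mx -mulmxA VP mulmx1 -gP.
Qed.

(** [h] factors through [h'] by a linear injection of matrix spaces; comparing dimensions bounds the
    size, and equal sizes make it onto. *)
Lemma embed_leq n (h : {lrmorphism 'M[F]_n.+1 ->
  A}) n' (h' : {lrmorphism 'M[F]_n'.+1 -> A}) :
    injective h -> injective h' ->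
    (forall i j, exists m, h (delta_mx i j) = h' m) ->
  (n <= n')%N /\ (n = n' -> forall m', exists m, h m = h' m').
Proof.
move=> h_inj h'_inj hh'.
have ex m : exists m', h m = h' m'.
  rewrite [m]matrix_sum_delta linear_sum.
  elim/big_ind: _ => [|x y [x' ->] [y' ->]|i _]; first by exists 0; rewrite linear0.
    by exists (x' + y'); rewrite linearD.
  rewrite linear_sum; elim/big_ind: _ => [|x y [x' ->] [y' ->]|j _].
  - by exists 0; rewrite linear0.
  - by exists (x' + y'); rewrite linearD.
  - by have [x' x'E] := hh' i j; exists (m i j *: x'); rewrite !linearZ /= x'E.
have [L LE] := choice ex.
have L_lin : linear L.
  by move=> a x y; apply: h'_inj; rewrite -LE !linearP /= -!LE.
pose L' : {linear 'M[F]_n.+1 ->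
  'M[F]_n'.+1} := HB.pack L (GRing.isLinear.Build _ _ _ _ L L_lin).
have L'_inj : injective L' by move=> x y /(congr1 h'); rewrite -!LE => /h_inj.
have [le surj] := mx_linear_injection L'_inj; split=> // nn' m'.
by have [|m <-] := surj _ m'; [rewrite nn' | exists m; rewrite LE].
Qed.

Definition has_mx3 := exists n (h : {lrmorphism 'M[F]_n.+3 -> A}), injective h.

(** Adding the matrix units of the given embedding to [s] keeps the new matrix algebra at least as
    large. *)
Lemma has_mx3_embed (s : seq A) : has_mx3 ->
  exists n (h : {lrmorphism 'M[F]_n.+3 -> A}),
    injective h /\ forall x, x \in s -> exists m, x = h m.
Proof.
move=> [n0 [h0 h0_inj]].
have [n [h [h_inj hs]]] := locmx_embed
  (s ++ [seq h0 (delta_mx p.1 p.2) | p : 'I_n0.+3 * 'I_n0.+3]).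
have [|le _] := embed_leq h0_inj h_inj.
  move=> i j; apply: hs; rewrite mem_cat; apply/orP; right.
  by apply/mapP; exists (i, j) => //; rewrite mem_enum.
case: n h h_inj hs le => [|[|n]] // h h_inj hs _.
exists n, h; split=> // x xs; apply: hs; by rewrite mem_cat xs.
Qed.

Lemma locmx_simple : simple_ring A.
Proof.
move=> x x0; have [n [h [h_inj /(_ x)[|m xm]]]] := locmx_embed [:: x].
  by rewrite inE.
have [|s s1] := @matrix_simple F n m.
  by apply: contraNneq x0 => m0; rewrite xm m0 rmorph0.
exists [seq (h w.1, h w.2) | w <- s].
rewrite big_map xm -(rmorph1 h) -s1 rmorph_sum; apply: eq_bigr => w _ /=.
by rewrite !rmorphM.
Qed.

End Embeddings.

Lemma delta_diag_mx (R : comPzRingType) n (d : 'rV[R]_n) i :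
  delta_mx i i *m diag_mx d = d 0 i *: delta_mx i i.
Proof.
apply/matrixP => a b; rewrite mul_mx_diag !mxE mulrC.
by have [->|_] := eqVneq b i; rewrite ?andbF ?mulr0.
Qed.

Lemma diag_delta_mx (R : comPzRingType) n (d : 'rV[R]_n) i :
  diag_mx d *m delta_mx i i = d 0 i *: delta_mx i i.
Proof.
apply/matrixP => a b; rewrite mul_diag_mx !mxE.
by have [->|_] := eqVneq a i; rewrite ?mulr0.
Qed.

Lemma delta_mx_neq0 (R : nzRingType) m n i j : delta_mx i j != 0 :> 'M[R]_(m, n).
Proof.
by apply/eqP => /matrixP/(_ i j); rewrite !mxE !eqxx => /eqP; rewrite oner_eq0.
Qed.

Section Diagonal.
Variables (F : fieldType) (A : unitAlgType F) (n : nat).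
Variable h : {lrmorphism 'M[F]_n.+1 -> A}.
Hypothesis h_inj : injective h.

Lemma diag_idem_bool d : h (diag_mx d) * h (diag_mx d) = h (diag_mx d) ->
  forall i, d 0 i = 0 \/ d 0 i = 1.
Proof.
rewrite -rmorphM => /h_inj dd i.
have /eqP := congr1 (fun m : 'M_n.+1 => delta_mx i i *m m) dd.
rewrite -[diag_mx d * _]/(_ *m _) mulmxA delta_diag_mx -scalemxAl delta_diag_mx
  scalerA.
rewrite -subr_eq0 -scalerBl scaler_eq0 (negPf (delta_mx_neq0 _ _ _)) orbF.
rewrite -[X in _ - X]mulr1 -mulrBr mulf_eq0 subr_eq0 => /orP[]/eqP; auto.
Qed.

Lemma splits_diag d i j : h (diag_mx d) * h (diag_mx d) = h (diag_mx d) ->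
  i != j -> d 0 i = 1 -> d 0 j = 1 -> splits (h (diag_mx d)).
Proof.
move=> ee ij di dj; pose p := h (delta_mx i i).
have pp : p * p = p by rewrite -rmorphM -[delta_mx i i * _]/(_ *m _) mul_delta_mx.
have pe : p * h (diag_mx d) = p.
  by rewrite -rmorphM -[delta_mx i i * _]/(_ *m _) delta_diag_mx di scale1r.
have ep : h (diag_mx d) * p = p.
  by rewrite -rmorphM -[diag_mx d * _]/(_ *m _) diag_delta_mx di scale1r.
have h0 k : h (delta_mx k k) != 0.
  apply: contraNneq (delta_mx_neq0 F k k) => hk.
  by apply/eqP/h_inj; rewrite hk rmorph0.
exists p, (h (diag_mx d) - p); split; split => //.
- by rewrite addrC subrK.
- exact: h0.
- apply: contraNneq (h0 j) => /eqP; rewrite subr_eq0 => /eqP hp.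
  have <- : h (diag_mx d) * h (delta_mx j j) = h (delta_mx j j).
    by rewrite -rmorphM -[diag_mx d * _]/(_ *m _) diag_delta_mx dj scale1r.
  rewrite hp -rmorphM -[delta_mx i i * _]/(_ *m _) mul_delta_mx_0 //.
  by rewrite rmorph0.
- by rewrite mulrBr !mulrBl ee pe ep pp subrr subr0.
- by rewrite mulrBr pe pp subrr.
- by rewrite mulrBl ep pp subrr.
Qed.

End Diagonal.

Section LocallyMatrix.
Variables (F : fieldType) (A : unitAlgType F).
Hypothesis locmxA : unital_locally_matrix A.

(** Pigeonhole: once diagonalized, [e] has at least three entries in [{0, 1}], so two coincide. Two
    ones split [e], two zeros split [1 - e]. *)
Lemma locmx_splits (e : A) : has_mx3 A -> e * e = e -> splits e \/ splits (1 - e).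
Proof.
move=> mx3 ee; have [n [h [h_inj he]]] := has_mx3_embed locmxA [:: e] mx3.
have [||x y|h' [h'_inj _ diag]] := embed_diag h_inj (es := [:: e]).
- by move=> x /he.
- by move=> x; rewrite inE => /eqP->.
- by rewrite !inE => /eqP-> /eqP->.
have [|d ed] := diag e; first by rewrite inE.
have dd := ee; rewrite ed in dd; have d01 := diag_idem_bool h'_inj dd.
pose i0 : 'I_n.+3 := inord 0; pose i1 : 'I_n.+3 := inord 1;
  pose i2 : 'I_n.+3 := inord 2.
have i01 : i0 != i1 by rewrite -val_eqE /= !inordK.
have i02 : i0 != i2 by rewrite -val_eqE /= !inordK.
have i12 : i1 != i2 by rewrite -val_eqE /= !inordK.
have split0 i j : i != j -> d 0 i = 0 -> d 0 j = 0 -> splits (1 - e).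
  move=> ij di dj; pose d' := const_mx 1 - d.
  have eE : 1 - e = h' (diag_mx d').
    by rewrite ed /d' linearB /= diag_const_mx rmorphB rmorph1.
  rewrite eE; apply: (splits_diag h'_inj _ ij); rewrite -?eE ?mxE ?di ?dj ?subr0 //.
  exact: idem_compl.
have split1 i j : i != j -> d 0 i = 1 -> d 0 j = 1 -> splits e.
  by move=> ij di dj; rewrite ed; apply: (splits_diag h'_inj dd ij).
case: (d01 i0) => d0; case: (d01 i1) => d1; case: (d01 i2) => d2;
  solve [left; eauto | right; eauto].
Qed.

Lemma locmx_good : 2%N \notin [pchar F] -> has_mx3 A -> split_simple A.
Proof.
move=> F2 mx3; split; last by move=> e ee _ _; apply: locmx_splits.
- have F2' : (2%:R : F) != 0 by apply: contra F2 => F2'; rewrite inE.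
  by rewrite -scaler_nat scaler_unit ?unitr1 // unitfE.
- exact: locmx_simple.
Qed.

Lemma locmx_framed : has_mx3 A -> exists e u, @framed A e u.
Proof.
move=> [n [h h_inj]].
(* At [(true, true)] this repeats the value at [(true, false)]; injectivity is claimed on
   [frame_idx] only, and [e] takes the remainder there. *)
pose idx (i : I4) : 'I_n.+3 := inord (if i.1 then 0 else if i.2 then 1 else 2).
pose u i j := h (delta_mx (idx i) (idx j)).
pose e (i : I4) := if i \in frame_idx then u i i else 1 - \sum_(j <- frame_idx) u
  j j.
have idx_inj : {in frame_idx &, injective idx}.
  move=> i j; rewrite !inE => /or3P[]/eqP-> /or3P[]/eqP-> // /(congr1 val);
  by rewrite /= !inordK.
have uM i j k : u i j * u j k = u i k.
  by rewrite -rmorphM -[delta_mx _ _ * _]/(_ *m _) mul_delta_mx.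
have uM0 i j k l : j \in frame_idx -> k \in frame_idx -> j != k ->
  u i j * u k l = 0.
  move=> jI kI jk; rewrite -rmorphM -[delta_mx _ _ * _]/(_ *m _) mul_delta_mx_0
    ?rmorph0 //.
  by apply: contraNneq jk => /idx_inj->.
have eI i : i \in frame_idx -> e i = u i i by rewrite /e => ->.
have e0 i : i \notin frame_idx -> e i = 1 - \sum_(j <- frame_idx) u j j.
  by rewrite /e => /negPf->.
have sum_l i : i \in frame_idx -> (\sum_(j <- frame_idx) u j j) * u i i = u i i.
  move=> iI; rewrite big_distrl (bigD1_seq i) //= uM big1_seq ?addr0 // => j
    /andP[ji jI].
  by rewrite uM0.
have sum_r i : i \in frame_idx -> u i i * (\sum_(j <- frame_idx) u j j) = u i i.
  move=> iI; rewrite big_distrr (bigD1_seq i) //= uM big1_seq ?addr0 // => j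
    /andP[ji jI].
  by rewrite uM0 // eq_sym.
exists e, u; split.
- split=> [i j|].
    have [iI|iI] := boolP (i \in frame_idx);
      have [jI|jI] := boolP (j \in frame_idx).
    + rewrite !eI //; case: eqVneq => [->|ij]; [exact: uM | exact: uM0].
    + case: eqVneq => [ij|_]; first by rewrite -ij iI in jI.
      by rewrite (eI i) // (e0 j) // mulrBr mulr1 sum_r // subrr.
    + case: eqVneq => [ij|_]; first by rewrite ij jI in iI.
      by rewrite (eI j) // (e0 i) // mulrBl mul1r sum_l // subrr.
    + have ij : i = j by case: i j iI jI => [[] []] [[] []].
      rewrite ij eqxx e0 //; apply: idem_compl.
      rewrite {2 3}big_seq big_distrr; apply: eq_bigr => k kI; exact: sum_l.
  rewrite sum_I4 /= /e /= !big_cons big_nil addr0.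
  by non_commutative_ring.
- by move=> i j iI jI; rewrite /peirce !eI // !uM.
- by [].
- by move=> i iI; rewrite eI.
- rewrite eI //; apply: contraNneq (delta_mx_neq0 F (idx (false,
  false)) (idx (false, false))) => hk.
  by apply/eqP/h_inj; rewrite rmorph0; exact: hk.
Qed.

End LocallyMatrix.

(** * Elementary matrices and commutators of invertible matrices *)

Section Elementary.
Variable F : fieldType.

Inductive elementary n : 'M[F]_n -> Prop :=
| elementary1 : elementary 1%:M
| elementaryM x y : elementary x -> elementary y -> elementary (x *m y)
| elementaryT i j t : i != j -> elementary (1%:M + t *: delta_mx i j).

Lemma elementary_inv n (x : 'M[F]_n) : elementary x ->
  exists2 y, elementary y & x *m y = 1%:M /\ y *m x = 1%:M.
Proof.
elim=> [|{}x y _ [x' Ex' [xx' x'x]] _ [y' Ey' [yy' y'y]]|i j t ij].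
- by exists 1%:M; [exact: elementary1 | rewrite mulmx1].
- exists (y' *m x'); first exact: elementaryM.
  split; first by rewrite mulmxA -(mulmxA x) yy' mulmx1.
  by rewrite mulmxA -(mulmxA y') x'x mulmx1.
have tt (a b : F) : (1%:M + a *: delta_mx i j) *m (1%:M + b *: delta_mx i j) =
    1%:M + (a + b) *: delta_mx i j.
  rewrite mulmxDl mul1mx mulmxDr mulmx1 -scalemxAl -scalemxAr.
  by rewrite mul_delta_mx_0 1?eq_sym // !scaler0 addr0 scalerDl addrAC addrA.
exists (1%:M + (- t) *: delta_mx i j); first exact: elementaryT.
by rewrite !tt addrN addNr scale0r addr0.
Qed.

Lemma block_mx1M n (x y : 'M[F]_n) : block_mx 1%:M 0 0 (x *m y) =
  block_mx 1%:M 0 0 x *m block_mx 1%:M 0 0 y :> 'M_(1 + n).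
Proof. by rewrite mulmx_block !mulmx0 !mul0mx mulmx1 !addr0 add0r. Qed.

Lemma elementary_block n (x : 'M[F]_n) : elementary x ->
  elementary (block_mx 1%:M 0 0 x : 'M_(1 + n)).
Proof.
elim=> [|{}x y _ Ex _ Ey|i j t ij].
- by rewrite -scalar_mx_block; apply: elementary1.
- by rewrite block_mx1M; apply: elementaryM.
have -> : block_mx 1%:M 0 0 (1%:M + t *: delta_mx i j) =
    1%:M + t *: delta_mx (rshift 1 i) (rshift 1 j) :> 'M_(1 + n).
  rewrite -[RHS]submxK; congr block_mx; apply/matrixP => a b;
    by rewrite !mxE ?eq_shift ?ord1 ?andbF ?mulr0 ?addr0 ?add0r.
by apply: elementaryT; rewrite eq_rshift.
Qed.

Lemma elementary_col n (c : 'cV[F]_n) : elementary (block_mx 1%:M 0 c 1%:M :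
  'M_(1 + n)).
Proof.
pose P (c : 'cV[F]_n) := elementary (block_mx 1%:M 0 c 1%:M : 'M_(1 + n)).
rewrite -/(P c) [c]matrix_sum_delta; apply: (big_ind P).
- by rewrite /P -scalar_mx_block; apply: elementary1.
- move=> x y Px Py; have := elementaryM Px Py.
  by rewrite mulmx_block !mulmx0 !mul0mx !mulmx1 !mul1mx !addr0 add0r.
move=> i _; rewrite big_ord1 /P.
have -> : block_mx 1%:M 0 (c i 0 *: delta_mx i 0) 1%:M =
    1%:M + c i 0 *: delta_mx (rshift 1 i) (lshift n 0) :> 'M_(1 + n).
  rewrite -[RHS]submxK; congr block_mx; apply/matrixP => a b;
    by rewrite !mxE ?eq_shift ?ord1 ?andbF ?mulr0 ?addr0 ?add0r.
by apply: elementaryT; rewrite eq_rlshift.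
Qed.

Lemma elementary_row n (r : 'rV[F]_n) : elementary (block_mx 1%:M r 0 1%:M :
  'M_(1 + n)).
Proof.
pose P (r : 'rV[F]_n) := elementary (block_mx 1%:M r 0 1%:M : 'M_(1 + n)).
rewrite -/(P r) [r]matrix_sum_delta big_ord1; apply: (big_ind P).
- by rewrite /P -scalar_mx_block; apply: elementary1.
- move=> x y Px Py; have := elementaryM Py Px.
  by rewrite mulmx_block !mulmx0 !mul0mx !mulmx1 !mul1mx !addr0 add0r.
move=> i _; rewrite /P.
have -> : block_mx 1%:M (r 0 i *: delta_mx 0 i) 0 1%:M =
    1%:M + r 0 i *: delta_mx (lshift n 0) (rshift 1 i) :> 'M_(1 + n).
  rewrite -[RHS]submxK; congr block_mx; apply/matrixP => a b;
    by rewrite !mxE ?eq_shift ?ord1 ?andbF ?mulr0 ?addr0 ?add0r.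
by apply: elementaryT; rewrite eq_lrshift.
Qed.

(* Dilations commute with each other and normalize the elementary group, which
   therefore contains all commutators as soon as it generates GL_n with them:
   this spares the determinant. *)
Definition dilation n (t : F) : 'M[F]_n.+1 :=
  1%:M + (t - 1) *: delta_mx ord_max ord_max.

Lemma dilationM n t t' : dilation n t *m dilation n t' = dilation n (t * t').
Proof.
rewrite /dilation mulmxDl mul1mx mulmxDr mulmx1 -scalemxAl -scalemxAr mul_delta_mx.
rewrite scalerA -addrA -!scalerDl; congr (_ + _ *: _); ring.
Qed.

Lemma dilation1 n : dilation n 1 = 1%:M.
Proof. by rewrite /dilation subrr scale0r addr0. Qed.

Lemma dilation_conj n t (x : 'M[F]_n.+1) : t != 0 -> elementary x ->
  elementary (dilation n t *m x *m dilation n t^-1).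
Proof.
move=> t0; have tV : dilation n t *m dilation n t^-1 = 1%:M.
  by rewrite dilationM mulfV // dilation1.
have Vt : dilation n t^-1 *m dilation n t = 1%:M.
  by rewrite dilationM mulVf // dilation1.
elim=> [|{}x y _ Ex _ Ey|i j a ij].
- by rewrite mulmx1 tV; apply: elementary1.
- have -> : dilation n t *m (x *m y) *m dilation n t^-1 =
      (dilation n t *m x *m dilation n t^-1) *m (dilation n t *m y *m dilation n
        t^-1).
    by rewrite !mulmxA -(mulmxA _ _ (dilation n t)) Vt mulmx1.
  exact: elementaryM.
rewrite mulmxDr mulmxDl mulmx1 tV -scalemxAr -scalemxAl.
have -> : dilation n t *m delta_mx i j *m dilation n t^-1 =
    ((if i == ord_max then t else 1) * (if j == ord_max then t^-1 else 1)) *: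
      delta_mx i j.
  have -> : dilation n t *m delta_mx i j = (if i == ord_max then t else 1) *:
    delta_mx i j.
    rewrite mulmxDl mul1mx -scalemxAl mul_delta_mx_cond eq_sym.
    case: eqP => [->|_]; last by rewrite mulr0n scaler0 addr0 scale1r.
    by rewrite mulr1n -[X in X + _]scale1r -scalerDl addrC subrK.
  rewrite -scalemxAl; have -> : delta_mx i j *m dilation n t^-1 = (if j ==
    ord_max then t^-1 else 1) *: delta_mx i j.
    rewrite mulmxDr mulmx1 -scalemxAr mul_delta_mx_cond.
    case: eqP => [->|_]; last by rewrite mulr0n scaler0 addr0 scale1r.
    by rewrite mulr1n -[X in X + _]scale1r -scalerDl addrC subrK.
  by rewrite scalerA.
by rewrite scalerA; apply: elementaryT.
Qed.

Definition elementary_dilation n (x : 'M[F]_n.+1) :=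
  exists s t, [/\ elementary s, t != 0 & x = s *m dilation n t].

Lemma elementary_dilation_l n (s x : 'M[F]_n.+1) :
  elementary s -> elementary_dilation (s *m x) -> elementary_dilation x.
Proof.
move=> /elementary_inv[s' Es' [_ s's]] [y [t [Ey t0 sx]]].
exists (s' *m y), t; split=> //; first exact: elementaryM.
by rewrite -mulmxA -sx mulmxA s's mul1mx.
Qed.

Lemma elementary_dilation_r n (s x : 'M[F]_n.+1) :
  elementary s -> elementary_dilation (x *m s) -> elementary_dilation x.
Proof.
move=> /elementary_inv[s' Es' [ss' _]] [y [t [Ey t0 xs]]].
exists (y *m (dilation n t *m s' *m dilation n t^-1)), t; split=> //.
  exact/elementaryM/dilation_conj.
rewrite -!mulmxA dilationM mulVf // dilation1 mulmx1 mulmxA -xs.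
by rewrite -mulmxA ss' mulmx1.
Qed.

(** Gaussian elimination: bring the top left entry to 1, clear its row and column, and recurse on
    the lower block. The dilation sits at the last index, so it survives the block embedding. *)
Lemma unitmx_elementary_dilation n (x : 'M[F]_n.+1) :
  x \in unitmx -> elementary_dilation x.
Proof.
elim: n x => [|n IHn] x xU.
  exists 1%:M, (x 0 0); split; first exact: elementary1.
    by move: xU; rewrite unitmxE det_mx11 unitfE.
  rewrite mul1mx /dilation; apply/matrixP => i j; rewrite !ord1 !mxE eqxx /=.
  by rewrite mulr1n mulr1 addrC subrK.
have main (y : 'M[F]_(1 + n.+1)) : y \in unitmx -> y 0 0 = 1 ->
    @elementary_dilation n.+1 y.
  move=> yU y00; pose c := dlsubmx y; pose r := ursubmx y; pose N := drsubmx y.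
  have yE : y = block_mx 1%:M r c N.
    rewrite -[LHS]submxK; congr block_mx; apply/matrixP => a b.
    have l0 : lshift n.+1 (0 : 'I_1) = (0 : 'I_n.+2) by apply: val_inj.
    by rewrite !ord1 !mxE eqxx l0 y00.
  have prodE : block_mx 1%:M 0 (- c) 1%:M *m y *m block_mx 1%:M (- r) 0 1%:M =
      block_mx 1%:M 0 0 (N - c *m r).
    rewrite yE !mulmx_block !mulmx0 !mul0mx !mulmx1 !mul1mx !addr0 ?add0r.
    by rewrite mulNmx mul1mx ?addNr ?mul0mx ?add0r addrC.
  have NU : N - c *m r \in unitmx.
    have := congr1 determinant prodE.
    rewrite !det_mulmx det_lblock !det_ublock !det1 !mul1r mulr1 => detN.
    by rewrite unitmxE -detN -unitmxE.
  have [s [t [Es t0 NE]]] := IHn _ NU.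
  apply: (elementary_dilation_l (elementary_col (- c))).
  apply: (elementary_dilation_r (elementary_row (- r))).
  rewrite prodE NE; exists (block_mx 1%:M 0 0 s : 'M_(1 + n.+1)), t; split=> //.
    exact: elementary_block.
  have -> : dilation n.+1 t = block_mx 1%:M 0 0 (dilation n t) :> 'M_(1 + n.+1).
    rewrite /dilation (_ : ord_max = rshift 1 ord_max :> 'I_(1 + n.+1));
      last exact: val_inj.
    rewrite -[LHS](@submxK F 1 n.+1 1 n.+1); congr block_mx; apply/matrixP => a b;
      by rewrite !mxE ?eq_shift ?ord1 ?andbF ?mulr0 ?addr0 ?add0r.
  exact: block_mx1M.
have pivot (y : 'M[F]_n.+2) i : y \in unitmx -> i != 0 -> y i 0 != 0 ->
  elementary_dilation y.
  move=> yU i0 yi0; have i0' : 0 != i by rewrite eq_sym.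
  (* Adding this multiple of row [i] to row 0 makes the corner entry 1. *)
  have Es := elementaryT ((1 - y 0 0) / y i 0) i0'.
  have [s' _ [/mulmx1_unit[sU _] _]] := elementary_inv Es.
  apply: (elementary_dilation_l Es); apply: main; first by rewrite unitmx_mul sU.
  rewrite mulmxDl mul1mx -scalemxAl !mxE (bigD1 i) //= big1 => [|k ki]; last first.
    by rewrite mxE (negPf ki) andbF mul0r.
  by rewrite mxE !eqxx mul1r addr0 mulfVK // addrC subrK.
have [/existsP[i /andP[i0 xi0]]|/existsPn x0] := boolP [exists i,
  (i != 0) && (x i 0 != 0)].
  exact: pivot xU i0 xi0.
have xi0 i : i != 0 -> x i 0 = 0.
  by move=> i0; have := x0 i; rewrite i0 negbK => /eqP.
have x00 : x 0 0 != 0.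
  apply: contraNneq (@delta_mx_neq0 F n.+2 1 0 0) => x00.
  rewrite -[delta_mx 0 0](mulKmx xU) -colE (_ : col 0 x = 0) ?mulmx0 //.
  by apply/matrixP => i j; rewrite !mxE; have [->|/xi0] := eqVneq i 0.
(* The first column is now supported at the corner; adding row 0 to row 1 creates the nonzero entry
   that [pivot] needs. *)
have i10 : (1 : 'I_n.+2) != 0 by [].
have Es := elementaryT 1 i10.
have [s' _ [/mulmx1_unit[sU _] _]] := elementary_inv Es.
apply: (elementary_dilation_l Es); apply: (pivot _ 1) => //.
  by rewrite unitmx_mul sU.
rewrite mulmxDl mul1mx scale1r !mxE (bigD1 0) //= big1 => [|k k0]; last first.
  by rewrite mxE (negPf k0) andbF mul0r.
by rewrite mxE !eqxx mul1r addr0 xi0 // add0r.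
Qed.

Lemma elementary_commutator n (y z : 'M[F]_n.+1) :
  y \in unitmx -> z \in unitmx -> elementary (y *m z *m invmx y *m invmx z).
Proof.
move=> yU zU; have [s [t [Es t0 yE]]] := unitmx_elementary_dilation yU.
have [r [a [Er a0 zE]]] := unitmx_elementary_dilation zU.
have [s' Es' [ss' s's]] := elementary_inv Es.
have [r' Er' [rr' r'r]] := elementary_inv Er.
have yV : invmx y = dilation n t^-1 *m s'.
  apply: (can_inj (mulKmx yU)); rewrite mulmxV // yE.
  by rewrite mulmxA -(mulmxA s) dilationM mulfV // dilation1 mulmx1 ss'.
have zV : invmx z = dilation n a^-1 *m r'.
  apply: (can_inj (mulKmx zU)); rewrite mulmxV // zE.
  by rewrite mulmxA -(mulmxA r) dilationM mulfV // dilation1 mulmx1 rr'.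
have -> : y *m z *m invmx y *m invmx z =
  s *m (dilation n t *m r *m dilation n t^-1) *m
  (dilation n a *m s' *m dilation n a^-1) *m r'.
  rewrite yV zV yE zE !mulmxA; congr (_ *m _ *m _ *m _).
  by rewrite -!(mulmxA _ (dilation n _) (dilation n _)) !dilationM mulrC.
do 2?[apply: elementaryM => //]; last exact: dilation_conj.
exact/elementaryM/dilation_conj.
Qed.

End Elementary.

(** * Generation of the commutator subgroup by off-diagonal root subgroups *)

Inductive off_diagonal_product (R : pzRingType) (e : I4 -> R) : R -> Prop :=
| off_diagonal_product1 : off_diagonal_product e 1
| off_diagonal_productM x y : off_diagonal_product e x ->
    off_diagonal_product e y -> off_diagonal_product e (x * y)
| off_diagonal_productD i j x : i != j -> peirce e i j x ->
    off_diagonal_product e (1 + x).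

Lemma off_diagonal_product_inv (R : pzRingType) (e : I4 -> R) x :
    orthogonal_idempotents e -> off_diagonal_product e x ->
  exists2 y, off_diagonal_product e y & x * y = 1 /\ y * x = 1.
Proof.
move=> orthe; elim=> [|{}x y _ [x' Ex' [xx' x'x]] _ [y' Ey' [yy' y'y]]|i j {}x ij
  hx].
- by exists 1; [exact: off_diagonal_product1 | rewrite mulr1].
- exists (y' * x'); first exact: off_diagonal_productM.
  split; first by rewrite mulrA -(mulrA x) yy' mulr1.
  by rewrite mulrA -(mulrA y') x'x mulr1.
have xx : x * x = 0 by apply: (peirce_mul0 orthe hx hx); rewrite eq_sym.
exists (1 - x).
  apply: (off_diagonal_productD ij); case: hx => ix xj.
  by split; rewrite ?mulrN ?mulNr ?ix ?xj.
have -> : (1 + x) * (1 - x) = 1 - x * x by non_commutative_ring.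
have -> : (1 - x) * (1 + x) = 1 - x * x by non_commutative_ring.
by rewrite xx subr0.
Qed.

Section Generation.
Variables (F : fieldType) (A : unitAlgType F).
Hypothesis locmxA : unital_locally_matrix A.
Variables (e : I4 -> A) (u : I4 -> I4 -> A).
Hypothesis frameA : framed e u.

(** With the frame diagonal, each matrix index is labelled by a frame idempotent whose entry there
    is 1. A transvection between different labels is already off-diagonal; one inside a label is a
    commutator through an index with another label. *)
Lemma elementary_off_diagonal n (h : {lrmorphism 'M[F]_n.+1 -> A}) x :
    injective h -> (forall i, exists d, e i = h (diag_mx d)) ->
  elementary x -> off_diagonal_product e (h x).
Proof.
move=> h_inj diag; have [orthe _ _ _ _] := frameA; have [d dE] := choice diag.
have d01 i : forall k, d i 0 k = 0 \/ d i 0 k = 1.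
  by apply: (diag_idem_bool h_inj); rewrite -dE idem_orth.
have label k : exists i, d i 0 k = 1.
  have [|/forallNP nd] := pselect (exists i, d i 0 k = 1); first by [].
  have d0 i : d i 0 k = 0 by case: (d01 i k) => // /nd.
  have : h 1 = h (\sum_i diag_mx (d i)).
    by rewrite rmorph1 -orthe.2 linear_sum; apply: eq_bigr => i _; apply: dE.
  move/h_inj/matrixP/(_ k k); rewrite summxE big1 => [|i _].
    by rewrite mxE eqxx => /eqP; rewrite oner_eq0.
  by rewrite mxE d0 mul0rn.
have [lab labP] := choice label.
have off a b t : lab a != lab b ->
  off_diagonal_product e (h (1%:M + t *: delta_mx a b)).
  move=> ab; rewrite rmorphD rmorph1; apply: (off_diagonal_productD ab).
  split; rewrite dE -rmorphM; congr (h _).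
    rewrite -[LHS]/(_ *m _) -scalemxAr -(mul_delta_mx a a b) mulmxA diag_delta_mx.
    by rewrite labP scale1r.
  rewrite -[LHS]/(_ *m _) -scalemxAl -(mul_delta_mx b a b) -mulmxA delta_diag_mx.
  by rewrite labP scale1r.
elim=> [|{}x y _ Ex _ Ey|a b t ab].
- rewrite rmorph1; exact: off_diagonal_product1.
- rewrite -[x *m y]/(x * y) rmorphM; exact: off_diagonal_productM.
have [lab_ab|] := eqVneq (lab a) (lab b); last exact: off.
(* The label is taken in [frame_idx], where [e i] is nonzero, so that some matrix index [c] carries
   it. *)
have [i iI il] : exists2 i, i \in frame_idx & i != lab a.
  have [->|] := eqVneq (lab a) (true, false); first by exists (false, true).
  by rewrite eq_sym; exists (true, false).
have [c dc] : exists c, d i 0 c = 1.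
  have := frame_idem_neq0 frameA iI; rewrite dE => hd.
  have [//|/forallNP nd] := pselect (exists c, d i 0 c = 1).
  case/eqP: hd; rewrite (_ : d i = 0) ?linear0 ?rmorph0 //.
  by apply/rowP => c; rewrite mxE; case: (d01 i c) => // /nd.
have labc : lab c = i.
  apply: contraTeq (oner_neq0 F) => lci; rewrite negbK; apply/eqP.
  have : h (diag_mx (d (lab c)) *m diag_mx (d i)) = 0.
    by rewrite -[_ *m _]/(_ * _) rmorphM /= -!dE mul_orth.
  rewrite -(rmorph0 h) => /h_inj/matrixP/(_ c c).
  by rewrite mul_diag_mx !mxE eqxx mulr1n labP dc mulr1.
have ac : lab a != lab c by rewrite labc eq_sym.
have cb : lab c != lab b by rewrite labc -lab_ab.
have neq (k l : 'I_n.+1) : lab k != lab l -> k != l by apply: contra_neq => ->.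
have [ca [cb' ba]] : c != a /\ b != c /\ b != a.
  by rewrite !(eq_sym _ a) ab (neq a c) // eq_sym (neq c b).
have -> : 1%:M + t *: delta_mx a b =
    (1%:M + t *: delta_mx a c) * (1%:M + 1 *: delta_mx c b) *
    (1%:M + (- t) *: delta_mx a c) * (1%:M + (- 1) *: delta_mx c b).
  rewrite !scale1r scaleN1r scaleNr.
  set X := t *: delta_mx a c; set Y := delta_mx c b.
  have XY : X * Y = t *: delta_mx a b.
    by rewrite -[LHS]/(_ *m _) -scalemxAl mul_delta_mx.
  have XX : X * X = 0.
    by rewrite -[LHS]/(_ *m _) -scalemxAl -scalemxAr mul_delta_mx_0 // !scaler0.
  have YY : Y * Y = 0 by rewrite -[LHS]/(_ *m _) mul_delta_mx_0.
  have YX : Y * X = 0 by rewrite -[LHS]/(_ *m _) -scalemxAr mul_delta_mx_0 ?scaler0.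
  by rewrite -XY; apply: elementary_commutatorE.
rewrite !rmorphM.
by apply: off_diagonal_productM (off _ _ _ cb);
  apply: off_diagonal_productM (off _ _ _ ac);
  apply: off_diagonal_productM; apply: off.
Qed.

(** A single commutator is computed in one matrix algebra containing [y], [z] and the frame. The
    inverses are included as well, so that they become matrix inverses and [elementary_commutator]
    applies. *)
Lemma comm_units_off_diagonal x : comm_units x -> off_diagonal_product e x.
Proof.
have [orthe _ _ _ _] := frameA.
move: x; apply: comm_units_ind => [|x y|x xU Ex|y z yU zU].
- exact: off_diagonal_product1.
- exact: off_diagonal_productM.
- have [x' Ex' [xx' _]] := off_diagonal_product_inv orthe Ex.
  by rewrite -[x^-1]mulr1 -xx' mulKr.
pose es := [seq e i | i : I4].
have [n [h [h_inj hs]]] := locmx_embed locmxA ([:: y; y^-1; z; z^-1] ++ es).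
have [|||h' [h'_inj h'P diag]] := embed_diag h_inj (es := es).
- by move=> f fes; apply: hs; rewrite mem_cat fes orbT.
- by move=> _ /mapP[i _ ->]; apply: idem_orth.
- move=> _ _ /mapP[i _ ->] /mapP[j _ ->]; rewrite !(orthe.1) eq_sym.
  by case: eqVneq => // ->.
have in_h' t : t \in [:: y; y^-1; z; z^-1] -> exists m, t = h' m.
  by move=> ts; apply/h'P/hs; rewrite mem_cat ts.
have unit_h' t : t \in [:: y; z] -> t \is a GRing.unit ->
    exists2 m, m \in unitmx & t = h' m /\ t^-1 = h' (invmx m).
  move=> tyz tU; have [m tm] : exists m, t = h' m.
    by apply: in_h'; move: tyz; rewrite !inE => /orP[]->; rewrite ?orbT.
  have [m' tm'] : exists m, t^-1 = h' m.
    by apply: in_h'; move: tyz; rewrite !inE => /orP[]/eqP->; rewrite eqxx ?orbT.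
  have mm' : m *m m' = 1%:M.
    by apply: h'_inj; rewrite -[_ *m _]/(_ * _) rmorphM /= -tm -tm' rmorph1 mulrV.
  have [mU _] := mulmx1_unit mm'; exists m => //; split=> //; rewrite tm';
    congr (h' _).
  by apply: (can_inj (mulKmx mU)); rewrite mm' mulmxV.
have [Y YU [yE yVE]] : exists2 m, m \in unitmx & y = h' m /\ y^-1 = h' (invmx m).
  by apply: unit_h' => //; rewrite inE eqxx.
have [Z ZU [zE zVE]] : exists2 m, m \in unitmx & z = h' m /\ z^-1 = h' (invmx m).
  by apply: unit_h' => //; rewrite !inE eqxx orbT.
have -> : y * z * y^-1 * z^-1 = h' (Y *m Z *m invmx Y *m invmx Z).
  by rewrite yVE zVE [in LHS]yE [in LHS]zE -!rmorphM.
apply: elementary_off_diagonal h'_inj _ _; last exact: elementary_commutator.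
by move=> i; apply: diag; apply: map_f; rewrite mem_enum.
Qed.

End Generation.

(** * Algebras containing at least three by three matrices *)

Section ThreeByThree.
Variables (F : fieldType) (A B : unitAlgType F).
Hypotheses (F2 : 2%N \notin [pchar F]).
Hypotheses (locmxA : unital_locally_matrix A) (locmxB : unital_locally_matrix B).
Variables (phi : A -> B) (psi : B -> A).
Hypothesis phipsi : comm_units_iso phi psi.

Definition standard_iso (R S : unitRingType) (f : R -> S) :=
  (exists theta : R -> S, ring_isomorphism theta /\
     forall g, comm_units g -> f g = theta g) \/
  (exists theta : R -> S, ring_antiisomorphism theta /\
     forall g, comm_units g -> f g = theta g^-1).

Lemma mx3_standard : has_mx3 A -> has_mx3 B -> standard_iso phi.
Proof.
move=> A3 B3; have [e [u frameA]] := locmx_framed A3.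
have goodA := locmx_good locmxA F2 A3; have goodB := locmx_good locmxB F2 B3.
have [A2 _ _] := goodA; have [hphi _ _ _] := phipsi; have [phiK phiM] := hphi.
have phi1 := comm_units_hom1 hphi; have [orthe _ _ _ _] := frameA.
have offK x : off_diagonal_product e x -> comm_units x.
  elim=> [|{}x y _ Kx _ Ky|i j {}x ij hx]; first exact: comm_units1.
    exact: comm_unitsM.
  exact: comm_units_peirce frameA _ _ _ ij hx.
have [[theta thetaI thetaP]|[theta thetaI thetaP]] :=
    framed_comm_units_iso goodA goodB frameA phipsi; [left|right].
  exists theta; split=> // g /(comm_units_off_diagonal locmxA frameA).
  have [_ thetaD theta1 thetaM] := thetaI.
  elim=> [|x y Ex IHx Ey IHy|i j x ij hx]; first by rewrite phi1 theta1.
    by rewrite phiM ?thetaM ?IHx ?IHy //; apply: offK.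
  by rewrite thetaD theta1 (thetaP i j) // [RHS]addrC subrK.
have [thetaB thetaD theta1 thetaM] := thetaI.
exists (theta : A -> B); split; first by split=> // x y; apply: thetaM.
have thetaV g : off_diagonal_product e g -> (phi g)^-1 = theta g.
  elim=> [|x y Ex IHx Ey IHy|i j x ij hx]; first by rewrite phi1 invr1 theta1.
    have [Kx Ky] := (offK _ Ex, offK _ Ey).
    rewrite phiM // invrM ?IHx ?IHy ?thetaM //; apply: comm_units_unit; exact: phiK.
  by rewrite thetaD theta1 (thetaP i j) // [RHS]addrC subrK.
move=> g Kg; rewrite -thetaV; last first.
  exact/(comm_units_off_diagonal locmxA frameA)/comm_unitsV.
by rewrite comm_units_homV // invrK.
Qed.

End ThreeByThree.

(** * Explicit computations with two by two matrices *)

Lemma ord2_cases (i : 'I_2) : i = 0 \/ i = 1.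
Proof. by case: i => [[|[|//]] ?]; [left|right]; apply: val_inj. Qed.

Section TwoByTwo.
Variable F : fieldType.

Definition mx2 (a b c d : F) : 'M[F]_2 :=
  \matrix_(i, j) if i == 0 then if j == 0 then a else b
                 else if j == 0 then c else d.

Lemma mx2_eta (m : 'M[F]_2) : m = mx2 (m 0 0) (m 0 1) (m 1 0) (m 1 1).
Proof.
by apply/matrixP => i j; rewrite mxE; case: (ord2_cases i) => ->;
  case: (ord2_cases j) => ->.
Qed.

Lemma mx2_inj a b c d a' b' c' d' :
  mx2 a b c d = mx2 a' b' c' d' -> [/\ a = a', b = b', c = c' & d = d'].
Proof.
by move/matrixP => H; have := (H 0 0, H 0 1, H 1 0, H 1 1);
  rewrite !mxE /= => -[[[-> ->] ->] ->].
Qed.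

Lemma mx2M a b c d a' b' c' d' : mx2 a b c d * mx2 a' b' c' d' =
  mx2 (a * a' + b * c') (a * b' + b * d') (c * a' + d * c') (c * b' + d * d').
Proof.
apply/matrixP => i j; rewrite !mxE !big_ord_recl big_ord0 !mxE /= addr0.
by case: eqP; case: eqP.
Qed.

Lemma mx2D a b c d a' b' c' d' :
  mx2 a b c d + mx2 a' b' c' d' = mx2 (a + a') (b + b') (c + c') (d + d').
Proof. by apply/matrixP => i j; rewrite !mxE; case: eqP; case: eqP. Qed.

Lemma mx2Z k a b c d : k *: mx2 a b c d = mx2 (k * a) (k * b) (k * c) (k * d).
Proof. by apply/matrixP => i j; rewrite !mxE; case: eqP; case: eqP. Qed.

Lemma mx2N a b c d : - mx2 a b c d = mx2 (- a) (- b) (- c) (- d).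
Proof. by apply/matrixP => i j; rewrite !mxE; case: eqP; case: eqP. Qed.

Lemma mx2_1 : 1 = mx2 1 0 0 1.
Proof. by rewrite [LHS]mx2_eta !mxE. Qed.

Lemma mx2_0 : 0 = mx2 0 0 0 0.
Proof. by rewrite [LHS]mx2_eta !mxE. Qed.

Lemma det_mx2 a b c d : \det (mx2 a b c d) = a * d - b * c.
Proof.
rewrite (expand_det_row _ 0) !big_ord_recl big_ord0 /cofactor !det_mx11 !mxE /=.
by rewrite expr0 expr1; ring.
Qed.

Lemma trace_mx2 a b c d : \tr (mx2 a b c d) = a + d.
Proof. by rewrite /mxtrace !big_ord_recl big_ord0 !mxE addr0. Qed.

Lemma cayley_mx2 (m : 'M[F]_2) : \det m = 1 -> m * m = \tr m *: m - 1.
Proof.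
rewrite [m]mx2_eta; move: (m 0 0) (m 0 1) (m 1 0) (m 1 1) => a b c d.
rewrite det_mx2 trace_mx2 mx2M mx2_1 mx2Z mx2N mx2D => D; congr mx2; try ring.
- by rewrite -D; ring.
- by rewrite -D; ring.
Qed.

Lemma square_zero_mx2 (m : 'M[F]_2) : m * m = 0 ->
  exists a b c, m = mx2 a b c (- a) /\ a * a + b * c = 0.
Proof.
rewrite [m]mx2_eta; move: (m 0 0) (m 0 1) (m 1 0) (m 1 1) => a b c d.
rewrite mx2M mx2_0 => /mx2_inj[aa ab ca dd]; exists a, b, c; split=> //.
suff -> : d = - a by [].
apply/eqP; rewrite -addr_eq0; apply/eqP.
have [//|ad] := eqVneq (d + a) 0.
have b0 : b = 0.
  by apply: (mulfI ad); rewrite mulr0 -ab; ring.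
have a0 : a = 0.
  by move: aa; rewrite b0 mul0r addr0 => /eqP; rewrite mulf_eq0 orbb => /eqP.
have d0 : d = 0.
  by move: dd; rewrite b0 mulr0 add0r => /eqP; rewrite mulf_eq0 orbb => /eqP.
by rewrite a0 d0 addr0.
Qed.

(* Two square-zero elements generate matrix units as soon as they do not
   commute. *)
Lemma square_zero_anticommutator (y z : 'M[F]_2) : y * y = 0 -> z * z = 0 ->
    y * z != z * y ->
  exists2 c, c != 0 & y * z + z * y = c%:A.
Proof.
move=> /square_zero_mx2[a [b [c [-> E]]]] /square_zero_mx2[a' [b' [c' [-> E']]]].
move=> nc; exists (a * a' + a * a' + b * c' + b' * c); last first.
  by rewrite !mx2M mx2_1 mx2Z mx2D; congr mx2; ring.
(* On trace-zero matrices the anticommutator is the polar form of the quadratic form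
   [a * a + b * c], and orthogonal isotropic vectors are proportional. Concretely [H1], [H2], [H3]
   say that the minors of [(a, b, c)] and [(a', b', c')] square to 0. *)
apply: contraNneq nc => s0; rewrite !mx2M.
have sq0 (x : F) : x * x = 0 -> x = 0.
  by move/eqP; rewrite mulf_eq0 orbb => /eqP.
have bc : b * c = - (a * a) by apply/eqP; rewrite -addr_eq0 addrC E.
have bc' : b' * c' = - (a' * a') by apply/eqP; rewrite -addr_eq0 addrC E'.
have sE : b * c' + b' * c = - (a * a' + a * a').
  by apply/eqP; rewrite -addr_eq0 addrC addrA s0.
have H1 : b * c' = b' * c.
  apply/eqP; rewrite -subr_eq0; apply/eqP/sq0.
  have -> : (b * c' - b' * c) * (b * c' - b' * c) =
    (b * c' + b' * c) * (b * c' + b' * c) - 4%:R * (b * c) * (b' * c') by ring.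
  by rewrite sE bc bc'; ring.
have H2 : a * b' = a' * b.
  apply/eqP; rewrite -subr_eq0; apply/eqP/sq0.
  have -> : (a * b' - a' * b) * (a * b' - a' * b) =
    a * a * b' * b' + a' * a' * b * b - (a * a' + a * a') * (b * b') by ring.
  have -> : a * a = - (b * c) by rewrite bc opprK.
  have -> : a' * a' = - (b' * c') by rewrite bc' opprK.
  have -> : a * a' + a * a' = - (b * c' + b' * c) by rewrite sE opprK.
  by ring.
have H3 : a * c' = a' * c.
  apply/eqP; rewrite -subr_eq0; apply/eqP/sq0.
  have -> : (a * c' - a' * c) * (a * c' - a' * c) =
    a * a * c' * c' + a' * a' * c * c - (a * a' + a * a') * (c * c') by ring.
  have -> : a * a = - (b * c) by rewrite bc opprK.
  have -> : a' * a' = - (b' * c') by rewrite bc' opprK.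
  have -> : a * a' + a * a' = - (b * c' + b' * c) by rewrite sE opprK.
  by ring.
have sub0 (x x' : F) : x = x' -> x - x' = 0 by move=> ->; rewrite subrr.
apply/eqP; congr mx2.
- have -> : a * a' + b * c' = a' * a + b' * c + (b * c' - b' * c) by ring.
  by rewrite (sub0 _ _ H1) addr0.
- have -> : a * b' + b * - a' = a' * b + b' * - a + 2%:R * (a * b' - a' * b) by
  ring.
  by rewrite (sub0 _ _ H2) mulr0 addr0.
- have -> : c * a' + - a * c' = c' * a + - a' * c - 2%:R * (a * c' - a' * c) by
  ring.
  by rewrite (sub0 _ _ H3) mulr0 subr0.
- have -> : c * b' + - a * - a' = c' * b + - a' * - a - (b * c' - b' * c) by ring.
  by rewrite (sub0 _ _ H1) subr0.
Qed.

Lemma commute_upper_mx2 (w : 'M[F]_2) (c : F) : (2%:R : F) != 0 -> c != 0 ->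
    w * w = 0 -> w * mx2 0 c 0 0 = mx2 0 c 0 0 * w ->
  w = mx2 0 (w 0 1) 0 0.
Proof.
move=> F2 c0 /square_zero_mx2[a [b [d [-> _]]]];
  rewrite !mx2M => /mx2_inj[H1 H2 _ _].
rewrite !mxE /=; have d0 : d = 0.
  by apply: (mulfI c0); rewrite mulr0; move: H1; rewrite !mul0r !mulr0 !add0r => <-.
have a0 : a = 0.
  apply: (mulfI F2); apply: (mulfI c0); rewrite !mulr0.
  have -> : c * (2%:R * a) = a * c + b * 0 - (0 * b + c * - a) by ring.
  by rewrite H2 subrr.
by rewrite d0 a0 oppr0.
Qed.

Lemma commute_lower_mx2 (w : 'M[F]_2) (c : F) : (2%:R : F) != 0 -> c != 0 ->
    w * w = 0 -> w * mx2 0 0 c 0 = mx2 0 0 c 0 * w ->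
  w = mx2 0 0 (w 1 0) 0.
Proof.
move=> F2 c0 /square_zero_mx2[a [b [d [-> _]]]];
  rewrite !mx2M => /mx2_inj[H1 _ H2 _].
rewrite !mxE /=; have b0 : b = 0.
  by apply: (mulfI c0); rewrite mulr0 mulrC; move: H1;
    rewrite !mul0r !mulr0 !add0r => ->.
have a0 : a = 0.
  apply: (mulfI F2); apply: (mulfI c0); rewrite !mulr0.
  have -> : c * (2%:R * a) = (c * a + 0 * d) - (d * 0 + - a * c) by ring.
  by rewrite H2 subrr.
by rewrite b0 a0 oppr0.
Qed.

End TwoByTwo.

Definition upper (F : fieldType) (t : F) := mx2 1 t 0 1.
Definition lower (F : fieldType) (t : F) := mx2 1 0 t 1.

Lemma matrix_units_morph (F : fieldType) n (A : algType F) (E : 'I_n -> 'I_n -> A) :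
    (forall i j k l, E i j * E k l = if j == k then E i l else 0) ->
    \sum_i E i i = 1 ->
  exists f : 'M[F]_n -> A, [/\ {morph f : x y / x + y}, f 1%:M = 1,
    {morph f : x y / x *m y >-> x * y}, forall a, {morph f : x / a *: x}
    & forall i j, f (delta_mx i j) = E i j].
Proof.
move=> EM E1; pose f (m : 'M[F]_n) := \sum_i \sum_j m i j *: E i j.
have fE i j : f (delta_mx i j) = E i j.
  rewrite /f (bigD1 i) //= (bigD1 j) //= mxE !eqxx scale1r !big1 ?addr0 //.
    by move=> k ki; rewrite big1 // => l _; rewrite mxE (negPf ki) scale0r.
  by move=> l lj; rewrite mxE (negPf lj) andbF scale0r.
exists f; split=> //.
- move=> x y; rewrite /f -big_split; apply: eq_bigr => i _ /=.
  by rewrite -big_split; apply: eq_bigr => j _; rewrite mxE scalerDl.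
- rewrite /f -E1; apply: eq_bigr => i _; rewrite (bigD1 i) //= mxE eqxx scale1r.
  by rewrite big1 ?addr0 // => j ji; rewrite mxE eq_sym (negPf ji) scale0r.
- move=> x y; have Ef i j : E i j * f y = \sum_k y j k *: E i k.
    rewrite /f big_distrr (bigD1 j) //= [X in _ + X]big1 ?addr0 => [|l lj].
      by rewrite big_distrr; apply: eq_bigr => k _; rewrite /= -scalerAr EM eqxx.
    rewrite big_distrr big1 // => k _.
    by rewrite /= -scalerAr EM eq_sym (negPf lj) scaler0.
  rewrite {2}/f big_distrl; apply: eq_bigr => i _ /=; rewrite big_distrl /=.
  under [RHS]eq_bigr => j _ do rewrite -scalerAl Ef scaler_sumr.
  rewrite exchange_big; apply: eq_bigr => k _ /=.
  by rewrite mxE scaler_suml; apply: eq_bigr => j _; rewrite scalerA.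
- move=> a x; rewrite /f scaler_sumr; apply: eq_bigr => i _.
  by rewrite scaler_sumr; apply: eq_bigr => j _; rewrite mxE scalerA.
Qed.

(** * Transport of the conclusion along ring isomorphisms *)

Section Transport.
Variables (R R' S S' : unitRingType).
Variables (f : {rmorphism R' -> R}) (f' : {rmorphism R -> R'}).
Variables (g : {rmorphism S' -> S}) (g' : {rmorphism S -> S'}).
Hypotheses (fK : cancel f f') (f'K : cancel f' f).
Hypotheses (gK : cancel g g') (g'K : cancel g' g).
Variables (phi : R -> S) (psi : S -> R).
Hypothesis phipsi : comm_units_iso phi psi.

Lemma comm_units_iso_transport :
  comm_units_iso (g' \o phi \o f) (f' \o psi \o g).
Proof.
have [[phiK phiM] [psiK psiM] phiK' psiK'] := phipsi.
have kf x : comm_units x -> comm_units (f x) by apply: comm_units_morph.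
have kg x : comm_units x -> comm_units (g x) by apply: comm_units_morph.
split; [split|split| |] => /=.
- by move=> x Kx; apply/comm_units_morph/phiK/kf.
- by move=> x y Kx Ky; rewrite rmorphM phiM ?rmorphM //; apply: kf.
- by move=> x Kx; apply/comm_units_morph/psiK/kg.
- by move=> x y Kx Ky; rewrite rmorphM psiM ?rmorphM //; apply: kg.
- by move=> x Kx; rewrite g'K phiK' //; apply: kf.
- by move=> x Kx; rewrite f'K psiK' //; apply: kg.
Qed.

Lemma standard_iso_transport : standard_iso (g' \o phi \o f) -> standard_iso phi.
Proof.
have comp_bij (th : R' -> S') : bijective th -> bijective (g \o th \o f').
  move=> thB; apply: bij_comp; last by exists f.
  by apply: bij_comp => //; exists g'.
have kf' x : comm_units x -> comm_units (f' x) by apply: comm_units_morph.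
case=> -[theta [thetaI thetaP]]; [left|right]; exists (g \o theta \o f').
  have [thB thD th1 thM] := thetaI; split.
    split; [exact: comp_bij| | |] => [x y||x y] /=.
    - by rewrite rmorphD thD rmorphD.
    - by rewrite rmorph1 th1 rmorph1.
    - by rewrite rmorphM thM rmorphM.
  by move=> x Kx /=; rewrite -(thetaP _ (kf' x Kx)) /= f'K g'K.
have [thB thD thM] := thetaI; split.
  split; [exact: comp_bij| |] => [x y|x y] /=.
  - by rewrite rmorphD thD rmorphD.
  - by rewrite rmorphM thM rmorphM.
move=> x Kx /=; rewrite rmorphV ?comm_units_unit //.
by rewrite -(thetaP _ (kf' x Kx)) /= f'K g'K.
Qed.

End Transport.

(** * Isomorphisms of [SL_2(F)] *)

Section SL2.
Variable F : fieldType.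
Hypothesis F2 : (2%:R : F) != 0.
Implicit Types x g v w : 'M[F]_2.

Lemma comm_units_elementary_mx n (x : 'M[F]_n.+1) : comm_units x -> elementary x.
Proof.
move: x; apply: comm_units_ind => [|x y|x xU|y z yU zU].
- exact: elementary1.
- exact: elementaryM.
- move=> /elementary_inv[x' Ex' [xx' _]].
  suff -> : x^-1 = x' by [].
  by rewrite -[x^-1]mulr1 -[1]xx' [x *m x']/(x * x') mulKr.
- exact: elementary_commutator yU zU.
Qed.

Lemma comm_units_det n (x : 'M[F]_n.+1) : comm_units x -> \det x = 1.
Proof.
have detM (y z : 'M[F]_n.+1) : \det (y * z) = \det y * \det z by apply: det_mulmx.
have detV (y : 'M[F]_n.+1) : y \is a GRing.unit -> \det y * \det y^-1 = 1.
  by move=> yU; rewrite -detM mulrV //; apply: det1.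
move: x; apply: comm_units_ind => [|x y Dx Dy|x xU Dx|y z yU zU].
- exact: det1.
- by rewrite detM Dx Dy mulr1.
- by rewrite -(detV x xU) Dx mul1r.
by rewrite !detM [_ * \det z]mulrC -(mulrA (\det z)) detV // mulr1 detV.
Qed.

Lemma comm_units_upper (t : F) : comm_units (upper t).
Proof.
have -> : upper t = 1 + mx2 0 t 0 0 by rewrite mx2_1 mx2D /upper; congr mx2; ring.
apply: (@comm_units_elementary _ (mx2 1 0 0 0)).
- by rewrite -scaler_nat scaler_unit ?unitr1 // unitfE.
- by rewrite mx2M; congr mx2; ring.
- by rewrite mx2M; congr mx2; ring.
- by rewrite mx2M mx2_0; congr mx2; ring.
Qed.

Lemma comm_units_lower (t : F) : comm_units (lower t).
Proof.
have -> : lower t = 1 + mx2 0 0 t 0 by rewrite mx2_1 mx2D /lower; congr mx2; ring.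
apply: (@comm_units_elementary _ (mx2 0 0 0 1)).
- by rewrite -scaler_nat scaler_unit ?unitr1 // unitfE.
- by rewrite mx2M; congr mx2; ring.
- by rewrite mx2M; congr mx2; ring.
- by rewrite mx2M mx2_0; congr mx2; ring.
Qed.

Lemma comm_units_diag (t : F) : t != 0 -> comm_units (mx2 t 0 0 t^-1).
Proof.
move=> t0.
have -> : mx2 t 0 0 t^-1 = 1 + (t - 1) *: (mx2 0 1 0 0 * mx2 0 0 1 0) +
    (t^-1 - 1) *: (mx2 0 0 1 0 * mx2 0 1 0 0).
  by rewrite !mx2M mx2_1 !mx2Z !mx2D; congr mx2; ring.
by apply: comm_units_torus; rewrite // !mx2M ?mx2_0; congr mx2; ring.
Qed.

Lemma trace_fourth v : \det v = 1 -> \tr (v * v * (v * v)) =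
  \tr v * \tr v * (\tr v * \tr v) - 4%:R * (\tr v * \tr v) + 2%:R.
Proof.
rewrite [v]mx2_eta; move: (v 0 0) (v 0 1) (v 1 0) (v 1 1) => a b c d.
rewrite det_mx2 !mx2M !trace_mx2 => D.
(* Multiplying by powers of the determinant makes both sides homogeneous of degree four, after which
   the identity is polynomial. *)
have -> : 4%:R * ((a + d) * (a + d)) = 4%:R * ((a + d) * (a + d)) * (a * d - b * c).
  by rewrite D mulr1.
have -> : 2%:R = 2%:R * (a * d - b * c) * (a * d - b * c) :> F by rewrite D !mulr1.
ring.
Qed.

(* Comparing the traces of [v] and [v ^ 4] gives (t - 2)(t + 1)(t^2 + t - 1) =
   0 for [t := \tr v]; the last two factors force [v ^ 3 = 1] and [v ^ 5 = 1].
   *)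
Lemma conj_fourth_unipotent v g : \det v = 1 -> g \is a GRing.unit ->
    g * v = v * v * (v * v) * g ->
    v * v * v != 1 -> (v * v * (v * v) * v = 1 -> (5%:R : F) = 0) ->
  (v - 1) * (v - 1) = 0.
Proof.
move=> D gU gv v3 v5; have CH := cayley_mx2 D.
set t := \tr v in CH *.
have trE : \tr (v * v * (v * v)) = t.
  have -> : v * v * (v * v) = g * v * g^-1 by rewrite gv mulrK.
  by rewrite [LHS]mxtrace_mulC [_ *m _]mulKr.
have poly : (t - 2%:R) * ((t + 1) * (t * t + t - 1)) = 0.
  have -> : (t - 2%:R) * ((t + 1) * (t * t + t - 1)) =
     (t * t * (t * t) - 4%:R * (t * t) + 2%:R) - t by ring.
  by rewrite -trace_fourth // trE subrr.
have v3E : v * v * v = (t * t - 1) *: v - t *: 1.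
  rewrite CH mulrBl mul1r -scalerAl CH scalerBr scalerA scalerBl scale1r.
  by rewrite addrAC.
have t2 : t = 2%:R -> (v - 1) * (v - 1) = 0.
  move=> tE; rewrite mulrBl mulrBr mul1r mulr1 CH tE scaler_nat mulr2n.
  by rewrite [_ - 1 - v]addrAC addrK subrr.
move: poly => /eqP; rewrite mulf_eq0 subr_eq0 => /orP[/eqP//|].
rewrite mulf_eq0 => /orP[|] /eqP tE.
  case/eqP: v3; rewrite v3E.
  have -> : t = -1 by apply/eqP; rewrite -addr_eq0 tE.
  by rewrite mulrNN mulr1 subrr scale0r scaleN1r opprK add0r.
have F5 : (5%:R : F) = 0.
  apply: v5.
  rewrite -(mulrA (v * v)).
  have tt : t * t - 1 = - t by apply/eqP; rewrite -addr_eq0 addrAC tE.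
  have -> : v * v * v = - t *: v - t *: 1 by rewrite v3E tt.
  have {tt}tt : t * t = 1 - t by apply: (addIr (-1)); rewrite tt; ring.
  have -> : - t *: v - t *: 1 = - t *: (v + 1) by rewrite scalerDr !scaleNr.
  have E : (t *: v - 1) * (v + 1) = (- t - 1) *: 1.
    rewrite mulrBl mul1r mulrDr mulr1 -scalerAl CH scalerBr scalerA tt scalerBl
      scale1r.
    rewrite scalerBl scale1r scaleNr opprD addrA; congr (_ - 1).
    by rewrite [_ - t *: v - _]addrAC subrK addrAC subrr add0r.
  rewrite CH -scalerAr E scalerA mulrDr mulrNN tt mulrN1 opprK subrK.
  exact: scale1r.
(* When 5 = 0, [t^2 + t - 1] equals [(t - 2)^2], so this factor also forces trace 2. *)
apply: t2; apply/eqP; rewrite -subr_eq0; apply/eqP.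
have : (t - 2%:R) * (t - 2%:R) = 0.
  have -> : (t - 2%:R) * (t - 2%:R) = (t * t + t - 1) - 5%:R * (t - 1) by ring.
  by rewrite tE F5 mul0r subr0.
by move/eqP; rewrite mulf_eq0 orbb => /eqP.
Qed.

End SL2.

Section SL2Iso.
Variable F : fieldType.
Hypotheses (F2 : (2%:R : F) != 0) (F3 : (3%:R : F) != 0).
Local Notation M := 'M[F]_2.

Lemma upperD (s t : F) : upper s * upper t = upper (s + t).
Proof. by rewrite mx2M; congr mx2; ring. Qed.

Lemma lowerD (s t : F) : lower s * lower t = lower (s + t).
Proof. by rewrite mx2M; congr mx2; ring. Qed.

Lemma upper0 : upper (0 : F) = 1. Proof. by rewrite mx2_1. Qed.
Lemma lower0 : lower (0 : F) = 1. Proof. by rewrite mx2_1. Qed.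

Lemma upperB1 (t : F) : upper t - 1 = mx2 0 t 0 0.
Proof. by rewrite mx2_1 mx2N mx2D; congr mx2; ring. Qed.

Lemma lowerB1 (t : F) : lower t - 1 = mx2 0 0 t 0.
Proof. by rewrite mx2_1 mx2N mx2D; congr mx2; ring. Qed.

Section Unipotent.
Variables (phi psi : M -> M).
Hypothesis phipsi : comm_units_iso phi psi.

Let unipotent_image (u g : M) : comm_units u -> comm_units g ->
    g * u = u * u * (u * u) * g -> u * u * u != 1 ->
    (u * u * (u * u) * u = 1 -> (5%:R : F) = 0) ->
  (phi u - 1) * (phi u - 1) = 0.
Proof.
move=> Ku Kg gu u3 u5; have [hphi hpsi phiK' psiK'] := phipsi.
have [phiK phiM] := hphi.
have Kuu := comm_unitsM Ku Ku.
have phi1 := comm_units_hom1 hphi.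
apply: (@conj_fourth_unipotent _ _ (phi g)).
- exact/comm_units_det/phiK.
- exact/comm_units_unit/phiK.
- by rewrite -!phiM ?gu //; do ?apply: comm_unitsM.
- apply: contra_neq u3 => H; have := congr1 psi H.
  rewrite -!phiM // -{1}phi1 !phiK' //; first exact: comm_units1.
  exact: comm_unitsM.
- move=> H; apply: u5; have := congr1 psi H.
  rewrite -!phiM //; do ?apply: comm_unitsM => //.
  rewrite -{1}phi1 !phiK' //; first exact: comm_units1.
  by do ?apply: comm_unitsM.
Qed.

Let five (t : F) : t != 0 -> 5%:R * t = 0 -> (5%:R : F) = 0.
Proof. by move=> t0 /eqP; rewrite mulf_eq0 (negPf t0) orbF => /eqP. Qed.

Lemma upper_unipotent t : (phi (upper t) - 1) * (phi (upper t) - 1) = 0.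
Proof.
have [hphi _ _ _] := phipsi.
have [->|t0] := eqVneq t 0.
  by rewrite upper0 comm_units_hom1 // subrr mul0r.
(* Conjugation by [diag(2, 1/2)] multiplies [t] by 4, the fourth power of [upper t]. Characteristic
   different from 3 ensures that its cube is not 1. *)
apply: (unipotent_image (g := mx2 2%:R 0 0 2%:R^-1)).
- exact: comm_units_upper.
- exact: comm_units_diag.
- by rewrite !upperD !mx2M; congr mx2; field.
- rewrite !upperD mx2_1; apply: contra_neq t0 => /mx2_inj[_ + _ _].
  move=> t3; apply: (mulfI F3); rewrite mulr0 -[RHS]t3; ring.
- rewrite !upperD mx2_1 => /mx2_inj[_ t5 _ _]; apply: (five t0).
  by rewrite -[RHS]t5; ring.
Qed.

Lemma lower_unipotent t : (phi (lower t) - 1) * (phi (lower t) - 1) = 0.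
Proof.
have [hphi _ _ _] := phipsi.
have [->|t0] := eqVneq t 0.
  by rewrite lower0 comm_units_hom1 // subrr mul0r.
have F2V : 2%:R^-1 != 0 :> F by rewrite invr_eq0.
apply: (unipotent_image (g := mx2 2%:R^-1 0 0 2%:R)).
- exact: comm_units_lower.
- by rewrite -[X in mx2 _ _ _ X]invrK; apply: comm_units_diag.
- by rewrite !lowerD !mx2M; congr mx2; field.
- rewrite !lowerD mx2_1; apply: contra_neq t0 => /mx2_inj[_ _ + _].
  move=> t3; apply: (mulfI F3); rewrite mulr0 -[RHS]t3; ring.
- rewrite !lowerD mx2_1 => /mx2_inj[_ _ t5 _]; apply: (five t0).
  by rewrite -[RHS]t5; ring.
Qed.

(** The image is unipotent and commutes with [upper c], which leaves only upper unitriangular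
    matrices. *)
Lemma phi_upper c t : c != 0 -> phi (upper 1) = upper c ->
  phi (upper t) = upper (phi (upper t) 0 1).
Proof.
move=> c0 phi1E; have [[phiK phiM] _ _ _] := phipsi.
have w2 := upper_unipotent t.
set w := phi (upper t) - 1 in w2.
have wE : phi (upper t) = 1 + w by rewrite /w addrC subrK.
have wC : w * mx2 0 c 0 0 = mx2 0 c 0 0 * w.
  rewrite -upperB1 -phi1E; apply: commrB; last exact: commr1.
  apply/commr_sym/commrB; last exact: commr1.
  by rewrite /GRing.comm -!phiM ?upperD 1?addrC //; apply: comm_units_upper.
rewrite wE (commute_upper_mx2 F2 c0 w2 wC).
by rewrite mx2_1 mx2D !mxE /=; congr mx2; ring.
Qed.

Lemma phi_lower c t : c != 0 -> phi (lower 1) = lower c ->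
  phi (lower t) = lower (phi (lower t) 1 0).
Proof.
move=> c0 phi1E; have [[phiK phiM] _ _ _] := phipsi.
have w2 := lower_unipotent t.
set w := phi (lower t) - 1 in w2.
have wE : phi (lower t) = 1 + w by rewrite /w addrC subrK.
have wC : w * mx2 0 0 c 0 = mx2 0 0 c 0 * w.
  rewrite -lowerB1 -phi1E; apply: commrB; last exact: commr1.
  apply/commr_sym/commrB; last exact: commr1.
  by rewrite /GRing.comm -!phiM ?lowerD 1?addrC //; apply: comm_units_lower.
rewrite wE (commute_lower_mx2 F2 c0 w2 wC).
by rewrite mx2_1 mx2D !mxE /=; congr mx2; ring.
Qed.

End Unipotent.
End SL2Iso.

Section SL2Normalized.
Variable F : fieldType.
Hypotheses (F2 : (2%:R : F) != 0) (F3 : (3%:R : F) != 0).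
Local Notation M := 'M[F]_2.
Variables (phi psi : M -> M).
Hypothesis phipsi : comm_units_iso phi psi.

(** Only the isomorphism alternative occurs, since on [SL_2(F)] inverse transpose is conjugation by
    a Weyl element. The constant [c] turns out to be 1, as [beta] and [alpha] agree. *)
Lemma SL2_normalized_standard (c : F) : c != 0 ->
  phi (upper 1) = upper 1 -> phi (lower 1) = lower c -> standard_iso phi.
Proof.
move=> c0 phiu phil; have [hphi hpsi phiK' psiK'] := phipsi.
have [phiK phiM] := hphi; have psiphi := comm_units_iso_sym phipsi.
have Ku (t : F) : comm_units (upper t) by apply: comm_units_upper.
have Kl (t : F) : comm_units (lower t) by apply: comm_units_lower.
have psiu : psi (upper 1) = upper 1 by rewrite -{1}phiu; apply: phiK'; apply: Ku.
pose alpha t := phi (upper t) 0 1; pose beta t := phi (lower t) 1 0.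
pose alpha' t := psi (upper t) 0 1.
have phi_u t : phi (upper t) = upper (alpha t).
  exact: (phi_upper F2 F3 phipsi t (oner_neq0 F) phiu).
have phi_l t : phi (lower t) = lower (beta t).
  exact: (phi_lower F2 F3 phipsi t c0 phil).
have psi_u t : psi (upper t) = upper (alpha' t).
  exact: (phi_upper F2 F3 psiphi t (oner_neq0 F) psiu).
have upper_inj (s t : F) : upper s = upper t -> s = t by move=> /mx2_inj[].
have lower_inj (s t : F) : lower s = lower t -> s = t by move=> /mx2_inj[].
have alphaD s t : alpha (s + t) = alpha s + alpha t.
  by apply: upper_inj; rewrite -phi_u -upperD phiM // !phi_u upperD.
have alpha1 : alpha 1 = 1 by apply: upper_inj; rewrite -phi_u.
have alphaK : cancel alpha alpha'.
  by move=> t; apply: upper_inj; rewrite -psi_u -phi_u phiK'.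
have alpha'K : cancel alpha' alpha.
  by move=> t; apply: upper_inj; rewrite -phi_u -psi_u psiK'.
have alpha0 : alpha 0 = 0 by apply: (addrI (alpha 0)); rewrite -alphaD !addr0.
have alphaN t : alpha (- t) = - alpha t.
  by apply/eqP; rewrite -addr_eq0 -alphaD addNr alpha0.
have alpha_neq0 t : t != 0 -> alpha t != 0.
  by apply: contra_neq => at0; rewrite -(alphaK t) at0 -alpha0 alphaK.
(* The Weyl element [upper t * lower (- t^-1) * upper t] conjugates [upper] to
   [lower]; transporting this relation ties [beta] to [alpha] and makes
   [alpha] commute with squares. *)
have weyl s t : t != 0 ->
    [/\ alpha t * beta (- t^-1) = - 1
      & beta (- (s / (t * t))) = - (alpha s / (alpha t * alpha t))].
  move=> t0; have at0 := alpha_neq0 _ t0.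
  have rel r : (1 + alpha t * beta (- t^-1)) * alpha r = 0 /\
      beta (- t^-1) * alpha r = beta (- (r / (t * t))) *
        (alpha t + alpha t + alpha t * beta (- t^-1) * alpha t).
    have : upper t * lower (- t^-1) * upper t * upper r =
        lower (- (r / (t * t))) * (upper t * lower (- t^-1) * upper t).
      by rewrite /upper /lower !mx2M; congr mx2; field.
    move/(congr1 phi); rewrite !phiM //; do ?[apply: comm_unitsM => //].
    rewrite !phi_u !phi_l /upper /lower !mx2M => /mx2_inj[_ E1 _ E2]; split.
      apply: (addIr (alpha t + alpha t + alpha t * beta (- t^-1) * alpha t)).
      rewrite add0r; apply: etrans (etrans _ E1) _; ring.
    apply: (addIr (1 + beta (- t^-1) * alpha t)).
    apply: etrans (etrans _ E2) _; first by ring.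
    by ring.
  have [E1 E2] := rel 1; rewrite alpha1 mulr1 in E1.
  have ab : alpha t * beta (- t^-1) = -1 by apply/eqP; rewrite -addr_eq0 addrC E1.
  split=> //; have [_ E3] := rel s.
  rewrite ab mulN1r addrK in E3.
  have -> : beta (- (s / (t * t))) = beta (- t^-1) * alpha s / alpha t.
    by rewrite E3 mulfK.
  have -> : beta (- t^-1) = - (alpha t)^-1.
    by apply: (mulfI at0); rewrite ab mulrN mulfV.
  by field.
(* Two evaluations of [beta (- (t * t)^-1)]: the conjugation relation at [t] with [s = 1], and the
   product relation at [t * t]. Additivity then polarizes this to [alphaM], dividing by 2. *)
have alpha_sqr t : alpha (t * t) = alpha t * alpha t.
  have [->|t0] := eqVneq t 0; first by rewrite mulr0 alpha0 mulr0.
  have tt0 : t * t != 0 by rewrite mulf_neq0.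
  have att0 := alpha_neq0 _ tt0; have at0 := alpha_neq0 _ t0.
  have [_ E1] := weyl 1 t t0; have [E2 _] := weyl 1 (t * t) tt0.
  rewrite mul1r in E1; rewrite E1 alpha1 in E2.
  have -> : alpha (t * t) = - (alpha (t * t) * - (1 / (alpha t * alpha t))) *
     (alpha t * alpha t) by field.
  by rewrite E2 opprK mul1r.
have alphaM s t : alpha (s * t) = alpha s * alpha t.
  have := alpha_sqr (s + t).
  have -> : (s + t) * (s + t) = s * s + t * t + (s * t + s * t) by ring.
  rewrite !alphaD !alpha_sqr => E; apply: (mulfI F2).
  apply: (addrI (alpha s * alpha s + alpha t * alpha t)).
  by rewrite mulr_natl mulr2n E; ring.
(* The product relation of [weyl] is used at [t = - r^-1], where [- t^-1] is [r]. *)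
have betaE r : beta r = alpha r.
  have [->|r0] := eqVneq r 0.
    rewrite alpha0; apply: lower_inj; rewrite -phi_l lower0.
    exact: comm_units_hom1.
  have rV0 : - r^-1 != 0 by rewrite oppr_eq0 invr_eq0.
  have [E _] := weyl 1 _ rV0; rewrite invrN invrK opprK alphaN in E.
  have arV : alpha r * alpha r^-1 = 1 by rewrite -alphaM mulfV.
  have -> : beta r = alpha r * alpha r^-1 * beta r by rewrite arV mul1r.
  by rewrite -mulrA -[alpha r^-1 * _]opprK -mulNr E opprK mulr1.
pose al : {rmorphism F -> F} := HB.pack alpha
  (GRing.isZmodMorphism.Build _ _ alpha (fun s t => etrans (alphaD s (- t))
    (congr1 _ (alphaN t))))
  (GRing.isMonoidMorphism.Build _ _ alpha (conj alpha1 alphaM)).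
have phiE x : comm_units x -> phi x = map_mx al x.
  move=> /comm_units_elementary_mx.
  have Kel y : elementary y -> comm_units (y : M).
    elim=> [|{}y z _ Ky _ Kz|i j t ij]; [exact: comm_units1|exact: comm_unitsM|].
    case: (ord2_cases i) (ord2_cases j) ij => -> [] -> // _.
      suff -> : 1%:M + t *: delta_mx 0 1 = upper t by [].
      by rewrite [LHS]mx2_eta !mxE /=; congr mx2; ring.
    suff -> : 1%:M + t *: delta_mx 1 0 = lower t by [].
    by rewrite [LHS]mx2_eta !mxE /=; congr mx2; ring.
  elim=> [|y z Ey IHy Ez IHz|i j t ij].
  - by rewrite map_mx1; apply: comm_units_hom1.
  - by rewrite map_mxM -IHy -IHz; apply: phiM; apply: Kel.
  case: (ord2_cases i) (ord2_cases j) ij => -> [] -> // _.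
    have -> : 1%:M + t *: delta_mx 0 1 = upper t.
      by rewrite [LHS]mx2_eta !mxE /=; congr mx2; ring.
    by rewrite phi_u [RHS]mx2_eta !mxE /= ?alpha1 ?alpha0.
  have -> : 1%:M + t *: delta_mx 1 0 = lower t.
    by rewrite [LHS]mx2_eta !mxE /=; congr mx2; ring.
  by rewrite phi_l betaE [RHS]mx2_eta !mxE /= ?alpha1 ?alpha0.
left; exists (map_mx al : M -> M); split=> //; split.
- exists (map_mx alpha' : M -> M) => m; apply/matrixP => i j; rewrite !mxE.
    exact: alphaK.
  exact: alpha'K.
- exact: map_mxD.
- exact: map_mx1.
- exact: map_mxM.
Qed.

End SL2Normalized.

(** The images of [upper 1] and [lower 1] minus 1 are square-zero and do not commute, so up to a
    scalar they are [E12] and [E21] of another system of matrix units. Changing coordinates to that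
    system reduces to the normalized case. *)
Lemma SL2_standard (F : fieldType) (phi psi : 'M[F]_2 -> 'M[F]_2) :
    (2%:R : F) != 0 -> (3%:R : F) != 0 -> comm_units_iso phi psi ->
  standard_iso phi.
Proof.
move=> F2 F3 phipsi; have [hphi hpsi phiK' psiK'] := phipsi;
  have [phiK phiM] := hphi.
have Ku (t : F) : comm_units (upper t) by apply: comm_units_upper.
have Kl (t : F) : comm_units (lower t) by apply: comm_units_lower.
pose y := phi (upper 1) - 1; pose z := phi (lower 1) - 1.
have yy : y * y = 0 := upper_unipotent F2 F3 phipsi 1.
have zz : z * z = 0 := lower_unipotent F2 F3 phipsi 1.
have yz : y * z != z * y.
  apply/eqP => yz; have : phi (upper 1) * phi (lower 1) = phi (lower 1) * phi
    (upper 1).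
    have -> : phi (upper 1) = y + 1 by rewrite subrK.
    have -> : phi (lower 1) = z + 1 by rewrite subrK.
    apply: commrD; last exact: commr1.
    by apply/commr_sym/commrD; [apply: commr_sym | apply: commr1].
  rewrite -!phiM // => /(congr1 psi); rewrite !phiK'; try exact: comm_unitsM.
  rewrite !mx2M => /mx2_inj[+ _ _ _].
  rewrite !(mulr1, mul1r, mulr0, mul0r) => /(addrI 1)/eqP.
  by rewrite oner_eq0.
have [c c0 yzE] := square_zero_anticommutator yy zz yz.
pose z' := c^-1 *: z.
have yz' : y * z' + z' * y = 1.
  by rewrite /z' -scalerAr -scalerAl -scalerDr yzE scalerA mulVf // scale1r.
have zz' : z' * z' = 0 by rewrite /z' -scalerAr -scalerAl zz !scaler0.
have zE : z = c *: z' by rewrite /z' scalerA mulfV // scale1r.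
have uE : phi (upper 1) = 1 + y by rewrite /y addrC subrK.
have lE : phi (lower 1) = 1 + c *: z' by rewrite -zE /z addrC subrK.
clearbody z' y; clear zE yz yzE zz z.
move: z' yz' zz' lE => z yz zz lE.
have yzy : y * z * y = y by rewrite -[RHS]mulr1 -yz mulrDr !mulrA yy mul0r add0r.
have zyz : z * y * z = z by rewrite -[RHS]mulr1 -yz mulrDr !mulrA zz mul0r addr0.
have yzz : y * z * z = 0 by rewrite -mulrA zz mulr0.
have zyy : z * y * y = 0 by rewrite -mulrA yy mulr0.
(* The relation [y * z + z * y = 1] makes [y * z] and [z * y] complementary idempotents, completing
   the system of matrix units. *)
pose E (i j : 'I_2) := if i == 0 then (if j == 0 then y * z else y)
  else if j == 0 then z else z * y.
have [||f [fD f1 fM fZ fE]] := @matrix_units_morph F 2 'M[F]_2 E.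
- move=> i j k l.
  by case: (ord2_cases i) (ord2_cases j) (ord2_cases k) (ord2_cases l) =>
    -> [] -> [] -> [] ->; rewrite /E /= ?(mulrA, yzy, zyz, yzz, zyy, yy, zz, mul0r).
- by rewrite !big_ord_recl big_ord0 addr0 /E /= yz.
have [kappa kappaE] := @lrmorphism_build F 'M[F]_2 'M[F]_2 f fD f1 fM fZ.
have kappa_inj : injective kappa := simple_morph_inj (@matrix_simple F 1).
have [_ /(_ erefl) kappa_surj] := @mx_linear_injection F 2 2 kappa kappa_inj.
have [kappa' kappa'K] := choice kappa_surj.
have kappaK : cancel kappa kappa' by move=> x; apply: kappa_inj; rewrite kappa'K.
pose kap : {rmorphism 'M[F]_2 -> 'M[F]_2} := HB.pack kappa'
  (GRing.isZmodMorphism.Build _ _ kappa' (can2_zmod_morphism kappaK kappa'K))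
  (GRing.isMonoidMorphism.Build _ _ kappa' (can2_monoid_morphism kappaK kappa'K)).
pose idM : {rmorphism 'M[F]_2 -> 'M[F]_2} := idfun.
have iso1 := @comm_units_iso_transport 'M[F]_2 'M[F]_2 'M[F]_2 'M[F]_2 idM idM
  kappa kap
  (fun _ => erefl) (fun _ => erefl) kappaK kappa'K phi psi phipsi.
apply: (@standard_iso_transport 'M[F]_2 'M[F]_2 'M[F]_2 'M[F]_2 idM idM kappa kap
  (fun _ => erefl) (fun _ => erefl) kappaK kappa'K phi).
apply: (SL2_normalized_standard F2 F3 iso1 c0) => /=; apply: kappa_inj;
  rewrite kappa'K.
  rewrite [LHS]uE; have -> : upper 1 = 1 + delta_mx 0 1 :> 'M[F]_2.
    by rewrite [RHS]mx2_eta !mxE /=; congr mx2; ring.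
  by rewrite rmorphD rmorph1 /= kappaE fE.
rewrite [LHS]lE; have -> : lower c = 1 + c *: delta_mx 1 0 :> 'M[F]_2.
  by rewrite [RHS]mx2_eta !mxE /=; congr mx2; ring.
by rewrite kappaE fD fZ fE [f 1]f1.
Qed.

(** * Types of locally matrix algebras and how the group tells them apart *)

Lemma inj_surj_bij (T U : Type) (f : T -> U) :
  injective f -> (forall y, exists x, f x = y) -> bijective f.
Proof.
by move=> f_inj /choice[g gK]; exists g => // x; apply: f_inj; rewrite gK.
Qed.

Lemma rmorphism_inverse (R S : pzRingType) (f : {rmorphism R -> S}) :
  bijective f -> exists2 g : {rmorphism S -> R}, cancel f g & cancel g f.
Proof.
move=> [g fK gK].
pose g' : {rmorphism S -> R} := HB.pack g
  (GRing.isZmodMorphism.Build _ _ g (can2_zmod_morphism fK gK))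
  (GRing.isMonoidMorphism.Build _ _ g (can2_monoid_morphism fK gK)).
by exists g'.
Qed.

Section Types.
Variables (F : fieldType) (A : unitAlgType F).
Hypothesis locmxA : unital_locally_matrix A.

(** A matrix algebra containing any given [a] and the matrix units of [h] cannot be larger, so it
    has the same size and the image of [h] contains [a]. *)
Lemma maximal_embed n (h : {lrmorphism 'M[F]_n.+1 -> A}) : injective h ->
    (forall n' (h' : {lrmorphism 'M[F]_n'.+1 -> A}), injective h' -> (n' <= n)%N) ->
  bijective h.
Proof.
move=> h_inj max; apply: inj_surj_bij => // a.
have [n' [h' [h'_inj h's]]] := locmx_embed locmxA
  (a :: [seq h (delta_mx p.1 p.2) | p : 'I_n.+1 * 'I_n.+1]).
have [i j|le eqn] := embed_leq h_inj h'_inj.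
  by apply: h's; rewrite inE; apply/orP; right; apply/mapP; exists (i, j);
    rewrite ?mem_enum.
have [|m' am'] := h's a; first by rewrite inE eqxx.
have [|m hm] := eqn _ m'; last by exists m; rewrite hm.
by apply/eqP; rewrite eqn_leq le (max _ h').
Qed.

(** If no embedding of size at least three exists, sizes are bounded and an embedding of maximal
    size is onto. *)
Lemma locmx_cases : [\/ has_mx3 A,
  exists h : {lrmorphism 'M[F]_2 -> A}, bijective h
  | exists h : {lrmorphism 'M[F]_1 -> A}, bijective h].
Proof.
have [?|no3] := pselect (has_mx3 A); first by constructor 1.
have le1 n (h : {lrmorphism 'M[F]_n.+1 -> A}) : injective h -> (n <= 1)%N.
  case: n h => [|[|n]] h h_inj //; case: no3; by exists n, h.
have [[h h_inj]|no2] := pselect (exists h : {lrmorphism 'M[F]_2 -> A}, injective h).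
  by constructor 2; exists h; apply: maximal_embed.
constructor 3; have [n [h [h_inj _]]] := locmx_embed locmxA [::].
have n0 n' (h' : {lrmorphism 'M[F]_n'.+1 -> A}) : injective h' -> (n' <= 0)%N.
  move=> h'_inj; have := le1 _ _ h'_inj.
  by case: n' h' h'_inj => [|[|]] // h' h'_inj _; case: no2; exists h'.
case: n h h_inj => [|n] h h_inj; last by have := n0 _ _ h_inj.
by exists h; apply: maximal_embed.
Qed.

Lemma mx3_noncentral_involution : (2%:R : F) != 0 -> has_mx3 A ->
  exists g x : A, [/\ comm_units g, comm_units x, g * g = 1 & g * x <> x * g].
Proof.
move=> F2 [n [h h_inj]].
have A2 : 2%:R \is a @GRing.unit A.
  by rewrite -scaler_nat scaler_unit ?unitr1 // unitfE.
pose i0 : 'I_n.+3 := inord 0; pose i1 : 'I_n.+3 := inord 1;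
  pose i2 : 'I_n.+3 := inord 2.
have i01 : i0 != i1 by rewrite -val_eqE /= !inordK.
have i02 : i0 != i2 by rewrite -val_eqE /= !inordK.
have i12 : i1 != i2 by rewrite -val_eqE /= !inordK.
pose E i j := h (delta_mx i j : 'M[F]_n.+3).
have EM i j k : E i j * E j k = E i k.
  by rewrite -rmorphM -[delta_mx _ _ * _]/(_ *m _) mul_delta_mx.
have E0 i j k l : j != k -> E i j * E k l = 0.
  by move=> jk; rewrite -rmorphM -[delta_mx _ _ * _]/(_ *m _) mul_delta_mx_0
    ?rmorph0.
(* This is [diag(1, -1, -1)], extended by 1: two minus signs put it in the commutator subgroup, and
   the third index keeps it from being central. *)
pose g := 1 - E i1 i1 - E i1 i1 - E i2 i2 - E i2 i2.
have Kg : comm_units g.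
  have -> : g = 1 + (-1 - 1) *: (E i1 i2 * E i2 i1) + ((-1)^-1 - 1) *: (E i2 i1 *
    E i1 i2).
    by rewrite !EM invrN1 !scalerBl !scaleN1r !scale1r !addrA.
  apply: comm_units_torus; rewrite ?EM ?oppr_eq0 ?oner_eq0 // E0 //.
  by rewrite eq_sym.
have Kx : comm_units (1 + E i0 i1).
  by apply: (@comm_units_elementary A (E i0 i0)); rewrite ?EM // E0 // eq_sym.
exists g, (1 + E i0 i1); split=> //.
  have -> : g * g = 1 - E i1 i1 - E i1 i1 - E i1 i1 - E i1 i1 + E i1 i1 * E i1 i1
    + E i1 i1 * E i1 i1 + E i1 i1 * E i1 i1 + E i1 i1 * E i1 i1
    - E i2 i2 - E i2 i2 - E i2 i2 - E i2 i2 + E i2 i2 * E i2 i2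
    + E i2 i2 * E i2 i2 + E i2 i2 * E i2 i2 + E i2 i2 * E i2 i2
    + (E i1 i1 * E i2 i2 + E i1 i1 * E i2 i2 + E i1 i1 * E i2 i2 + E i1 i1 * E i2
      i2)
    + (E i2 i2 * E i1 i1 + E i2 i2 * E i1 i1 + E i2 i2 * E i1 i1 + E i2 i2 * E i1
      i1).
    by rewrite /g; non_commutative_ring.
  rewrite !EM (E0 i1 i1 i2) // (E0 i2 i2 i1) 1?eq_sym // !addr0.
  by non_commutative_ring.
have gE : g * E i0 i1 = E i0 i1.
  have -> : g * E i0 i1 = E i0 i1 - E i1 i1 * E i0 i1 - E i1 i1 * E i0 i1
     - E i2 i2 * E i0 i1 - E i2 i2 * E i0 i1 by rewrite /g; non_commutative_ring.
  by rewrite (E0 i1 i1 i0) 1?eq_sym // (E0 i2 i2 i0) 1?eq_sym // !subr0.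
have Eg : E i0 i1 * g = - E i0 i1.
  have -> : E i0 i1 * g = E i0 i1 - E i0 i1 * E i1 i1 - E i0 i1 * E i1 i1
     - E i0 i1 * E i2 i2 - E i0 i1 * E i2 i2 by rewrite /g; non_commutative_ring.
  by rewrite EM (E0 i0 i1 i2) // !subr0 subrr sub0r.
rewrite [g * _]mulrDr [_ * g]mulrDl mulr1 mul1r gE Eg => /addrI/eqP.
rewrite -addr_eq0 => /eqP/(two_torsion_free A2) Ez.
have /eqP := delta_mx_neq0 F i0 i1; apply; apply: h_inj; rewrite rmorph0; exact: Ez.
Qed.

(** With determinant 1 and square 1, Cayley-Hamilton reads [tr(g) g = 2]; the trace is then nonzero
    and [g] is scalar. *)
Lemma mx2_involution_central (h : {lrmorphism 'M[F]_2 -> A}) : (2%:R : F) != 0 ->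
  bijective h -> forall g x : A, comm_units g -> g * g = 1 -> g * x = x * g.
Proof.
move=> F2 /rmorphism_inverse[h' hK h'K] g x Kg gg.
have D := comm_units_det (comm_units_morph h' Kg).
have := cayley_mx2 D; rewrite -rmorphM gg rmorph1 => /eqP.
rewrite eq_sym subr_eq -mulr2n => /eqP E.
have t0 : \tr (h' g) != 0.
  apply/eqP => t0; move: E; rewrite t0 scale0r => /esym/eqP.
  by rewrite -scaler_nat scaler_eq0 (negPf F2) oner_eq0.
have gE : h' g = ((\tr (h' g))^-1 * 2%:R) *: 1.
  by rewrite -scalerA scaler_nat -E scalerA mulVf // scale1r.
apply: (can_inj h'K); rewrite !rmorphM gE.
by rewrite -scalerAl -scalerAr mul1r mulr1.
Qed.

Lemma mx1_comm_units (h : {lrmorphism 'M[F]_1 -> A}) :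
  bijective h -> forall g : A, comm_units g -> g = 1.
Proof.
move=> [h' hK h'K].
have comm (x y : A) : x * y = y * x.
  rewrite -(h'K x) -(h'K y) -!rmorphM; congr (h _).
  by rewrite -[LHS]/(_ *m _) -[RHS]/(_ *m _) [h' x]mx11_scalar scalar_mxC.
apply: comm_units_ind => // [x y -> ->|x _ ->|y z yU zU]; rewrite ?mulr1 ?invr1 //.
by rewrite (comm y) mulrK // mulrV.
Qed.

End Types.

(** * Combination of the cases and return to the commutator subgroups *)

Section Main.
Variables (F : fieldType).
Hypotheses (charF2 : 2%N \notin [pchar F]) (charF3 : 3%N \notin [pchar F]).

Let F2 : (2%:R : F) != 0. Proof. by apply: contra charF2 => F2; rewrite inE. Qed.
Let F3 : (3%:R : F) != 0. Proof. by apply: contra charF3 => F3; rewrite inE. Qed.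

Section Mixed.
Variables (A B : unitAlgType F) (phi : A -> B) (psi : B -> A).
Hypotheses (locmxA : unital_locally_matrix A) (phipsi : comm_units_iso phi psi).

Let mx3_central : has_mx3 A ->
  (forall g x : B, comm_units g -> g * g = 1 -> g * x = x * g) -> False.
Proof.
move=> A3 central; have [hphi _ phiK' _] := phipsi; have [phiK phiM] := hphi.
have [g [x [Kg Kx gg gx]]] := mx3_noncentral_involution F2 A3.
apply: gx; have := central (phi g) (phi x) (phiK _ Kg).
rewrite -!phiM // gg (comm_units_hom1 hphi) => /(_ erefl)/(congr1 psi).
by rewrite !phiK' //; apply: comm_unitsM.
Qed.

Lemma mx3_mx2_false (h : {lrmorphism 'M[F]_2 -> B}) :
  has_mx3 A -> bijective h -> False.
Proof. by move=> A3 hB; apply: mx3_central A3 (mx2_involution_central F2 hB). Qed.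

Lemma mx3_mx1_false (h : {lrmorphism 'M[F]_1 -> B}) :
  has_mx3 A -> bijective h -> False.
Proof.
move=> A3 hB; apply: mx3_central A3 _ => g x Kg _.
by rewrite (mx1_comm_units hB Kg) mulr1 mul1r.
Qed.

Lemma mx2_mx1_false (h : {lrmorphism 'M[F]_2 -> A}) (k : {lrmorphism 'M[F]_1 ->
  B}) :
  bijective h -> bijective k -> False.
Proof.
move=> [h' hK _] kB; have [hphi _ phiK' _] := phipsi; have [phiK phiM] := hphi.
have Ku := comm_units_morph h (comm_units_upper F2 1).
have := mx1_comm_units kB (phiK _ Ku).
rewrite -(comm_units_hom1 hphi) => /(congr1 psi).
rewrite !phiK' //; last exact: comm_units1.
rewrite -(rmorph1 h) => /(can_inj hK); rewrite mx2_1 => /mx2_inj[_ /eqP + _ _].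
by rewrite oner_eq0.
Qed.

End Mixed.

Lemma comm_units_iso_standard (A B : unitAlgType F) (phi : A -> B) (psi : B -> A) :
    unital_locally_matrix A -> unital_locally_matrix B -> comm_units_iso phi psi ->
  standard_iso phi.
Proof.
move=> locA locB phipsi; have psiphi := comm_units_iso_sym phipsi.
have [A3|[h hB]|[h hB]] := locmx_cases locA;
  have [B3|[k kB]|[k kB]] := locmx_cases locB.
- exact: (mx3_standard charF2 locA locB phipsi).
- by case: (mx3_mx2_false phipsi A3 kB).
- by case: (mx3_mx1_false phipsi A3 kB).
- by case: (mx3_mx2_false psiphi B3 hB).
- have [h' hK h'K] := rmorphism_inverse hB;
  have [k' kK k'K] := rmorphism_inverse kB.
  have := SL2_standard F2 F3 (comm_units_iso_transport hK h'K kK k'K phipsi).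
  exact: standard_iso_transport.
- by case: (mx2_mx1_false phipsi hB kB).
- by case: (mx3_mx1_false psiphi B3 hB).
- by case: (mx2_mx1_false psiphi kB hB).
have [h' hK h'K] := rmorphism_inverse hB; have [k' kK k'K] := rmorphism_inverse kB.
(* Both groups are trivial here, so any ring isomorphism induces [phi]; both algebras being copies
   of ['M[F]_1] provides one. *)
left; exists (k \o h'); split; last first.
  move=> g /(mx1_comm_units hB)-> /=; rewrite !rmorph1.
  by apply: comm_units_hom1; case: phipsi.
split; first by exists (h \o k') => x /=; rewrite ?kK ?h'K ?hK ?k'K.
- by move=> x y /=; rewrite !rmorphD.
- by rewrite /= !rmorph1.
- by move=> x y /=; rewrite !rmorphM.
Qed.

End Main.

Lemma units_commutators_incl_inj (R : unitRingType) :
  injective (@units_commutators_incl R).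
Proof. by move=> g h /val_inj/val_inj. Qed.

Lemma comm_units_of_hom (R S : unitRingType)
    (phi : units_commutators R -> units_commutators S) :
    {morph phi : x y / (x * y)%g} ->
  exists2 f : R -> S, comm_units_hom f &
    forall g, f (units_commutators_incl g) = units_commutators_incl (phi g).
Proof.
move=> phiM; have ex x : exists y : S, forall g, units_commutators_incl g = x ->
    y = units_commutators_incl (phi g).
  (* Outside the commutator subgroup the value is arbitrary, and 0 is chosen. *)
  have [[g <-]|nx] := pselect (comm_units x); last first.
    by exists 0 => g gx; case: nx; exists g.
  by exists (units_commutators_incl (phi g)) => k /units_commutators_incl_inj->.
have [f fP] := choice ex; have fE g := fP _ g erefl.
exists f => //; split; first by move=> _ [g <-]; rewrite fE; exists (phi g).
move=> _ _ [g <-] [k <-]; rewrite !fE.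
by rewrite -[_ * _]/(units_commutators_incl (g * k)%g) fE phiM.
Qed.

Theorem theorem1 (F : fieldType)
    (char_neq2 : 2%N \notin [pchar F]) (char_neq3 : 3%N \notin [pchar F])
    (A B : unitAlgType F)
    (locmxA : unital_locally_matrix A) (locmxB : unital_locally_matrix B) :
  ((exists phi : units_commutators A -> units_commutators B,
      group_isomorphism phi) ->
   (exists theta : A -> B, ring_isomorphism theta) \/
   (exists theta : A -> B, ring_antiisomorphism theta))
  /\
  (forall phi : units_commutators A -> units_commutators B,
     group_isomorphism phi ->
     (exists theta1 : A -> B,
        ring_isomorphism theta1 /\
        forall g : units_commutators A,
          units_commutators_incl (phi g) = theta1 (units_commutators_incl g)) \/
     (exists theta2 : A -> B,
        ring_antiisomorphism theta2 /\
        forall g : units_commutators A,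
          units_commutators_incl (phi g) =
            theta2 (units_commutators_incl (g^-1)%g))).
Proof.
suff main (phi : units_commutators A -> units_commutators B) :
    group_isomorphism phi ->
    (exists theta1 : A -> B, ring_isomorphism theta1 /\
       forall g, units_commutators_incl (phi g) = theta1 (units_commutators_incl
         g)) \/
    (exists theta2 : A -> B, ring_antiisomorphism theta2 /\
       forall g, units_commutators_incl (phi g) =
         theta2 (units_commutators_incl (g^-1)%g)).
  split=> // -[phi /main[[theta [thetaI _]]|[theta [thetaI _]]]].
    by left; exists theta.
  by right; exists theta.
move=> [[psi phiK psiK] phiM].
have psiM : {morph psi : x y / (x * y)%g}.
  by move=> x y; rewrite -{1}(psiK x) -{1}(psiK y) -phiM phiK.
have [f fH fE] := comm_units_of_hom phiM;
  have [f' f'H f'E] := comm_units_of_hom psiM.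
have ff' : comm_units_iso f f'.
  by split=> // _ [g <-]; rewrite ?fE ?f'E ?fE ?phiK ?psiK.
have [[theta [thetaI thetaE]]|[theta [thetaI thetaE]]] :=
  comm_units_iso_standard char_neq2 char_neq3 locmxA locmxB ff'; [left|right].
  by exists theta; split=> // g; rewrite -fE; apply: thetaE; exists g.
by exists theta; split=> // g; rewrite -fE thetaE //; exists g.
Qed.
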